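(* Let $R$ be a root system of type BC of rank $r$ with non-negative multiplicities $a$, $2b$, $\iota$ on the roots $\pm\varepsilon_j\pm\varepsilon_k$, $\pm\varepsilon_j$, $\pm2\varepsilon_j$, respectively, let $\nu\ge0$, and write $|\mathrm{Cos}(t)|=\prod_{j=1}^r|\cos t_j|$, $|\mathrm{Sin}(t)|=\prod_{j=1}^r|\sin t_j|$. The spherical transforms of $|\mathrm{Cos}(t)|^{2\nu}$ and $|\mathrm{Sin}(t)|^{2\nu}$ are given by $$c_{\nu,r}(\underline{\mathbf m}):=\widehat{|\mathrm{Cos}|^{2\nu}}(\underline{\mathbf m})=N_\nu\prod_{j=1}^r\frac{\big(\nu+1+\frac a2(j-1)-\frac{m_j}2\big)_{m_j/2}}{\big(\nu+1+\iota+b+a(r-1)-\frac a2(j-1)\big)_{m_j/2}}$$ and $$s_{\nu,r}(\underline{\mathbf m}):=\widehat{|\mathrm{Sin}|^{2\nu}}(\underline{\mathbf m})=N'_\nu\prod_{j=1}^r\frac{\big(\nu+1+\frac a2(j-1)-\frac{m_j}2\big)_{m_j/2}}{\big(\nu+1+\iota+b+a(r-1)-\frac a2(j-1)\big)_{m_j/2}}\;\phi_{\underline{\mathbf m}}\big(\tfrac\pi2,\dots,\tfrac\pi2\big).$$ For root systems of type C or type D one has $b=0$, $\phi_{\underline{\mathbf m}}(\frac\pi2,\dots,\frac\pi2)=\prod_{j=1}^r(-1)^{m_j/2}$, and thus $$s_{\nu,r}(\underline{\mathbf m})=N'_\nu\prod_{j=1}^r\frac{\big(-\nu-\frac a2(j-1)\big)_{m_j/2}}{\big(\nu+1+\iota+b+a(r-1)-\frac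 a2(j-1)\big)_{m_j/2}} .$$
   Context: Root system: $R=\{\pm\varepsilon_j\pm\varepsilon_k,\ j\ne k\}\cup\{\pm\varepsilon_j\}\cup\{\pm2\varepsilon_j\}$ with real multiplicities $a,2b,\iota\ge0$; roots of multiplicity zero are omitted, so type B ($\iota=0<b$), type C ($b=0<\iota$) and type D ($b=\iota=0$, with $r\ge2$, $a>0$) are special cases. $W$ is its Weyl group; the $\varepsilon_j$ are dual to an orthonormal basis, identified with the standard basis $e_j$ of $\mathbb R^r$. $Q^\vee\subset\mathbb R^r$ is the lattice generated by the vectors $\hat\alpha/(\alpha,\alpha)$, $\alpha\in R$, where $\lambda(\hat\alpha)=(\lambda,\alpha)$ (i.e. by $\frac12(e_j\pm e_k)$, $e_j$, $\frac12e_j$ for the roots $\varepsilon_j\pm\varepsilon_k,\varepsilon_j,2\varepsilon_j$ that occur). $\rho_j=\iota+b+a(r-j)$. Trigonometric Cherednik operators: $$D_j=\partial_j-ia\sum_{k<j}\frac{1-s_{kj}}{1-e^{-2i(t_k-t_j)}}+ia\sum_{j<k}\frac{1-s_{jk}}{1-e^{-2i(t_j-t_k)}}+ia\sum_{k\ne j}\frac{1-\sigma_{jk}}{1-e^{-2i(t_j+t_k)}}+2i\iota\frac{1-\sigma_j}{1-e^{-4it_j}}+2ib\frac{1-\sigma_j}{1-e^{-2it_j}}-i\rho_j,$$ where $s_{jk},\sigma_{jk},\sigma_j$ are the reflections in $\varepsilon_j-\varepsilon_k$, $\varepsilon_j+\varepsilon_k$, $\varepsilon_j$ acting on functions of $t$.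 These operators commute. Measure: $d\mu_R(t)=\prod_{j<k}|2\sin(t_j-t_k)\,2\sin(t_j+t_k)|^a\prod_j|2\sin t_j|^{2b}|2\sin2t_j|^{\iota}\,dt_1\cdots dt_r$ on $\mathbb R^r/2\pi Q^\vee$. $\underline{\mathbf m}=(m_1,\dots,m_r)$ with all $m_j/2\in\mathbb Z$ and $m_1\ge\dots\ge m_r\ge0$ (for type D: $m_1\ge\dots\ge m_{r-1}\ge|m_r|$). $\phi_{\underline{\mathbf m}}$ is the Heckman–Opdam Jacobi polynomial with highest exponent $\underline{\mathbf m}$: the $W$-invariant trigonometric polynomial with $p(D_1,\dots,D_r)\phi_{\underline{\mathbf m}}=p(i(m_1+\rho_1),\dots,i(m_r+\rho_r))\phi_{\underline{\mathbf m}}$ for all $W$-invariant polynomials $p$, normalized by $\phi_{\underline{\mathbf m}}(0)=1$. Spherical transform: $\hat f(\underline{\mathbf m})=\int_{\mathbb R^r/2\pi Q^\vee}f(t)\phi_{\underline{\mathbf m}}(t)\,d\mu_R(t)$. $N_\nu=\int|\mathrm{Cos}(t)|^{2\nu}d\mu_R(t)$, $N'_\nu=\int|\mathrm{Sin}(t)|^{2\nu}d\mu_R(t)$ over $\mathbb R^r/2\pi Q^\vee$. $(x)_k=x(x+1)\cdots(x+k-1)$; for negative integers $k$, $(x)_k=\Gamma(x+k)/\Gamma(x)$, with quotients understood by continuity in $\nu$. *)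

(* Defs.v *)
From mathcomp Require Import all_boot all_order all_algebra.
From mathcomp Require Import all_classical all_reals all_analysis.
From mathcomp Require Import complex lra.
From mathcomp Require mpoly.

Set Implicit Arguments.
Unset Strict Implicit.
Unset Printing Implicit Defensive.

Import Order.TTheory GRing.Theory Num.Theory.
Import numFieldNormedType.Exports.

Local Open Scope ring_scope.
Local Open Scope complex_scope.

Section Vectors.
Context {F : fieldType} {r : nat}.

Definition eps (j : 'I_r) : 'rV[F]_r := delta_mx 0 j.

Definition dot (x y : 'rV[F]_r) : F := \sum_(j < r) x 0 j * y 0 j.

Definition refl (al x : 'rV[F]_r) : 'rV[F]_r :=
  x - (2 * dot al x / dot al al) *: al.

End Vectors.

Section ComplexFunctions.
Context {R : realType}.

Definition expi (x : R) : R[i] := cos x +i* sin x.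

Definition partialC {r : nat} (j : 'I_r) (f : 'rV[R]_r -> R[i]) (t : 'rV[R]_r)
    : R[i] :=
  'D_(eps j) (fun u => complex.Re (f u)) t
    +i* 'D_(eps j) (fun u => complex.Im (f u)) t.

(* (x)_k = Gamma(x + k) / Gamma(x) for an integer k.  For k = - n < 0 this is
   1 / ((x - 1) ... (x - n)).  As 0^-1 = 0, dividing by (x)_k with k < 0 is
   multiplying by the polynomial (x - 1) ... (x - n), also at its zeros, so that
   a quotient with such a denominator is its own continuous extension. *)
Definition poch (x : R) (k : int) : R :=
  match k with
  | Posz n => \prod_(i < n) (x + i%:R)
  | Negz n => (\prod_(i < n.+1) (x - i.+1%:R))^-1
  end.

(* Iterated Lebesgue integral over the box prod_j [0, L j]. *)
Fixpoint box_integral (n : nat) : ('I_n -> R) -> ('rV[R]_n -> R) -> R :=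
  match n with
  | 0 => fun _ f => f 0
  | n'.+1 => fun L f =>
      \int[lebesgue_measure]_(x in `[0, L ord0]%classic)
        box_integral (fun j => L (lift ord0 j))
          (fun v : 'rV[R]_n' => f (row_mx (x%:M : 'M[R]_1) v))
  end.

End ComplexFunctions.

(* The multiplicities of +-e_j +- e_k, +-e_j, +-2 e_j are a, 2 b and iota. *)
Section RootSystem.
Context {R : realType} {r : nat}.
Variables a b iota : R.

Definition typeC : Prop := b = 0 /\ 0 < iota.
Definition typeD : Prop := [/\ b = 0, iota = 0, (2 <= r)%N & 0 < a].

(* The roots that occur, over any field: W acts on real vectors (points of the
   torus) and on complex ones (spectral parameters). *)
Variant pos_root (F : fieldType) : 'rV[F]_r -> Prop :=
| PosSub (j k : 'I_r) : (j < k)%N -> a != 0 -> pos_root (eps j - eps k)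
| PosAdd (j k : 'I_r) : (j < k)%N -> a != 0 -> pos_root (eps j + eps k)
| PosShort (j : 'I_r) : b != 0 -> pos_root (eps j)
| PosLong (j : 'I_r) : iota != 0 -> pos_root (2 *: eps j).

Definition is_root (F : fieldType) (al : 'rV[F]_r) : Prop :=
  pos_root al \/ pos_root (- al).

Inductive weyl (F : fieldType) : ('rV[F]_r -> 'rV[F]_r) -> Prop :=
| WeylId : weyl id
| WeylRefl al w : is_root al -> weyl w -> weyl (refl al \o w).

Definition weyl_invariant (F : fieldType) (T : Type) (f : 'rV[F]_r -> T) :=
  forall w, weyl w -> forall x, f (w x) = f x.

Inductive coroot_lattice : 'rV[R]_r -> Prop :=
| Coroot0 : coroot_lattice 0
| CorootD al q : is_root al -> coroot_lattice q ->
    coroot_lattice ((dot al al)^-1 *: al + q).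

Definition rho (j : 'I_r) : R := iota + b + a * (r - j.+1)%:R.

(* Exponents: the characters exp(i mu.t) of R^r / 2 pi Q^vee. *)
Definition weight (mu : 'rV[R]_r) : Prop :=
  forall q, coroot_lattice q -> dot mu q \is a Num.int.

(* A root al enters the Cherednik operators through the exponential
   exp(- 2 i al.t), hence the factor 2. *)
Inductive dominated (m : 'rV[R]_r) : 'rV[R]_r -> Prop :=
| DomRefl : dominated m m
| DomSub al mu : pos_root al -> dominated m mu -> dominated m (mu - 2 *: al).

Definition trig_poly_with (f : 'rV[R]_r -> R[i]) (s : seq 'rV[R]_r)
    (c : 'rV[R]_r -> R[i]) : Prop :=
  [/\ uniq s, forall mu, mu \in s -> weight mu
    & forall t, f t = \sum_(mu <- s) c mu * expi (dot mu t)].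

Definition highest_exponent (f : 'rV[R]_r -> R[i]) (m : 'rV[R]_r) : Prop :=
  exists s c, [/\ trig_poly_with f s c, m \in s, c m != 0
    & forall mu, mu \in s -> dominated m mu].

Definition cherednik (j : 'I_r) (f : 'rV[R]_r -> R[i]) (t : 'rV[R]_r) : R[i] :=
  partialC j f t
  - 'i%C * a%:C * (\sum_(k < r | (k < j)%N)
      (f t - f (refl (eps k - eps j) t)) / (1 - expi (- 2 * (t 0 k - t 0 j))))
  + 'i%C * a%:C * (\sum_(k < r | (j < k)%N)
      (f t - f (refl (eps j - eps k) t)) / (1 - expi (- 2 * (t 0 j - t 0 k))))
  + 'i%C * a%:C * (\sum_(k < r | k != j)
      (f t - f (refl (eps j + eps k) t)) / (1 - expi (- 2 * (t 0 j + t 0 k))))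
  + 2 * 'i%C * iota%:C
      * ((f t - f (refl (eps j) t)) / (1 - expi (- 4 * t 0 j)))
  + 2 * 'i%C * b%:C
      * ((f t - f (refl (eps j) t)) / (1 - expi (- 2 * t 0 j)))
  - 'i%C * (rho j)%:C * f t.

Definition cherednik_monomial (k : mpoly.multinom r)
    : ('rV[R]_r -> R[i]) -> ('rV[R]_r -> R[i]) :=
  \big[comp/idfun]_(j < r) iter (mpoly.fun_of_multinom k j) (cherednik j).

Definition cherednik_poly (p : mpoly.mpoly r R[i]) (f : 'rV[R]_r -> R[i])
    (t : 'rV[R]_r) : R[i] :=
  \sum_(k <- mpoly.msupp p) mpoly.mcoeff k p * cherednik_monomial k f t.

(* Points where no denominator of a Cherednik operator vanishes.  They form a
   W-stable open dense set.  On the other points the quotients have removable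
   singularities, but x / 0 = 0 does not give their limits. *)
Definition regular (t : 'rV[R]_r) : Prop :=
  forall al, is_root al -> expi (- 2 * dot al t) != 1.

Definition polyval (p : mpoly.mpoly r R[i]) (x : 'rV[R[i]]_r) : R[i] :=
  mpoly.meval (fun j => x 0 j) p.

Definition int_vec (m : 'I_r -> int) : 'rV[R]_r := \row_j (m j)%:~R.

Definition spectral (m : 'I_r -> int) : 'rV[R[i]]_r :=
  \row_j ('i%C * ((m j)%:~R + rho j)%:C).

Definition dominant_even (m : 'I_r -> int) : Prop :=
  [/\ forall j, (2 %| m j)%Z,
      forall j k : 'I_r, (j < k)%N -> m k <= m j
    & (typeD -> forall j k : 'I_r, (j < k)%N -> `|m k| <= m j)
      /\ (~ typeD -> forall j, 0 <= m j)].

Definition jacobi_polynomial (m : 'I_r -> int) (phi : 'rV[R]_r -> R[i]) :=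
  [/\ weyl_invariant phi,
      highest_exponent phi (int_vec m),
      (forall p : mpoly.mpoly r R[i], weyl_invariant (polyval p) ->
         forall t, regular t ->
           cherednik_poly p phi t = polyval p (spectral m) * phi t)
    & phi 0 = 1].

Definition density (t : 'rV[R]_r) : R :=
  (\prod_(j < r) \prod_(k < r | (j < k)%N)
     `|2 * sin (t 0 j - t 0 k) * (2 * sin (t 0 j + t 0 k))| `^ a)
  * \prod_(j < r)
     (`|2 * sin (t 0 j)| `^ (2 * b) * `|2 * sin (2 * t 0 j)| `^ iota).

(* The box prod_j [0, torus_side j[ is a fundamental domain of 2 pi Q^vee:
   lemma torus_box_fundamental. *)
Definition torus_side (j : 'I_r) : R :=
  if (iota != 0) || (a != 0) && (0 < j)%N then pi else 2 * pi.

(* Integration over R^r / 2 pi Q^vee against d mu_R. *)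
Definition torus_integral (f : 'rV[R]_r -> R) : R :=
  box_integral torus_side (fun t => f t * density t).

Definition spherical_transform (phi : 'rV[R]_r -> R[i]) (f : 'rV[R]_r -> R)
    : R[i] :=
  torus_integral (fun t => complex.Re ((f t)%:C * phi t))
    +i* torus_integral (fun t => complex.Im ((f t)%:C * phi t)).

Definition absCos (t : 'rV[R]_r) : R := \prod_(j < r) `|cos (t 0 j)|.
Definition absSin (t : 'rV[R]_r) : R := \prod_(j < r) `|sin (t 0 j)|.

Definition normCos (nu : R) : R :=
  torus_integral (fun t => absCos t `^ (2 * nu)).
Definition normSin (nu : R) : R :=
  torus_integral (fun t => absSin t `^ (2 * nu)).

Definition half_pi_vec : 'rV[R]_r := const_mx (pi / 2).

Lemma coroot_latticeD q q' :
  coroot_lattice q -> coroot_lattice q' -> coroot_lattice (q + q').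
Proof.
move=> + hq'; elim=> [|al {}q hal _ IH]; first by rewrite add0r.
by rewrite -addrA; apply: CorootD.
Qed.

Lemma coroot_latticeN q : coroot_lattice q -> coroot_lattice (- q).
Proof.
elim=> [|al {}q hal _ IH]; first by rewrite oppr0; constructor.
have -> : - ((dot al al)^-1 *: al + q)
    = (dot (- al) (- al))^-1 *: (- al) + - q.
  rewrite opprD scalerN; congr (- (_^-1 *: _) + _).
  by apply: eq_bigr => j _; rewrite !mxE mulrNN.
by apply: CorootD => //; case: hal => h; [right; rewrite opprK|left].
Qed.

Lemma coroot_latticeZ (k : int) q :
  coroot_lattice q -> coroot_lattice (k%:~R *: q).
Proof.
move=> hq; have hn n : coroot_lattice (n%:R *: q).
  elim: n => [|n IH]; first by rewrite scale0r; constructor.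
  by rewrite -natr1 scalerDl scale1r; apply: coroot_latticeD.
case: k => n; first exact: hn.
by rewrite NegzE mulrNz scaleNr; apply/coroot_latticeN/hn.
Qed.

Lemma coroot_lattice_sum (I : Type) (s : seq I) (P : pred I)
    (q : I -> 'rV[R]_r) :
  (forall i, P i -> coroot_lattice (q i)) ->
  coroot_lattice (\sum_(i <- s | P i) q i).
Proof.
move=> h; elim/big_rec: _ => [|i x Pi IH]; first by constructor.
exact: coroot_latticeD (h _ Pi) IH.
Qed.

Lemma dotDl (x y z : 'rV[R]_r) : dot (x + y) z = dot x z + dot y z.
Proof. by rewrite -big_split; apply: eq_bigr => j _; rewrite mxE mulrDl. Qed.
Lemma dotC (x y : 'rV[R]_r) : dot x y = dot y x.
Proof. by apply: eq_bigr => j _; rewrite mulrC. Qed.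
Lemma dotZl (c : R) (x y : 'rV[R]_r) : dot (c *: x) y = c * dot x y.
Proof. by rewrite mulr_sumr; apply: eq_bigr => j _; rewrite mxE mulrA. Qed.
Lemma dot_eps (j k : 'I_r) : dot (eps j) (eps k) = (j == k)%:R :> R.
Proof.
rewrite /dot (bigD1 j) //= big1 => [|i ij].
  by rewrite !mxE !eqxx mul1r addr0.
by rewrite !mxE (negbTE ij) mul0r.
Qed.

Lemma dot_addss (j k : 'I_r) (c : R) : j != k -> c ^+ 2 = 1 ->
  dot (eps j + c *: eps k) (eps j + c *: eps k) = 2 :> R.
Proof.
move=> jk c2; rewrite dotDl dotZl !(dotC _ (_ + _)) !dotDl !dotZl !dot_eps.
rewrite !eqxx [k == j]eq_sym (negbTE jk) mulr0 add0r addr0 mulr1 -expr2 c2.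
by rewrite -mulr2n.
Qed.

Lemma dot_sub (j k : 'I_r) : j != k ->
  dot (eps j - eps k) (eps j - eps k) = 2 :> R.
Proof. by move=> jk; rewrite -scaleN1r dot_addss // sqrrN expr1n. Qed.

Lemma dot_add (j k : 'I_r) : j != k ->
  dot (eps j + eps k) (eps j + eps k) = 2 :> R.
Proof.
by move=> jk; rewrite -[X in _ + X]scale1r dot_addss // expr1n.
Qed.

Lemma coroot_sub (j k : 'I_r) : a != 0 -> j != k ->
  coroot_lattice (2^-1 *: (eps j - eps k)).
Proof.
move=> a0 jk; rewrite -[_ *: _]addr0.
have -> : 2 = dot (eps j - eps k) (eps j - eps k) :> R.
  by rewrite dot_sub.
apply: CorootD; last by constructor.
have := jk; rewrite neq_ltn => /orP[] h; first by left; constructor.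
by right; rewrite opprB; constructor.
Qed.

Lemma coroot_add (j k : 'I_r) : a != 0 -> j != k ->
  coroot_lattice (2^-1 *: (eps j + eps k)).
Proof.
move=> a0 jk; rewrite -[_ *: _]addr0.
have -> : 2 = dot (eps j + eps k) (eps j + eps k) :> R.
  by rewrite dot_add.
apply: CorootD; last by constructor.
have := jk; rewrite neq_ltn => /orP[] h; first by left; constructor.
by left; rewrite addrC; constructor.
Qed.

Lemma coroot_short (j : 'I_r) : b != 0 -> coroot_lattice (eps j).
Proof.
move=> b0; rewrite -[eps j]addr0 -[eps j]scale1r.
have -> : 1 = (dot (eps j) (eps j))^-1 :> R by rewrite dot_eps eqxx invr1.
by apply: CorootD; [left; constructor|constructor].
Qed.

Lemma coroot_long (j : 'I_r) : iota != 0 -> coroot_lattice (2^-1 *: eps j).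
Proof.
move=> i0; rewrite -[_ *: _]addr0.
have -> : 2^-1 *: eps j
    = (dot (2 *: eps j) (2 *: eps j))^-1 *: (2 *: eps j) :> 'rV[R]_r.
  rewrite dotZl dotC dotZl dot_eps eqxx mulr1 scalerA invfM -mulrA mulVf.
    by rewrite mulr1.
  by rewrite pnatr_eq0.
by apply: CorootD; [left; constructor|constructor].
Qed.

Lemma coroot_inv q : coroot_lattice q ->
  [/\ forall j, 2 * q 0 j \is a Num.int,
      iota = 0 -> a = 0 -> forall j, q 0 j \is a Num.int
    & iota = 0 -> \sum_(j < r) q 0 j \is a Num.int].
Proof.
have sum_eps j : \sum_(i < r) (eps j : 'rV[R]_r) 0 i = 1.
  rewrite (bigD1 j) //= big1 => [|i ij]; first by rewrite !mxE !eqxx addr0.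
  by rewrite !mxE (negbTE ij).
have int_eps j i : (eps j : 'rV[R]_r) 0 i \is a Num.int.
  by rewrite mxE; case: eqP => //= _; case: eqP => //=.
have n2 : 2 != 0 :> R by rewrite pnatr_eq0.
have pos (al : 'rV[R]_r) : pos_root al -> let q := (dot al al)^-1 *: al in
  [/\ forall j, 2 * q 0 j \is a Num.int,
      iota = 0 -> a = 0 -> forall j, q 0 j \is a Num.int
    & iota = 0 -> \sum_(j < r) q 0 j \is a Num.int].
  case=> [j k jk a0|j k jk a0|j b0|j i0] /=.
  - have -> : dot (eps j - eps k) (eps j - eps k) = 2 :> R.
      by rewrite dot_sub // neq_ltn jk.
    split=> [i|_ a0'|_]; last 2 first.
    + by rewrite a0' eqxx in a0.
    + under eq_bigr do rewrite mxE.
      rewrite -mulr_sumr; under eq_bigr do rewrite mxE [X in _ + X]mxE.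
      by rewrite sumrB !sum_eps subrr mulr0 rpred0.
    + by rewrite mxE mulrA mulfV // mul1r mxE [X in _ + X]mxE rpredB.
  - have -> : dot (eps j + eps k) (eps j + eps k) = 2 :> R.
      by rewrite dot_add // neq_ltn jk.
    split=> [i|_ a0'|_]; last 2 first.
    + by rewrite a0' eqxx in a0.
    + under eq_bigr do rewrite mxE.
      rewrite -mulr_sumr; under eq_bigr do rewrite mxE.
      by rewrite big_split /= !sum_eps mulVf // rpred1.
    + by rewrite mxE mulrA mulfV // mul1r mxE rpredD.
  - rewrite dot_eps eqxx invr1 scale1r; split=> [i|_ _ i|_].
    + by rewrite rpredM // rpred_nat.
    + exact: int_eps.
    + by rewrite sum_eps rpred1.
  - have -> : (dot (2 *: eps j) (2 *: eps j))^-1 *: (2 *: eps j)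
        = 2^-1 *: eps j :> 'rV[R]_r.
      rewrite dotZl dotC dotZl dot_eps eqxx mulr1 scalerA invfM -mulrA mulVf //.
      by rewrite mulr1.
    split=> [i|i0'|i0']; last 2 first.
    + by rewrite i0' eqxx in i0.
    + by rewrite i0' eqxx in i0.
    + by rewrite mxE mulrA mulfV // mul1r.
elim=> [|al {}q hal _ [IH1 IH2 IH3]].
  split=> [j|_ _ j|_]; rewrite ?mxE ?mulr0 ?rpred0 //.
  by rewrite big1 ?rpred0 // => j _; rewrite mxE.
suff [h1 h2 h3] : let q := (dot al al)^-1 *: al in
  [/\ forall j, 2 * q 0 j \is a Num.int,
      iota = 0 -> a = 0 -> forall j, q 0 j \is a Num.int
    & iota = 0 -> \sum_(j < r) q 0 j \is a Num.int].
  split=> [j|i0 a0 j|i0].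
  - by rewrite mxE mulrDr rpredD.
  - by rewrite mxE rpredD // ?h2 ?IH2.
  - by under eq_bigr do rewrite mxE; rewrite big_split /= rpredD // ?h3 ?IH3.
case: hal => [|/pos]; first exact: pos.
have -> : dot (- al) (- al) = dot al al.
  by apply: eq_bigr => j _; rewrite !mxE mulrNN.
rewrite /= scalerN => -[h1 h2 h3]; split=> [j|i0 a0 j|i0].
- by have := h1 j; rewrite mxE mulrN rpredN.
- by have := h2 i0 a0 j; rewrite mxE rpredN.
- have := h3 i0; under eq_bigr do rewrite mxE.
  by rewrite sumrN rpredN.
Qed.

Lemma int_lt1 (x : R) : x \is a Num.int -> `|x| < 1 -> x = 0.
Proof.
move=> /intrP[k ->]; rewrite -intr_norm (_ : 1 = 1%:~R) // ltr_int => h.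
by have -> : k = 0 by case: k h => -[].
Qed.

Lemma torus_box_fundamental :
  [\/ 0 < iota, 0 < b | typeD] -> forall t : 'rV[R]_r,
  exists! q, coroot_lattice q /\
    forall j, 0 <= t 0 j + 2 * pi * q 0 j < torus_side j.
Proof.
move=> hR t.
have pi2 : 0 < 2 * pi :> R by rewrite mulr_gt0 // pi_gt0.
pose u j : R := t 0 j / (2 * pi).
have tu j : t 0 j = 2 * pi * u j by rewrite mulrC divfK // gt_eqF.
pose s (j : 'I_r) : R :=
  if (iota != 0) || (a != 0) && (0 < j)%N then 2^-1 else 1.
have ts j : torus_side j = 2 * pi * s j.
  rewrite /torus_side /s; case: ifP => _; last by rewrite mulr1.
  by rewrite [2 * _]mulrC mulfK // pnatr_eq0.
have box q : (forall j, 0 <= t 0 j + 2 * pi * q 0 j < torus_side j) <->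
    (forall j, 0 <= u j + q 0 j < s j).
  split=> h j; have := h j; rewrite tu ts -mulrDr.
    by rewrite pmulr_rge0 // ltr_pM2l.
  by rewrite pmulr_rge0 // ltr_pM2l.
have half (x : R) : 0 <= x - (Num.floor (2 * x))%:~R / 2 < 2^-1.
  have := floor_itv (2 * x); rewrite intrD1 => /andP[h1 h2].
  by apply/andP; split; lra.
have whole (x : R) : 0 <= x - (Num.floor x)%:~R < 1.
  have := floor_itv x; rewrite intrD1 => /andP[h1 h2].
  by apply/andP; split; lra.
have rowE (q : 'rV[R]_r) : q = \sum_(j < r) q 0 j *: eps j.
  exact: row_sum_delta.
suff [q [hq /box bq]] : exists q, coroot_lattice q /\
    forall j, 0 <= u j + q 0 j < s j.
  exists q; split=> // q' [hq' /box bq'].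
  move/box: bq => bq.
  have hd := coroot_latticeD hq (coroot_latticeN hq').
  have [d1 d2 d3] := coroot_inv hd.
  have small j : `|(q - q') 0 j| < s j.
    have /andP[? ?] := bq j; have /andP[? ?] := bq' j.
    rewrite !mxE ltr_norml; apply/andP; split; lra.
  have small2 j : s j = 2^-1 -> (q - q') 0 j = 0.
    move=> sj; have := small j; rewrite sj => h.
    suff /eqP : 2 * (q - q') 0 j = 0 by rewrite mulf_eq0 pnatr_eq0 /= => /eqP.
    apply: int_lt1; first exact: d1.
    by rewrite normrM ger0_norm // -ltr_pdivlMl // mulr1.
  suff /eqP : q - q' = 0 by rewrite subr_eq0 => /eqP.
  apply/rowP => j; rewrite [RHS]mxE.
  have [i0|i0] := eqVneq iota 0; last by apply: small2; rewrite /s i0.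
  have lt1 : `|(q - q') 0 j| < 1.
    apply: lt_le_trans (small j) _; rewrite /s; case: ifP => // _; lra.
  have [a0|a0] := eqVneq a 0; first by apply: int_lt1 => //; apply: d2.
  have [j0|j0] := posnP j; last by apply: small2; rewrite /s a0 j0 /= orbT.
  apply: int_lt1 => //; have := d3 i0.
  rewrite (bigD1 j) //= big1 ?addr0 // => k kj; apply: small2.
  rewrite /s i0 eqxx a0 lt0n /=; case: eqP => [k0|] //.
  by case/eqP: kj; apply: val_inj; rewrite /= k0 j0.
have [i0|i0] := eqVneq iota 0; last first.
  exists (\row_j - ((Num.floor (2 * u j))%:~R / 2)); split=> [|j]; last first.
    by rewrite mxE /s i0 half.
  rewrite [X in coroot_lattice X]rowE; apply: coroot_lattice_sum => j _.
  rewrite mxE -mulNr -mulrNz -scalerA.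
  exact/coroot_latticeZ/coroot_long.
have [a0|a0] := eqVneq a 0.
  have b0 : b != 0.
    by case: hR => [|/gt_eqF->//|[_ _ _]]; rewrite ?i0 ?a0 ltxx.
  exists (\row_j - (Num.floor (u j))%:~R); split=> [|j]; last first.
    by rewrite mxE /s i0 a0 eqxx /= whole.
  rewrite [X in coroot_lattice X]rowE; apply: coroot_lattice_sum => j _.
  rewrite mxE -mulrNz.
  exact/coroot_latticeZ/coroot_short.
have [r0|r0] := posnP r.
  exists 0; split=> [|j]; first by constructor.
  by have := ltn_ord j; rewrite {2}r0.
pose o := Ordinal r0.
have eo : coroot_lattice (eps o).
  have [b0|b0] := eqVneq b 0; last exact: coroot_short.
  have r2 : (1 < r)%N by case: hR => [||[]//]; rewrite ?i0 ?b0 ltxx.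
  pose p := Ordinal r2; have op : o != p by [].
  have -> : eps o = 2^-1 *: (eps o - eps p) + 2^-1 *: (eps o + eps p)
      :> 'rV[R]_r.
    by apply/rowP => i; rewrite !mxE; lra.
  by apply: coroot_latticeD; [apply: coroot_sub|apply: coroot_add].
pose k j := Num.floor (2 * u j).
pose S : R := \sum_(j < r | j != o) (k j)%:~R / 2.
pose q0 := Num.floor (u o + S).
pose q : 'rV[R]_r := \sum_(j < r | j != o) (- k j)%:~R *: (2^-1 *: (eps j - eps o))
  + (- q0)%:~R *: eps o.
exists q; split.
  apply: coroot_latticeD; last exact: coroot_latticeZ.
  by apply: coroot_lattice_sum => j jo; apply/coroot_latticeZ/coroot_sub.
have qo : q 0 o = S - q0%:~R.
  rewrite /q mxE summxE; congr (_ + _).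
    apply: eq_bigr => j jo; rewrite !mxE eqxx (eq_sym o j) (negbTE jo).
    by rewrite mulrNz /= sub0r mulrN mulr1 mulNr mulrN opprK.
  by rewrite !mxE !eqxx mulr1 mulrNz.
have qj j : j != o -> q 0 j = - ((k j)%:~R / 2).
  move=> jo; rewrite /q mxE summxE (bigD1 j) //= big1 => [|i /andP[_ ij]].
    rewrite !mxE !eqxx /= (negbTE jo) mulr0 addr0 addr0 subr0 mulr1.
    by rewrite mulrNz mulNr.
  by rewrite !mxE eqxx [j == i]eq_sym (negbTE ij) (negbTE jo) /= subr0 !mulr0.
move=> j; have [->|jo] := eqVneq j o.
  by rewrite qo /s i0 eqxx a0 ltnn /= addrA whole.
have j0 : (0 < j)%N by rewrite lt0n; apply: contra jo => /eqP e; apply/eqP/val_inj.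
by rewrite qj // /s a0 j0 /= orbT half.
Qed.

End RootSystem.

Arguments typeD {R} r a b iota.
Arguments normCos {R} r a b iota nu.
Arguments normSin {R} r a b iota nu.

(* Main.v *)
(* The Cherednik operators D_j are skew-adjoint for the density.  They are
   triangular on exponentials, so that a commutator maps an exponential to a
   strictly lower polynomial; by induction that polynomial has norm 0, hence the
   D_j commute.  When the density is multiplied by |Cos|^(2 kappa) (or
   |Sin|^(2 kappa)), D_j stays skew-adjoint up to a multiple of tan t_j (or
   cot t_j).  Put lam = 2 (kappa + 1) + iota + b + a (r - 1).  Integrated by parts
   one after the other against prod_j cos^2 t_j, the operators
     D_0 + i lam, ..., D_(r-1) + i lam, D_(r-1) - i lam, ..., D_0 - i lam
   remove its 2 r linear factors one by one, while their product acts on phi by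
   prod_j (lam^2 - (m_j + rho_j)^2).  So the spherical transform at kappa is an
   explicit multiple of the one at kappa + 1, and this recurrence is determined
   by its limit at infinity: the weight concentrates at 0 (or at
   (pi/2, ..., pi/2)), and the normalised transform tends to the value of phi
   there.
   Integrals are used as limits of means over the grids (pi / n) Z^r, for which
   invariance under W is an exact identity. *)

Require Import Defs.
From mathcomp Require Import all_boot all_order all_fingroup all_algebra.
From mathcomp Require Import all_classical all_reals all_analysis.
From mathcomp Require Import complex ring lra zify.
From mathcomp Require mpoly.

Set Implicit Arguments.
Unset Strict Implicit.
Unset Printing Implicit Defensive.

Import Order.TTheory GRing.Theory Num.Theory.
Import numFieldNormedType.Exports.

Local Open Scope ring_scope.
Local Open Scope complex_scope.

(** The density is the obstacle: for small multiplicities it is not differentiable on the walls, and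
    its logarithmic derivative is singular there. Each factor q^p is therefore replaced by (q + h)^p
    with h > 0, and the mean is folded by the reflection of each root, so that the singular
    cotangents meet only differences G - G o s, which vanish on the wall. The bounds are then
    uniform in h, and h may tend to 0. Commutation matters because the spectral equation is given
    for W-invariant polynomials only, while the integration by parts applies the D_j in a prescribed
    order; after reordering, (D_j + i lam) (D_j - i lam) = D_j^2 + lam^2, and the product over j is
    invariant. The recurrence also carries constants that do not depend on m. The constant function
    1 obeys it with m = 0, so they cancel when the transform is divided by the total mass; the
    recurrence of the masses also shows that consecutive masses have ratio tending to 1, which is
    what forces concentration. A sign e treats cosine and sine together: their squares are (1 + e
    cos 2t) / 2. *)

Local Notation "x ^*" := (conjc x) : ring_scope.

(** * Uniform continuity *)

Section UniformContinuity.
Local Open Scope classical_set_scope.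
Local Open Scope ring_scope.
Context {R : realType}.

(** The relation [nr] is a parameter because the same closure lemmas serve for rows and for pairs of
    a row and a regularisation parameter; for the latter only parameters in [0, 1] are related to
    anything. Boundedness is part of the notion so that it is stable under products. *)
Definition ucont {X : Type} (nr : R -> X -> X -> Prop) (F : X -> R) : Prop :=
  (exists M, forall d x y, nr d x y -> `|F x| <= M /\ `|F y| <= M) /\
  forall e, 0 < e -> exists2 d, 0 < d &
    forall x y, nr d x y -> `|F x - F y| < e.

Section Closure.
Context {X : Type} {nr : R -> X -> X -> Prop}.
Hypothesis nrW : forall d d' x y, d <= d' -> nr d x y -> nr d' x y.
Implicit Types F G : X -> R.

Lemma ucont_cst c : ucont nr (fun=> c).
Proof.
split; first by exists `|c|.
by move=> e e0; exists 1 => // x y _; rewrite subrr normr0.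
Qed.

Lemma ucont_ext F G : F =1 G -> ucont nr F -> ucont nr G.
Proof. by move=> /funext->. Qed.

Lemma ucontD F G : ucont nr F -> ucont nr G -> ucont nr (fun x => F x + G x).
Proof.
move=> [[M FM] Fu] [[N GN] Gu]; split.
  exists (M + N) => d x y xy; have [? ?] := FM d x y xy.
  have [? ?] := GN d x y xy.
  by split; apply: le_trans (ler_normD _ _) _; rewrite lerD.
move=> e e0; have e2 : 0 < e / 2 by rewrite divr_gt0.
have [d1 d10 h1] := Fu _ e2; have [d2 d20 h2] := Gu _ e2.
exists (Num.min d1 d2) => [|x y xy]; first by rewrite lt_min d10.
have := h1 x y; have := h2 x y.
move=> /(_ (nrW _ xy)); rewrite ge_min lexx orbT => /(_ isT) k2.
move=> /(_ (nrW _ xy)); rewrite ge_min lexx => /(_ isT) k1.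
rewrite opprD addrACA [e]splitr.
by apply: le_lt_trans (ler_normD _ _) _; rewrite ltrD.
Qed.

Lemma ucontM F G : ucont nr F -> ucont nr G -> ucont nr (fun x => F x * G x).
Proof.
move=> [[M FM] Fu] [[N GN] Gu]; split.
  exists (M * N) => d x y xy; have [? ?] := FM d x y xy.
  have [? ?] := GN d x y xy.
  by split; rewrite normrM ler_pM.
move=> e e0.
pose M' := `|M| + 1; pose N' := `|N| + 1.
have M0 : 0 < M' by rewrite ltr_wpDl.
have N0 : 0 < N' by rewrite ltr_wpDl.
have [d1 d10 h1] := Fu (e / 2 / N') ltac:(by rewrite !divr_gt0).
have [d2 d20 h2] := Gu (e / 2 / M') ltac:(by rewrite !divr_gt0).
exists (Num.min d1 d2) => [|x y xy]; first by rewrite lt_min d10.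
have := h1 x y; have := h2 x y.
move=> /(_ (nrW _ xy)); rewrite ge_min lexx orbT => /(_ isT) k2.
move=> /(_ (nrW _ xy)); rewrite ge_min lexx => /(_ isT) k1.
have [Fx _] := FM _ x y xy; have [_ Gy] := GN _ x y xy.
have Fx' : `|F x| <= M' by rewrite (le_trans Fx)// (le_trans (ler_norm _))// lerDl.
have Gy' : `|G y| <= N' by rewrite (le_trans Gy)// (le_trans (ler_norm _))// lerDl.
have -> : F x * G x - F y * G y = F x * (G x - G y) + (F x - F y) * G y by ring.
rewrite [e]splitr (le_lt_trans (ler_normD _ _))// !normrM ltr_leD//.
- rewrite ltr_pdivlMr// in k2; apply: le_lt_trans k2.
  by rewrite mulrC ler_wpM2l.
- have : `|F x - F y| * `|G y| <= e / 2 / N' * N' by rewrite ler_pM// ltW.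
  by rewrite divfK ?gt_eqF.
Qed.

Lemma ucontN F : ucont nr F -> ucont nr (fun x => - F x).
Proof.
move=> uF; apply: ucont_ext (ucontM (ucont_cst (-1)) uF) => x /=.
by rewrite mulN1r.
Qed.

Lemma heine_segment (h : R -> R) (a b e : R) : 0 < e ->
  {within `[a, b]%classic, continuous h} ->
  exists2 d, 0 < d & forall x y, a <= x <= b -> a <= y <= b ->
    `|x - y| < d -> `|h x - h y| < e.
Proof.
move=> e0 /subspace_continuousP hc.
have K := @segment_compact R a b.
(* The modulus is the filter variable, tending to 0 from the right, so that one modulus serves the
   whole segment. *)
have /compact_near_coveringP/(_ _ (0^'+)%R) := K.
move=> /(_ _ (fun d x => a <= x <= b -> forall y, a <= y <= b ->
  `|x - y| < d -> `|h x - h y| < e)) [x /= xab|].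
  have e2 : 0 < e / 2 by rewrite divr_gt0.
  have := hc x xab => /cvgrPdist_lt /(_ _ e2).
  rewrite /= near_withinE => /nbhs_ballP[d /= d0 dh].
  have d2 : 0 < d / 2 by rewrite divr_gt0.
  exists (ball x (d / 2), [set d' | d' < d / 2]); first split => /=.
  - exact: nbhsx_ballx.
  - exact: nbhs_right_lt.
  move=> [u d'] /= [xu d'd] uab y yab uy.
  have xu' : `|x - u| < d / 2 by [].
  have hu : `|h x - h u| < e / 2.
    apply: dh; last by rewrite /= in_itv.
    by rewrite /ball/=; apply: lt_le_trans xu' _; rewrite ler_pdivrMr// ler_peMr ?ler1n ?ltW.
  have hy : `|h x - h y| < e / 2.
    apply: dh; last by rewrite /= in_itv.
    rewrite /ball/= [d]splitr -(subrKA u).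
    by apply: le_lt_trans (ler_normD _ _) _; rewrite ltrD// (lt_trans uy).
  rewrite [e]splitr -(subrKA (h x)) (le_lt_trans (ler_normD _ _))// ltrD//.
  by rewrite distrC.
move=> d /= d0 dP; exists (d / 2); first by rewrite divr_gt0.
move=> x y xab yab xy; apply: (dP (d / 2)) => //=.
- by rewrite sub0r normrN gtr0_norm ?divr_gt0// ltr_pdivrMr// ltr_pMr// ltr1n.
- by rewrite divr_gt0.
Qed.

Lemma bounded_segment (h : R -> R) (a b : R) :
  {within `[a, b]%classic, continuous h} ->
  exists M, forall x, a <= x <= b -> `|h x| <= M.
Proof.
move=> hc; have [ab|ba] := leP a b; last first.
  by exists 0 => x /andP[h1 h2]; have := le_trans h1 h2; rewrite leNgt ba.
have [c1 _ h1] := EVT_max ab hc; have [c2 _ h2] := EVT_min ab hc.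
exists (`|h c1| + `|h c2|) => x xab.
have := h1 x; have := h2 x; rewrite !in_itv/= => /(_ xab) k2 /(_ xab) k1.
have := ler_norm (h c1); have := ler_norm (- h c2); rewrite normrN.
have := normr_ge0 (h c1); have := normr_ge0 (h c2); rewrite ler_norml.
move=> n2 n1 m2 m1; apply/andP; split; lra.
Qed.

Lemma ucont_comp (h : R -> R) (a b : R) F :
  {within `[a, b]%classic, continuous h} ->
  (forall d x y, nr d x y -> a <= F x <= b /\ a <= F y <= b) ->
  ucont nr F -> ucont nr (fun x => h (F x)).
Proof.
move=> hc Fab [_ Fu]; split.
  have [M hM] := bounded_segment hc.
  by exists M => d x y /Fab[? ?]; split; apply: hM.
move=> e e0; have [d d0 dh] := heine_segment e0 hc.
have [d' d'0 d'h] := Fu _ d0; exists d' => // x y xy.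
by have [? ?] := Fab _ _ _ xy; apply: dh => //; apply: d'h.
Qed.

End Closure.

(** At 0 the power need not be differentiable, so continuity there is checked by hand: x^p < e as
    soon as x < e^(1/p). For p = 0 the convention 0^0 = 1 makes the function constant, which is what
    a root of multiplicity 0 requires. *)
Lemma continuous_powR_segment (p M : R) : 0 <= p ->
  {within `[0, M]%classic, continuous (fun x : R => x `^ p)}.
Proof.
rewrite le_eqVlt => /predU1P[<-|p0].
  have -> : (@powR R)^~ 0 = cst 1 :> (R -> R) by apply/funext => x; rewrite powRr0.
  by apply: continuous_subspaceT => x; exact: cst_continuous.
apply/subspace_continuousP => x /=; rewrite in_itv/= => /andP[].
rewrite le_eqVlt => /predU1P[<- _|x0 _]; last first.
  apply: cvg_within_filter.
  have [dv _] := is_derive1_powR p x0.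
  exact/differentiable_continuous/derivable1_diffP.
rewrite /from_subspace /= powR0 ?gt_eqF//; apply/cvgrPdist_lt => e e0.
have e1 : 0 < e `^ p^-1 by rewrite powR_gt0.
rewrite near_withinE; near=> y; rewrite /= in_itv/= => /andP[y0 _].
rewrite sub0r normrN ger0_norm ?powR_ge0//.
rewrite -(powRr1 (ltW e0)) -(mulVf (lt0r_neq0 p0)) powRrM.
rewrite gt0_ltr_powR ?nnegrE ?powR_ge0//.
have : `|0 - y| < e `^ p^-1 by near: y; apply: (@cvgr_dist_lt _ R) => //.
by rewrite sub0r normrN ger0_norm.
Unshelve. all: by end_near.
Qed.

Lemma cos_lipschitz (x y : R) : `|cos x - cos y| <= `|x - y|.
Proof.
wlog xy : x y / x <= y => [hw|].
  have [/hw//|/ltW/hw] := leP x y.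
  by rewrite distrC [X in _ <= X]distrC.
have [c _ hc] := @MVT_segment R (@cos R) (fun x => - sin x) x y xy
  (fun x _ => is_derive_cos x) (continuous_subspaceT (@continuous_cos R)).
rewrite distrC hc normrM normrN [X in _ <= X]distrC ler_piMl//.
by rewrite ler_norml sin_geN1 sin_le1.
Qed.

Lemma sin_lipschitz (x y : R) : `|sin x - sin y| <= `|x - y|.
Proof.
have h z : sin z = - cos (z + pi / 2) by rewrite cosDpihalf opprK.
by rewrite !h -opprD normrN (le_trans (cos_lipschitz _ _))// opprD addrACA subrr addr0.
Qed.

End UniformContinuity.

(** * Means over grids *)

(** Signed permutations: all reflections in the roots, hence all elements of W, are of this form. *)
Definition act {F : numFieldType} {r : nat} (s : {perm 'I_r}) (b : 'I_r -> bool)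
    (t : 'rV[F]_r) : 'rV[F]_r := \row_j ((-1) ^+ b j * t 0 (s j)).

Section Grid.
Local Open Scope classical_set_scope.
Local Open Scope ring_scope.
Context {R : realType}.

Definition near_row {r : nat} (d : R) (x y : 'rV[R]_r) : Prop :=
  forall j, `|x 0 j - y 0 j| < d.

Lemma near_rowW r d d' (x y : 'rV[R]_r) :
  d <= d' -> near_row d x y -> near_row d' x y.
Proof. by move=> dd' h j; apply: lt_le_trans (h j) dd'. Qed.

(** The m_j are even and the roots enter through exp(2 i al.t), so pi Z^r is a common period of all
    functions considered, also when a side of the torus box is 2 pi. *)
Definition pi_periodic {r : nat} {T : Type} (F : 'rV[R]_r -> T) : Prop :=
  forall t (v : 'I_r -> int), F (t + \row_j (pi * (v j)%:~R)) = F t.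

Definition gridpt {r n : nat} (k : 'rV['I_n]_r) : 'rV[R]_r :=
  \row_j (pi * (k 0 j)%:R / n%:R).

Definition gmean {r : nat} {K : numFieldType} (n : nat) (F : 'rV[R]_r -> K) : K :=
  (n ^ r)%:R^-1 * \sum_(k : 'rV['I_n]_r) F (gridpt k).

Lemma gmean_ext r (K : numFieldType) n (F G : 'rV[R]_r -> K) :
  F =1 G -> gmean n F = gmean n G.
Proof. by move=> /funext->. Qed.

Lemma gmeanD r (K : numFieldType) n (F G : 'rV[R]_r -> K) :
  gmean n (fun t => F t + G t) = gmean n F + gmean n G.
Proof. by rewrite /gmean big_split mulrDr. Qed.

Lemma gmeanZ r (K : numFieldType) n c (F : 'rV[R]_r -> K) :
  gmean n (fun t => c * F t) = c * gmean n F.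
Proof. by rewrite /gmean -mulr_sumr mulrCA. Qed.

Lemma gmeanN r (K : numFieldType) n (F : 'rV[R]_r -> K) :
  gmean n (fun t => - F t) = - gmean n F.
Proof. by rewrite /gmean sumrN mulrN. Qed.

Lemma gmeanB r (K : numFieldType) n (F G : 'rV[R]_r -> K) :
  gmean n (fun t => F t - G t) = gmean n F - gmean n G.
Proof. by rewrite gmeanD gmeanN. Qed.

Lemma gmean_sum r (K : numFieldType) n (I : Type) (s : seq I) (P : pred I)
    (F : I -> 'rV[R]_r -> K) :
  gmean n (fun t => \sum_(i <- s | P i) F i t) = \sum_(i <- s | P i) gmean n (F i).
Proof. by rewrite /gmean exchange_big mulr_sumr. Qed.

Lemma gmean_cst r (K : numFieldType) n (c : K) :
  (0 < n)%N -> gmean n (fun _ : 'rV[R]_r => c) = c.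
Proof.
move=> n0; rewrite /gmean sumr_const card_mx card_ord mul1n.
rewrite -(mulr_natl c) mulKf//.
by rewrite pnatr_eq0 -lt0n expn_gt0 n0.
Qed.

Lemma le_gmean r n (F G : 'rV[R]_r -> R) :
  (forall t, F t <= G t) -> gmean n F <= gmean n G.
Proof. by move=> FG; rewrite /gmean ler_wpM2l ?invr_ge0 ?ler_sum. Qed.

Lemma gmean_norm r n (F : 'rV[R]_r -> R) M : 0 <= M ->
  (forall t, `|F t| <= M) -> `|gmean n F| <= M.
Proof.
move=> M0 FM; have [->|n0] := posnP n.
  rewrite /gmean; case: r F FM => [|r] F FM.
    rewrite expn0 invr1 mul1r; apply: le_trans (ler_norm_sum _ _ _) _.
    apply: (@le_trans _ _ (\sum_(k : 'rV['I_0]_0) M)); first exact: ler_sum.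
    by rewrite sumr_const card_mx muln0 expn0.
  by rewrite exp0n// invr0 mul0r normr0.
apply/ler_normlP; rewrite -gmeanN; split;
  rewrite -[leRHS](@gmean_cst r _ n)//; apply: le_gmean => t;
  by have := FM t; rewrite ler_norml => /andP[]; lra.
Qed.

Lemma gmean_act r (K : numFieldType) n (F : 'rV[R]_r -> K) s b :
  pi_periodic F -> (0 < n)%N -> gmean n (fun t => F (act s b t)) = gmean n F.
Proof.
move=> Fp; case: n => // n _; rewrite /gmean; congr (_ * _).
pose h (k : 'rV['I_n.+1]_r) : 'rV['I_n.+1]_r :=
  \row_j (if b j then - k 0 (s j) else k 0 (s j)).
have hI : injective h.
  move=> k k' /rowP hk; apply/rowP => j; have := hk (s^-1 j)%g.
  by rewrite !mxE permKV; case: ifP => // _ /oppr_inj.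
rewrite [RHS](reindex_inj hI); apply: eq_bigr => k _.
(* In ['I_n.+1] the opposite of k is [n.+1 - k], except at 0; negating a coordinate is thus off by
   one period exactly when k is not 0. *)
pose v j : int := if b j && (k 0 (s j) != 0) then 1 else 0.
rewrite -[LHS](Fp _ v); congr F; apply/rowP => j; rewrite !mxE /v.
case: (b j) => /=; last by rewrite mul1r mulr0 addr0.
have n0 : n.+1%:R != 0 :> R by rewrite pnatr_eq0.
have [->|k0] := eqVneq (k 0 (s j)) 0.
  by rewrite /= subn0 modnn !mulr0 mul0r !mulr0 addr0.
rewrite /= modn_small ?ltn_subrL; last first.
  by rewrite andbT lt0n; apply: contra k0 => /eqP k0; apply/eqP/val_inj.
rewrite natrB; last exact: ltnW.
by field.
Qed.

Lemma row_mx_ord0 T r (A : 'M[T]_1) (v : 'rV[T]_r) :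
  (row_mx A v : 'rV[T]_(1 + r)) 0 ord0 = A 0 0.
Proof.
have -> : ord0 = lshift r (ord0 : 'I_1) by apply: val_inj.
by rewrite row_mxEl.
Qed.

Lemma row_mx_lift0 T r (A : 'M[T]_1) (v : 'rV[T]_r) j :
  (row_mx A v : 'rV[T]_(1 + r)) 0 (lift ord0 j) = v 0 j.
Proof.
have -> : lift ord0 j = rshift 1 j by apply: val_inj.
by rewrite row_mxEr.
Qed.

Lemma ord_recl_ind r (P : 'I_r.+1 -> Prop) :
  P ord0 -> (forall j, P (lift ord0 j)) -> forall j, P j.
Proof. by move=> P0 PS j; case: (unliftP ord0 j) => [i|] ->. Qed.

Lemma gmean_recl r (K : numFieldType) n (F : 'rV[R]_r.+1 -> K) :
  gmean n F = n%:R^-1 * \sum_(k < n)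
    gmean n (fun v => F (row_mx ((pi * k%:R / n%:R)%:M : 'M[R]_1) v)).
Proof.
rewrite /gmean -mulr_sumr mulrA expnS natrM invfM; congr (_ * _).
rewrite pair_bigA /=.
rewrite (reindex (fun p : 'I_n * 'rV['I_n]_r =>
  (row_mx (const_mx p.1 : 'M['I_n]_1) p.2 : 'rV['I_n]_(1 + r)))) /=; last first.
  exists (fun k : 'rV['I_n]_r.+1 => (k 0 ord0, rsubmx (k : 'rV['I_n]_(1 + r)))) => [[i v] _|k _] /=.
    congr pair; last exact: row_mxKr.
    by rewrite (row_mx_ord0 (const_mx i)) mxE.
  rewrite -[RHS](@hsubmxK _ 1 1 r); congr row_mx.
  apply/matrixP => i j; rewrite !ord1 !mxE; congr (k _ _); exact: val_inj.
apply: eq_bigr => -[i v] _ /=; congr F; apply/rowP.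
apply: (@ord_recl_ind r) => [|j].
  by rewrite mxE (row_mx_ord0 (const_mx i)) (row_mx_ord0 _%:M) !mxE eqxx mulr1n.
by rewrite mxE (row_mx_lift0 (const_mx i)) (row_mx_lift0 _%:M) mxE.
Qed.

Notation mu := (@lebesgue_measure R).

Lemma Rintegral_riemann_sum (f : R -> R) (h e : R) (m : nat) : 0 <= h ->
  continuous f -> (forall x y, `|x - y| <= h -> `|f x - f y| <= e) ->
  `|\int[mu]_(x in `[0, h * m%:R]) f x - h * \sum_(k < m) f (h * k%:R)|
    <= e * (h * m%:R).
Proof.
move=> h0 fc fe.
have fi a b : mu.-integrable `[a, b] (EFin \o f).
  apply: continuous_compact_integrable; first exact: segment_compact.
  exact: continuous_subspaceT.
elim: m => [|m IH].
  by rewrite mulr0 set_itv1 Rintegral_set1 big_ord0 !mulr0 subrr normr0.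
pose x := h * m%:R; pose y := h * m.+1%:R.
have xy : y = x + h by rewrite /x /y -natr1 mulrDr mulr1.
have x0 : 0 <= x by rewrite mulr_ge0.
have hB := @Rintegral_itvB R f (BLeft 0) (BRight y) x (fi 0 y).
have {hB} := hB x0; rewrite bnd_simp xy lerDl => /(_ h0) hB.
have fi' : mu.-integrable `]x, x + h] (EFin \o f).
  apply: integrableS (fi x (x + h)) => //.
  by apply: subset_itvr; rewrite bnd_simp.
have ci c : mu.-integrable `]x, x + h] (EFin \o cst c).
  apply: (@integrableS _ _ _ mu `[x, x + h]) => //.
    by apply: subset_itvr; rewrite bnd_simp.
  apply: continuous_compact_integrable; first exact: segment_compact.
  by apply: continuous_subspaceT => z; exact: cst_continuous.
have ch c : \int[mu]_(_ in `]x, x + h]) c = c * h.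
  rewrite Rintegral_cst//= lebesgue_measure_itv/= lte_fin.
  have [h_gt0|h_le0] := ltP 0 h.
    by rewrite ltrDl h_gt0 /= addrAC subrr add0r.
  have -> : h = 0 by apply/eqP; rewrite eq_le h_le0.
  by rewrite addr0 ltxx /= !mulr0.
have near_fx z : x < z <= x + h -> f x - e <= f z /\ f z <= f x + e.
  move=> /andP[xz zy].
  have : `|f z - f x| <= e by apply: fe; rewrite ger0_norm; lra.
  by rewrite ler_norml => /andP[? ?]; split; lra.
have up : \int[mu]_(z in `]x, x + h]) f z <= (f x + e) * h.
  rewrite -ch; apply: (le_Rintegral _ fi' (ci _)) => //= z.
  by rewrite in_itv/= => /near_fx[].
have dn : (f x - e) * h <= \int[mu]_(z in `]x, x + h]) f z.
  rewrite -ch; apply: (le_Rintegral _ (ci _) fi') => //= z.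
  by rewrite in_itv/= => /near_fx[].
rewrite -/y xy big_ord_recr /= mulrDr -/x.
rewrite -/x in IH; move: IH hB up dn; rewrite !ler_norml => /andP[].
set A := \int[mu]_(_ in _) _; set B := \int[mu]_(_ in _) _.
set C := \int[mu]_(_ in _) _; set S := h * \sum_(_ < _) _.
by move=> h1 h2 h3 h4 h5; apply/andP; split; nra.
Qed.

End Grid.

(** * Iterated integrals as limits of grid means *)

Section BoxIntegral.
Local Open Scope classical_set_scope.
Local Open Scope ring_scope.
Context {R : realType}.

Notation mu := (@lebesgue_measure R).

Lemma grid_step (d : R) : 0 < d ->
  exists N : nat, forall n, (N <= n)%N -> pi / n.+1%:R < d.
Proof.
move=> d0; exists (Num.truncn (pi / d)) => n Nn.
rewrite ltr_pdivrMr ?ltr0n// mulrC -ltr_pdivrMr//.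
by apply: lt_le_trans (truncnS_gt _) _; rewrite ler_nat ltnS.
Qed.

Definition modulus {r : nat} (F : 'rV[R]_r -> R) (h e : R) : Prop :=
  forall x y : 'rV[R]_r, (forall j, `|x 0 j - y 0 j| <= h) -> `|F x - F y| <= e.

Lemma ucont_modulus r (F : 'rV[R]_r -> R) (e : R) : ucont near_row F -> 0 < e ->
  exists N : nat, forall n, (N <= n)%N -> modulus F (pi / n.+1%:R) e.
Proof.
move=> [_ Fu] e0; have [d d0 h] := Fu _ e0; have [N hN] := grid_step d0.
exists N => n Nn x y xy; apply/ltW/h => j.
exact: le_lt_trans (xy j) (hN _ Nn).
Qed.

Lemma near_row_mx r d (x y : R) (v w : 'rV[R]_r) : `|x - y| < d ->
  near_row d v w ->
  near_row d (row_mx (x%:M : 'M[R]_1) v : 'rV[R]_(1 + r)) (row_mx y%:M w).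
Proof.
move=> xy vw; apply: (@ord_recl_ind r) => [|j].
  by rewrite !row_mx_ord0 !mxE !eqxx !mulr1n.
by rewrite !row_mx_lift0.
Qed.

Lemma ucont_row_mx r (F : 'rV[R]_r.+1 -> R) (x : R) : ucont near_row F ->
  ucont near_row (fun v => F (row_mx (x%:M : 'M[R]_1) v)).
Proof.
move=> [[M FM] Fu]; split.
  exists M => d v w vw; apply: (FM (Num.max d 1)); apply: near_row_mx.
    by rewrite subrr normr0 lt_max ltr01 orbT.
  by apply: near_rowW vw; rewrite le_max lexx.
move=> e e0; have [d d0 h] := Fu _ e0; exists d => // v w vw.
by apply/h/near_row_mx => //; rewrite subrr normr0.
Qed.

Lemma periodic_row_mx r (T : Type) (F : 'rV[R]_r.+1 -> T) (x : R) (z : int) v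
    (w : 'I_r -> int) : pi_periodic F ->
  F (row_mx ((x + pi * z%:~R)%:M : 'M[R]_1) (v + \row_j (pi * (w j)%:~R)))
  = F (row_mx (x%:M : 'M[R]_1) v).
Proof.
move=> Fp.
pose u j := if unlift ord0 j is Some i then w i else z.
rewrite -[RHS](Fp _ u); congr F; apply/rowP.
have row_u j (A : 'rV[R]_r.+1) :
    (A + \row_j (pi * (u j)%:~R)) 0 j = A 0 j + pi * (u j)%:~R by rewrite !mxE.
apply: (@ord_recl_ind r) => [|j]; rewrite row_u /u.
  by rewrite !row_mx_ord0 unlift_none !mxE eqxx !mulr1n.
by rewrite !row_mx_lift0 liftK !mxE.
Qed.

Lemma sum_periodic (f : R -> R) n c : (0 < n)%N ->
  (forall x (z : int), f (x + pi * z%:~R) = f x) ->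
  \sum_(k < c * n) f (pi / n%:R * k%:R) = c%:R * \sum_(k < n) f (pi * k%:R / n%:R).
Proof.
move=> n0 fp; elim: c => [|c IH]; first by rewrite mul0n big_ord0 mul0r.
have -> : (c.+1 * n = c * n + n)%N by rewrite mulSnr.
rewrite big_split_ord /= IH.
have -> : c.+1%:R = c%:R + 1 :> R by rewrite natr1.
rewrite [in RHS]mulrDl mul1r; congr (_ + _).
apply: eq_bigr => k _; rewrite -[RHS](fp _ (Posz c)); congr f.
rewrite natrD natrM -pmulrn; field.
by rewrite pnatr_eq0 -lt0n.
Qed.

(** The error is quantitative, e for each coordinate, because the induction on the dimension needs
    the inner integral to be approximated uniformly in the first variable. The sides are integral
    multiples of pi, so the grid fits the box and each side covers whole periods. *)
Lemma box_integral_gmean r (c : 'I_r -> nat) (F : 'rV[R]_r -> R) (e : R) n :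
  0 <= e -> ucont near_row F -> pi_periodic F -> modulus F (pi / n.+1%:R) e ->
  `|box_integral (fun j => pi * (c j)%:R) F
     - \prod_(j < r) (pi * (c j)%:R) * gmean n.+1 F|
  <= e * r%:R * \prod_(j < r) (pi * (c j)%:R).
Proof.
elim: r c F e n => [|r IH] c F e n e0 Fu Fp Fe.
  rewrite !big_ord0 mulr0 mul1r mulr1 /= /gmean expn0 invr1 mul1r.
  rewrite (eq_bigr (fun=> F 0)) => [|k _]; last first.
    by congr F; apply/rowP => -[].
  by rewrite sumr_const card_mx muln0 expn0 mulr1n subrr normr0.
pose c' j := c (lift ord0 j); pose V := \prod_(j < r) (pi * (c' j)%:R) : R.
have V0 : 0 <= V by apply: prodr_ge0 => j _; rewrite mulr_ge0 ?pi_ge0.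
pose G x v := F (row_mx (x%:M : 'M[R]_1) v).
have Gu x : ucont near_row (G x) by exact: ucont_row_mx.
have Gp x : pi_periodic (G x).
  move=> v w; rewrite /G -(periodic_row_mx x 0 v w Fp).
  by rewrite mulr0z mulr0 addr0.
pose I x := box_integral (fun j => pi * (c' j)%:R) (G x).
have Gx k x y (h e' : R) : 0 <= e' -> 0 <= h -> modulus F h e' -> `|x - y| <= h ->
    `|V * gmean k (G x) - V * gmean k (G y)| <= V * e'.
  move=> e'0 h0 Fe' xy; rewrite -mulrBr normrM ger0_norm// ler_wpM2l// -gmeanB.
  apply: gmean_norm => // v; apply: Fe'.
  apply: (@ord_recl_ind r) => [|j].
    by rewrite !row_mx_ord0 !mxE !eqxx !mulr1n.
  by rewrite !row_mx_lift0 subrr normr0.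
have IG k x (e' : R) : 0 <= e' -> modulus F (pi / k.+1%:R) e' ->
    `|I x - V * gmean k.+1 (G x)| <= e' * r%:R * V.
  move=> e'0 Fe'; apply: IH => // v w vw; apply: Fe'.
  apply: (@ord_recl_ind r) => [|j].
    by rewrite !row_mx_ord0 subrr normr0 divr_ge0 ?pi_ge0.
  by rewrite !row_mx_lift0.
have step_ge0 k : 0 <= pi / k.+1%:R :> R by rewrite divr_ge0 ?pi_ge0.
have gc k : continuous (fun x => V * gmean k (G x)).
  move=> x; apply/cvgrPdist_le => e' e'0.
  have K0 : 0 < V + 1 by rewrite ltr_wpDl.
  have [N hN] := ucont_modulus Fu (divr_gt0 e'0 K0).
  near=> y; have xy : `|x - y| <= pi / N.+1%:R.
    by near: y; apply: (@cvgr_dist_le _ R) => //; rewrite divr_gt0 ?pi_gt0.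
  have ek : 0 <= e' / (V + 1) by rewrite divr_ge0 ?ltW.
  apply: le_trans (Gx k x y _ _ ek (step_ge0 N) (hN N (leqnn _)) xy) _.
  by rewrite mulrA ler_pdivrMr// mulrC ler_pM2l// lerDl.
have Ic : continuous I.
  move=> x; apply/cvgrPdist_le => e' e'0.
  (* Two approximations of the inner integral by means cost [d * r * V] each, the variation of the
     mean costs [V * d]; the final 1 only keeps K positive. *)
  pose K := V * (r%:R * 2 + 1) + 1.
  have K0 : 0 < K by rewrite ltr_wpDl// mulr_ge0 ?addr_ge0 ?mulr_ge0.
  pose d := e' / K; have d0 : 0 <= d by rewrite divr_ge0 ?ltW.
  have [N hN] := ucont_modulus Fu (divr_gt0 e'0 K0 : 0 < d).
  have {}hN := hN N (leqnn _).
  near=> y; have xy : `|x - y| <= pi / N.+1%:R.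
    by near: y; apply: (@cvgr_dist_le _ R) => //; rewrite divr_gt0 ?pi_gt0.
  have h1 := IG N x _ d0 hN; have h2 := IG N y _ d0 hN.
  have h3 := Gx N.+1 x y _ _ d0 (step_ge0 N) hN xy.
  have -> : I x - I y = (I x - V * gmean N.+1 (G x))
    + (V * gmean N.+1 (G x) - V * gmean N.+1 (G y))
    - (I y - V * gmean N.+1 (G y)) by ring.
  have dK : d * K = e' by rewrite divfK ?gt_eqF.
  apply: le_trans (ler_normB _ _) _; apply: le_trans (lerD (ler_normD _ _) h2) _.
  apply: le_trans (lerD (lerD h1 h3) (lexx _)) _.
  rewrite -dK /K; nra.
have fi (f : R -> R) b : continuous f -> mu.-integrable `[0, b] (EFin \o f).
  move=> fc; apply: continuous_compact_integrable; first exact: segment_compact.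
  exact: continuous_subspaceT.
pose h : R := pi / n.+1%:R; pose L : R := pi * (c ord0)%:R.
have hL : h * (c ord0 * n.+1)%:R = L.
  rewrite /h /L natrM; have N0 : n.+1%:R != 0 :> R by rewrite pnatr_eq0.
  by move: (n.+1%:R) N0 => N N0; field.
have L0 : 0 <= L by rewrite mulr_ge0 ?pi_ge0.
pose g x := V * gmean n.+1 (G x).
have cst_int (k : R) : \int[mu]_(x in `[0, L]) k = k * L.
  rewrite Rintegral_cst//= lebesgue_measure_itv/= lte_fin.
  have [_|L_le0] := ltP 0 L; first by rewrite oppr0 adde0.
  have -> : L = 0 by apply/eqP; rewrite eq_le L_le0.
  by rewrite /= !mulr0.
have cc (k : R) : continuous (cst k : R -> R) by move=> x; exact: cst_continuous.
have Ig x : g x - e * r%:R * V <= I x <= g x + e * r%:R * V.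
  have := IG n x e e0 Fe; rewrite ler_norml -/(g x) => /andP[h1 h2].
  by apply/andP; split; lra.
have up : \int[mu]_(x in `[0, L]) I x <= \int[mu]_(x in `[0, L]) g x
    + e * r%:R * V * L.
  rewrite -cst_int -RintegralD//; [|exact/fi/gc|exact/fi/cc].
  apply: le_Rintegral => //; [exact/fi/Ic| |by move=> x _; case/andP: (Ig x)].
  by apply: fi => x; apply: cvgD; [exact: gc|exact: cc].
have dn : \int[mu]_(x in `[0, L]) g x - e * r%:R * V * L
    <= \int[mu]_(x in `[0, L]) I x.
  rewrite -cst_int -RintegralB//; [|exact/fi/gc|exact/fi/cc].
  apply: le_Rintegral => //; [|exact/fi/Ic|by move=> x _; case/andP: (Ig x)].
  by apply: fi => x; apply: cvgB; [exact: gc|exact: cc].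
have gsum : h * \sum_(k < c ord0 * n.+1) g (h * k%:R) = L * V * gmean n.+1 F.
  rewrite (@sum_periodic g)//; last first.
    move=> x z; rewrite /g; congr (_ * _); apply: gmean_ext => v.
    transitivity (G (x + pi * z%:~R) (v + \row_j (pi * (0 : int)%:~R))).
      by congr (G _ _); apply/rowP => j; rewrite !mxE mulr0 addr0.
    exact: periodic_row_mx.
  rewrite /g -mulr_sumr gmean_recl /h /L.
  set S := \sum_(_ < _) _; have N0 : n.+1%:R != 0 :> R by rewrite pnatr_eq0.
  by move: (n.+1%:R) S N0 => N S N0; field.
have := @Rintegral_riemann_sum R g h (V * e) (c ord0 * n.+1) (step_ge0 n) (gc _)
  (fun x y => Gx n.+1 x y h e e0 (step_ge0 n) Fe).
rewrite hL gsum big_ord_recl /= -/c' -/L -/V => rs.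
move: rs up dn; rewrite -/(I _) !ler_norml => /andP[].
rewrite -natr1 -/I.
set A := \int[mu]_(_ in _) g _; set B := \int[mu]_(_ in _) I _.
by move=> h1 h2 h3 h4; apply/andP; split; nra.
Unshelve. all: by end_near.
Qed.

Lemma cvg_gmean r (c : 'I_r -> nat) (F : 'rV[R]_r -> R) :
  (forall j, (0 < c j)%N) -> ucont near_row F -> pi_periodic F ->
  gmean n.+1 F @[n --> \oo] -->
    box_integral (fun j => pi * (c j)%:R) F / \prod_(j < r) (pi * (c j)%:R).
Proof.
move=> c0 Fu Fp; set V := \prod_(_ < _) _.
have V0 : 0 < V by apply: prodr_gt0 => j _; rewrite mulr_gt0 ?pi_gt0 ?ltr0n.
apply/cvgrPdist_le => e e0.
have r0 : 0 < r%:R + 1 :> R by rewrite ltr_wpDl.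
have [N hN] := ucont_modulus Fu (divr_gt0 e0 r0).
exists N => //= n Nn.
have := box_integral_gmean c (ltW (divr_gt0 e0 r0)) Fu Fp (hN n Nn).
rewrite -/V => h; have -> : box_integral (fun j => pi * (c j)%:R) F / V
    - gmean n.+1 F = (box_integral (fun j => pi * (c j)%:R) F
    - V * gmean n.+1 F) / V by field; rewrite gt_eqF.
rewrite normrM normfV (gtr0_norm V0) ler_pdivrMr//; apply: le_trans h _.
rewrite ler_pM2r// mulrAC ler_pdivrMr// ler_pM2l// lerDl.
exact: ler01.
Qed.

End BoxIntegral.

(** * Integration by parts against a regularised weight *)

Section Stokes.
Local Open Scope classical_set_scope.
Local Open Scope ring_scope.
Context {R : realType} {r : nat}.
Implicit Types (t v : 'rV[R]_r) (F G : 'rV[R]_r -> R).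

Lemma is_derive_line F t v (x d : R) :
  is_derive (x *: v + t) v F d <->
  is_derive x (1 : R) (fun h : R => F (h *: v + t)) d.
Proof.
set g := fun h : R => F (h *: v + t).
have E : (fun h : R => h^-1 *: ((F \o shift (x *: v + t)) (h *: v) - F (x *: v + t)))
    = (fun h : R => h^-1 *: ((g \o shift x) (h *: (1 : R)) - g x)).
  by apply/funext => h; rewrite /g /= addrA -scalerDl [h *: 1]mulr1.
split=> -[fd fE]; split.
- by move: fd; rewrite /derivable E.
- by rewrite -fE /derive E.
- by move: fd; rewrite /derivable -E.
- by rewrite -fE /derive -E.
Qed.

Lemma is_derive_line0 F t v (d : R) :
  is_derive t v F d <-> is_derive (0 : R) (1 : R) (fun h : R => F (h *: v + t)) d.
Proof. by rewrite -is_derive_line scale0r add0r. Qed.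

Lemma is_derive_compR (h : R -> R) F t v (b d : R) :
  is_derive (F t) (1 : R) h b -> is_derive t v F d ->
  is_derive t v (fun u => h (F u)) (b * d).
Proof.
move=> hb /is_derive_line0 Fd; apply/is_derive_line0.
apply: (@is_derive1_comp R h (fun x => F (x *: v + t))) => //.
by rewrite scale0r add0r.
Qed.

Lemma is_derive_mulR F G t v (a b : R) :
  is_derive t v F a -> is_derive t v G b ->
  is_derive t v (fun u => F u * G u) (a * G t + F t * b).
Proof.
move=> Fa Gb; have := is_deriveM Fa Gb; rewrite /GRing.scale /=.
by rewrite addrC [G t * a]mulrC.
Qed.

Lemma gmean_translate (K : numFieldType) n (z : 'I_r -> nat) (F : 'rV[R]_r -> K) :
  pi_periodic F ->
  gmean n.+1 (fun t => F (\row_j (pi * (z j)%:R / n.+1%:R) + t)) = gmean n.+1 F.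
Proof.
move=> Fp; rewrite /gmean; congr (_ * _).
pose h (k : 'rV['I_n.+1]_r) : 'rV['I_n.+1]_r := \row_j (k 0 j + inZp (z j)).
have hI : injective h.
  by move=> k k' /rowP hk; apply/rowP => j; have := hk j; rewrite !mxE => /addIr.
rewrite [RHS](reindex_inj hI); apply: eq_bigr => k _.
pose v j : int := Posz ((k 0 j + z j) %/ n.+1).
rewrite -[RHS](Fp _ v); congr F; apply/rowP => j; rewrite !mxE /v /= modnDmr.
have n0 : n.+1%:R != 0 :> R by rewrite pnatr_eq0.
have E : (z j)%:R + (k 0 j)%:R = ((k 0 j + z j) %/ n.+1)%:R * n.+1%:R
    + ((k 0 j + z j) %% n.+1)%:R :> R.
  by rewrite -natrM -!natrD addnC [X in X%:R = _](divn_eq _ n.+1).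
transitivity (pi * ((z j)%:R + (k 0 j)%:R) / n.+1%:R : R); first by field.
by rewrite E -pmulrn; field.
Qed.

Lemma gmean_shift (K : numFieldType) n j (F : 'rV[R]_r -> K) : pi_periodic F ->
  gmean n.+1 (fun t => F ((pi / n.+1%:R) *: eps j + t)) = gmean n.+1 F.
Proof.
move=> Fp; rewrite -(gmean_translate n (fun i => (i == j) : nat) Fp).
apply: gmean_ext => t; congr (F (_ + _)); apply/rowP => i; rewrite !mxE eqxx /=.
by case: (i == j); rewrite ?mulr1 ?mulr0 ?mul0r.
Qed.

(** The difference quotient whose step is exactly the step of the grid has mean 0, by invariance
    under grid translations; the mean value theorem puts it within the modulus of continuity of the
    derivative. *)
Lemma gmean_derive_cvg0 j F (F' : 'rV[R]_r -> R) : pi_periodic F -> ucont near_row F' ->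
  (forall t, is_derive t (eps j) F (F' t)) ->
  gmean n.+1 F' @[n --> \oo] --> 0.
Proof.
move=> Fp F'u FF'; apply/cvgrPdist_le => e e0.
have [N hN] := ucont_modulus F'u e0; exists N => //= n Nn.
have h0 : 0 < pi / n.+1%:R :> R by rewrite divr_gt0 ?pi_gt0.
set h := pi / n.+1%:R in h0 *.
have -> : 0 - gmean n.+1 F'
    = gmean n.+1 (fun t => h^-1 * (F (h *: eps j + t) - F t) - F' t).
  by rewrite gmeanB gmeanZ gmeanB gmean_shift// subrr mulr0.
apply: gmean_norm => [|t]; first exact: ltW.
have dl x : is_derive x (1 : R) (fun x : R => F (x *: eps j + t)) (F' (x *: eps j + t)).
  by apply/is_derive_line.
have [c c0h] := @MVT_segment R (fun x => F (x *: eps j + t))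
  (fun x => F' (x *: eps j + t)) 0 h (ltW h0) (fun x _ => dl x) ltac:(
  by apply: continuous_subspaceT => x; apply/differentiable_continuous/derivable1_diffP;
     case: (dl x)).
rewrite scale0r add0r subr0 => ->.
rewrite mulrCA mulVf ?gt_eqF// mulr1; apply: (hN n Nn) => i.
rewrite !mxE eqxx /=; move: c0h; rewrite in_itv /= => /andP[c0 ch].
by case: (i == j); rewrite -addrA subrr addr0 ?mulr1 ?mulr0 ?normr0 ?ger0_norm// ltW.
Qed.

Definition near_par (d : R) (x y : R * 'rV[R]_r) : Prop :=
  [/\ 0 <= x.1 <= 1, 0 <= y.1 <= 1, `|x.1 - y.1| < d & near_row d x.2 y.2].

Lemma near_parW d d' x y : d <= d' -> near_par d x y -> near_par d' x y.
Proof.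
move=> dd' [? ? h1 h2]; split => //; first exact: lt_le_trans h1 dd'.
exact: near_rowW h2.
Qed.

(* [W e] is a weight regularised by [e]; [La e] is its logarithmic derivative
   in the direction [eps j]. *)
Record regular_weight (j : 'I_r) (W La : R -> 'rV[R]_r -> R) : Prop := {
  rw_ucont : ucont near_par (fun x => W x.1 x.2);
  rw_derive : forall e t, 0 < e -> is_derive t (eps j) (W e) (La e t * W e t);
  rw_La : forall e, 0 < e <= 1 -> ucont near_row (La e);
  rw_periodic : forall e, pi_periodic (W e);
  rw_ge0 : forall e t, 0 <= e -> 0 <= W e t }.

Lemma regular_weight1 j : regular_weight j (fun _ _ => 1) (fun _ _ => 0).
Proof.
split=> //; first exact: ucont_cst.
- by move=> e t _; rewrite mul0r; exact: is_derive_cst.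
- by move=> e _; exact: ucont_cst.
Qed.

Lemma regular_weightM j W La W' La' :
  regular_weight j W La -> regular_weight j W' La' ->
  regular_weight j (fun e t => W e t * W' e t) (fun e t => La e t + La' e t).
Proof.
move=> [h1 h2 h3 h4 h5] [k1 k2 k3 k4 k5]; split.
- exact: (ucontM near_parW).
- move=> e t e0; have := is_derive_mulR (h2 e t e0) (k2 e t e0).
  by congr (is_derive _ _ _ _); ring.
- by move=> e e01; apply: (ucontD (@near_rowW R r)); [exact: h3|exact: k3].
- by move=> e t v; rewrite h4 k4.
- by move=> e t e0; rewrite mulr_ge0 ?h5 ?k5.
Qed.

Lemma regular_weight_prod j (I : Type) (s : seq I) (P : pred I)
    (W La : I -> R -> 'rV[R]_r -> R) :
  (forall i, P i -> regular_weight j (W i) (La i)) ->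
  regular_weight j (fun e t => \prod_(i <- s | P i) W i e t)
    (fun e t => \sum_(i <- s | P i) La i e t).
Proof.
move=> h; elim: s => [|i s IH].
  have -> : (fun e t => \prod_(i <- [::] | P i) W i e t) = (fun _ _ => 1).
    by apply/funext => e; apply/funext => t; rewrite big_nil.
  have -> : (fun e t => \sum_(i <- [::] | P i) La i e t) = (fun _ _ => 0).
    by apply/funext => e; apply/funext => t; rewrite big_nil.
  exact: regular_weight1.
have [Pi|Pi] := boolP (P i).
  have -> : (fun e t => \prod_(i <- i :: s | P i) W i e t)
      = (fun e t => W i e t * \prod_(i <- s | P i) W i e t).
    by apply/funext => e; apply/funext => t; rewrite big_cons Pi.
  have -> : (fun e t => \sum_(i <- i :: s | P i) La i e t)
      = (fun e t => La i e t + \sum_(i <- s | P i) La i e t).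
    by apply/funext => e; apply/funext => t; rewrite big_cons Pi.
  by apply: regular_weightM IH; exact: h.
have -> : (fun e t => \prod_(i <- i :: s | P i) W i e t)
    = (fun e t => \prod_(i <- s | P i) W i e t).
  by apply/funext => e; apply/funext => t; rewrite big_cons (negbTE Pi).
have -> : (fun e t => \sum_(i <- i :: s | P i) La i e t)
    = (fun e t => \sum_(i <- s | P i) La i e t).
  by apply/funext => e; apply/funext => t; rewrite big_cons (negbTE Pi).
exact: IH.
Qed.

Lemma ucont_par F : ucont near_row F -> ucont near_par (fun x => F x.2).
Proof.
move=> [[M FM] Fu]; split; first by exists M => d x y [_ _ _ /FM].
by move=> e /Fu[d d0 h]; exists d => // x y [_ _ _ /h].
Qed.

Lemma ucont_par1 : ucont near_par (fun x : R * 'rV[R]_r => x.1).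
Proof.
split; first by exists 1 => d x y [/andP[? ?] /andP[? ?] _ _]; rewrite !ger0_norm.
by move=> e e0; exists e => // x y [].
Qed.

Lemma regular_weight_powR j (q q' : 'rV[R]_r -> R) (p : R) : 0 <= p ->
  pi_periodic q -> ucont near_row q -> ucont near_row q' ->
  (forall t, is_derive t (eps j) q (q' t)) -> (forall t, 0 <= q t <= 4) ->
  regular_weight j (fun e t => (q t + e) `^ p)
    (fun e t => p * (q' t / (q t + e))).
Proof.
move=> p0 qp qu q'u qd q04; split.
(* The bound 5 is the bound 4 of [q] plus the bound 1 of the parameter. *)
- apply: (@ucont_comp _ _ near_par (fun x : R => x `^ p) 0 5 (fun x => q x.2 + x.1)).
  + exact: continuous_powR_segment.
  + move=> d x y [/andP[? ?] /andP[? ?] _ _].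
    have /andP[? ?] := q04 x.2; have /andP[? ?] := q04 y.2.
    by split; apply/andP; split; lra.
  + by apply: (ucontD near_parW); [exact: ucont_par|exact: ucont_par1].
- move=> e t e0; have /andP[q0 _] := q04 t.
  have qe : 0 < q t + e by rewrite ltr_wpDl.
  have qed : is_derive t (eps j) (fun u => q u + e) (q' t).
    have := @is_deriveD _ _ _ q (cst e) t (eps j) _ _ (qd t) (is_derive_cst _ _ _).
    by rewrite addr0.
  have := @is_derive_compR (fun x => x `^ p) (fun u => q u + e) t (eps j) _ _
    (is_derive1_powR p qe) qed.
  congr (is_derive _ _ _ _); rewrite powRB; last by apply/implyP => _; rewrite gt_eqF.
  by rewrite powRr1 ?ltW//; field; rewrite gt_eqF.
- move=> e /andP[e0 e1]; apply: (ucontM (@near_rowW R r)); first exact: ucont_cst.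
  apply: (ucontM (@near_rowW R r)) => //.
  apply: (@ucont_comp _ _ near_row (fun x : R => x^-1) e 5 (fun x => q x + e)).
  + apply: continuous_in_subspaceT => x; rewrite inE /= in_itv/= => /andP[ex _].
    by apply: inv_continuous; rewrite gt_eqF// (lt_le_trans e0).
  + move=> d x y _; have /andP[? ?] := q04 x; have /andP[? ?] := q04 y.
    by split; apply/andP; split; lra.
  + by apply: (ucontD (@near_rowW R r)) => //; exact: ucont_cst.
- by move=> e t v; rewrite qp.
- by move=> e t e0; rewrite powR_ge0.
Qed.

Lemma ucont_par_slice (W : R -> 'rV[R]_r -> R) e : 0 <= e <= 1 ->
  ucont near_par (fun x => W x.1 x.2) -> ucont near_row (W e).
Proof.
move=> e01 [[M WM] Wu]; split.
  exists M => d x y xy; apply: (WM (Num.max d 1) (e, x) (e, y)); split => //=.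
    by rewrite subrr normr0 lt_max ltr01 orbT.
  by apply: near_rowW xy; rewrite le_max lexx.
move=> e' e'0; have [d d0 h] := Wu _ e'0; exists d => // x y xy.
by apply: (h (e, x) (e, y)); split => //=; rewrite subrr normr0.
Qed.

Lemma stokes_regularised j W La G (G' : 'rV[R]_r -> R) e :
  regular_weight j W La -> pi_periodic G -> ucont near_row G -> ucont near_row G' ->
  (forall t, is_derive t (eps j) G (G' t)) -> 0 < e <= 1 ->
  gmean n.+1 (fun t => (G' t + La e t * G t) * W e t) @[n --> \oo] --> 0.
Proof.
move=> [Wu Wd Lu Wp W0] Gp Gu G'u Gd /andP[e0 e1].
have Weu : ucont near_row (W e) by apply: ucont_par_slice Wu; rewrite ltW.
apply: (@gmean_derive_cvg0 j (fun t => G t * W e t)).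
- by move=> t v; rewrite Gp Wp.
- apply: (ucontM (@near_rowW R r)) => //; apply: (ucontD (@near_rowW R r)) => //.
  by apply: (ucontM (@near_rowW R r)) => //; apply: Lu; rewrite e0.
- move=> t; have := is_derive_mulR (Gd t) (Wd e t e0).
  by congr (is_derive _ _ _ _); ring.
Qed.

(** The quotient [Z / (q + e)] is bounded uniformly in e. Replacing [W e] by [W 0] costs little by
    uniform continuity; the remaining error carries the factor e / (q + e) times [W 0], where the
    first is small away from the wall q = 0 and the second is small close to it. *)
Lemma regularised_term_cvg (W : R -> 'rV[R]_r -> R) (Z q : 'rV[R]_r -> R) (L : R) :
  ucont near_par (fun x => W x.1 x.2) -> (forall e t, 0 <= e -> 0 <= W e t) ->
  (forall t, 0 <= q t) -> (forall t, `|Z t| <= L * q t) ->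
  (forall y, 0 < y -> exists2 d, 0 < d & forall t, q t < d -> W 0 t <= y) ->
  forall y, 0 < y -> exists2 d, 0 < d & forall e t, 0 < e <= 1 -> e < d ->
    `|Z t / (q t + e) * W e t - Z t / q t * W 0 t| <= y.
Proof.
move=> Wu W0 q0 ZL Wq y y0.
have [[M WM] Wu'] := Wu.
pose K := `|L| + 1; have K0 : 0 < K by rewrite ltr_wpDl.
pose B := `|M| + 1; have B0 : 0 < B by rewrite ltr_wpDl.
have ZK t : `|Z t| <= K * q t.
  apply: le_trans (ZL t) _; rewrite ler_wpM2r// (le_trans (ler_norm _))//.
  by rewrite lerDl.
have WB t : W 0 t <= B.
  have [h _] := WM 1 (0, t) (0, t) ltac:(by split => //=; rewrite ?lexx ?ler01 ?subrr
    ?normr0 // => i; rewrite subrr normr0).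
  rewrite /= in h; apply: le_trans (ler_norm _) _; apply: le_trans h _.
  by apply: le_trans (ler_norm _) _; rewrite lerDl.
have y2K : 0 < y / 2 / K by rewrite !divr_gt0.
have [d1 d10 h1] := Wu' _ y2K; have [d2 d20 h2] := Wq _ y2K.
pose d3 := y / 2 / K / B * d2.
have d30 : 0 < d3 by rewrite mulr_gt0 ?divr_gt0.
exists (Num.min d1 d3) => [|e t /andP[e0 e1]]; first by rewrite lt_min d10.
rewrite lt_min => /andP[ed1 ed3].
have qe : 0 < q t + e by rewrite ltr_wpDl.
have Zq : `|Z t / q t| <= K.
  have [qt|qt] := eqVneq (q t) 0; first by rewrite qt invr0 mulr0 normr0 ltW.
  have qt0 : 0 < q t by rewrite lt_neqAle eq_sym qt q0.
  by rewrite normrM normfV (gtr0_norm qt0) ler_pdivrMr.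
have -> : Z t / (q t + e) * W e t - Z t / q t * W 0 t
    = Z t / (q t + e) * (W e t - W 0 t) - Z t / q t * (e / (q t + e)) * W 0 t.
  (* On the wall the bound forces [Z t = 0], so the default value of the quotient by 0 is
     harmless. *)
  have [qt|qt] := eqVneq (q t) 0.
    have -> : Z t = 0 by apply/eqP; rewrite -normr_le0 (le_trans (ZK t))// qt mulr0.
    by rewrite !mul0r subrr.
  by field; rewrite qt gt_eqF.
rewrite [y]splitr; apply: le_trans (ler_normB _ _) _; apply: lerD.
- rewrite normrM; have -> : y / 2 = K * (y / 2 / K) by field; rewrite gt_eqF.
  apply: ler_pM => //.
    rewrite normrM normfV (gtr0_norm qe) ler_pdivrMr//.
    by apply: le_trans (ZK t) _; rewrite ler_pM2l// lerDl ltW.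
  apply/ltW/(h1 (e, t) (0, t)); split => /=; rewrite ?lexx ?ler01 ?(ltW e0)//.
    by rewrite subr0 gtr0_norm.
  by move=> i; rewrite subrr normr0.
- rewrite normrM normrM.
  have -> : y / 2 = K * (y / 2 / K) by field; rewrite gt_eqF.
  rewrite -mulrA; apply: ler_pM => //.
  rewrite ger0_norm ?divr_ge0 ?(ltW e0) ?(ltW qe)//.
  rewrite (ger0_norm (W0 0 t (lexx 0))).
  have [qd|qd] := ltP (q t) d2.
    apply: le_trans (h2 t qd); rewrite ler_piMl ?W0//.
    by rewrite ler_pdivrMr// mul1r lerDr.
  have : e / (q t + e) <= y / 2 / K / B.
    rewrite ler_pdivrMr//; apply: le_trans (ltW ed3) _.
    by rewrite ler_pM2l ?divr_gt0//; apply: le_trans qd _; rewrite lerDl ltW.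
  move=> h; have -> : y / 2 / K = y / 2 / K / B * B by field; rewrite !gt_eqF.
  by apply: ler_pM => //; rewrite ?divr_ge0 ?W0 ?(ltW e0) ?(ltW qe).
Qed.

End Stokes.

(** * Characters and reflections *)

Section SignedPermutations.

Lemma dotDl_field (F : fieldType) r (x y z : 'rV[F]_r) :
  dot (x + y) z = dot x z + dot y z.
Proof. by rewrite -big_split; apply: eq_bigr => j _; rewrite mxE mulrDl. Qed.

Lemma dotZl_field (F : fieldType) r c (x z : 'rV[F]_r) :
  dot (c *: x) z = c * dot x z.
Proof. by rewrite mulr_sumr; apply: eq_bigr => j _; rewrite mxE mulrA. Qed.

Lemma dotNl_field (F : fieldType) r (x z : 'rV[F]_r) : dot (- x) z = - dot x z.
Proof. by rewrite -scaleN1r dotZl_field mulN1r. Qed.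

Lemma dot_epsl (F : fieldType) r (j : 'I_r) (x : 'rV[F]_r) :
  dot (eps j) x = x 0 j.
Proof.
rewrite /dot (bigD1 j) //= big1 => [|i ij].
  by rewrite !mxE !eqxx mul1r addr0.
by rewrite !mxE (negbTE ij) mul0r.
Qed.

Variables (F : numFieldType) (r : nat).
Implicit Types (j k : 'I_r) (t : 'rV[F]_r).

Lemma refl_sub j k t : j != k ->
  refl (eps j - eps k) t = act (tperm j k) (fun=> false) t.
Proof.
move=> jk; have n2 : 2 != 0 :> F by rewrite pnatr_eq0.
rewrite /refl dotDl_field dotNl_field !dot_epsl.
have -> : dot (eps j - eps k) (eps j - eps k) = 2 :> F.
  rewrite dotDl_field dotNl_field !dot_epsl !mxE !eqxx /=.
  by rewrite [k == j]eq_sym (negbTE jk) /=; ring.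
rewrite mulrAC mulfV// mul1r; apply/rowP => l; rewrite !mxE /= mul1r.
by case: tpermP => [->|->|/eqP/negbTE-> /eqP/negbTE->];
  rewrite ?eqxx /= ?[k == j]eq_sym ?(negbTE jk) /=; ring.
Qed.

Lemma refl_add j k t : j != k ->
  refl (eps j + eps k) t
    = act (tperm j k) (fun l => (l == j) || (l == k)) t.
Proof.
move=> jk; have n2 : 2 != 0 :> F by rewrite pnatr_eq0.
rewrite /refl dotDl_field !dot_epsl.
have -> : dot (eps j + eps k) (eps j + eps k) = 2 :> F.
  rewrite dotDl_field !dot_epsl !mxE !eqxx /=.
  by rewrite [k == j]eq_sym (negbTE jk) /=; ring.
rewrite mulrAC mulfV// mul1r; apply/rowP => l; rewrite !mxE /=.
by case: tpermP => [->|->|/eqP/negbTE-> /eqP/negbTE->];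
  rewrite ?eqxx /= ?[k == j]eq_sym ?(negbTE jk) /=; ring.
Qed.

Lemma refl_eps j t : refl (eps j) t = act 1%g (pred1 j) t.
Proof.
rewrite /refl !dot_epsl !mxE !eqxx divr1; apply/rowP => l; rewrite !mxE perm1 /=.
by have [->|lj] := eqVneq l j; rewrite /=; ring.
Qed.

Lemma reflZ (c : F) (al t : 'rV[F]_r) : c != 0 -> refl (c *: al) t = refl al t.
Proof.
move=> c0; rewrite /refl; congr (_ - _); rewrite scalerA; congr (_ *: _).
rewrite !dotZl_field.
have -> : dot al (c *: al) = c * dot al al.
  by rewrite mulr_sumr; apply: eq_bigr => j _; rewrite mxE mulrCA.
have [->|d0] := eqVneq (dot al al) 0; first by rewrite !mulr0 !invr0 !mulr0 mul0r.
by field; rewrite c0 d0.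
Qed.

Lemma reflN (al t : 'rV[F]_r) : refl (- al) t = refl al t.
Proof. by rewrite -scaleN1r reflZ// oppr_eq0 oner_eq0. Qed.

End SignedPermutations.

Section Characters.
Context {R : realType} {r : nat}.
Implicit Types (al mu : 'rV[int]_r) (t : 'rV[R]_r) (x y : R).

Lemma expiD x y : expi (x + y) = expi x * expi y.
Proof.
apply/eqP; rewrite /expi cosD sinD eq_complex /= eqxx /=.
by apply/eqP; ring.
Qed.

Lemma expi0 : expi 0 = 1 :> R[i].
Proof. by rewrite /expi cos0 sin0. Qed.

Lemma expi_conj x : (expi x)^* = expi (- x).
Proof. by rewrite /expi cosN sinN. Qed.

Lemma expi_2pi (z : int) : expi (2 * (pi * z%:~R)) = 1 :> R[i].
Proof.
have h n : expi (2 * (pi * n%:R)) = 1 :> R[i].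
  elim: n => [|n IH]; first by rewrite !mulr0 expi0.
  have -> : n.+1%:R = n%:R + 1 :> R by rewrite natr1.
  rewrite mulrDr mulr1 mulrDr expiD IH mul1r.
  by rewrite mulr_natl /expi cos2pi sin2pi.
case: z => n; first exact: h.
rewrite NegzE mulrNz !mulrN -expi_conj h.
exact: conjc1.
Qed.

Lemma expi_eq1 x : (expi (2 * x) == 1) = (sin x == 0).
Proof.
rewrite /expi eq_complex /= mulr_natl cos_mulr2n sin_mulr2n cos2sin2.
have [->|s0] := eqVneq (sin x) 0.
  by rewrite mulr0 mul0rn eqxx andbT -subr_eq0; apply/eqP; ring.
apply/negP => /andP[/eqP h _]; case/negP: s0; rewrite -sqrf_eq0; apply/eqP; lra.
Qed.

(** Exponents are kept as integral vectors, half of the exponents of the statement; this is the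
    origin of the factor 2 in [ez], and it makes the height of an exponent an integer on which to do
    induction. *)
Definition dz al t : R := \sum_i (al 0 i)%:~R * t 0 i.

Definition ez al t : R[i] := expi (2 * dz al t).

Lemma dzD al mu t : dz (al + mu) t = dz al t + dz mu t.
Proof. by rewrite -big_split; apply: eq_bigr => i _; rewrite mxE intrD mulrDl. Qed.

Lemma dzN al t : dz (- al) t = - dz al t.
Proof. by rewrite -sumrN; apply: eq_bigr => i _; rewrite mxE intrN mulNr. Qed.

Lemma dz0 t : dz 0 t = 0.
Proof. by rewrite /dz big1// => i _; rewrite mxE mul0r. Qed.

Lemma dz_delta j t : dz (delta_mx 0 j) t = t 0 j.
Proof.
rewrite /dz (bigD1 j) //= big1 => [|i ij].
  by rewrite !mxE !eqxx mul1r addr0.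
by rewrite !mxE (negbTE ij) mul0r.
Qed.

Lemma dz_line al t j x : dz al (x *: eps j + t) = x * (al 0 j)%:~R + dz al t.
Proof.
rewrite /dz; under eq_bigr do rewrite mxE mulrDr.
rewrite big_split /=; congr (_ + _); rewrite (bigD1 j) //= big1 => [|i ij].
  by rewrite !mxE !eqxx mulr1 addr0 mulrC.
by rewrite !mxE (negbTE ij) !mulr0.
Qed.

Lemma dz_shift al t (v : 'I_r -> int) :
  dz al (t + \row_j (pi * (v j)%:~R)) = dz al t + pi * (\sum_j al 0 j * v j)%:~R.
Proof.
rewrite /dz rmorph_sum mulr_sumr -big_split; apply: eq_bigr => j _.
by rewrite !mxE mulrDr rmorphM /= mulrCA.
Qed.

Lemma ezD al mu t : ez (al + mu) t = ez al t * ez mu t.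
Proof. by rewrite /ez dzD mulrDr expiD. Qed.

Lemma ez0 t : ez 0 t = 1.
Proof. by rewrite /ez dz0 mulr0 expi0. Qed.

Lemma ezN al t : ez (- al) t = (ez al t)^*.
Proof. by rewrite /ez dzN mulrN expi_conj. Qed.

Lemma ez_neq0 al t : ez al t != 0.
Proof.
apply/eqP => h; have := ez0 t; rewrite -(subrr al) ezD h mul0r => /esym/eqP.
by rewrite oner_eq0.
Qed.

Lemma ezV al t : ez (- al) t = (ez al t)^-1.
Proof.
apply: (mulfI (ez_neq0 al t)); rewrite -ezD subrr ez0 mulfV//.
exact: ez_neq0.
Qed.

Lemma ezMn al t n : ez (al *+ n) t = ez al t ^+ n.
Proof. by elim: n => [|n IH]; rewrite ?mulr0n ?ez0// mulrSr ezD IH exprSr. Qed.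

Lemma ez_periodic al : pi_periodic (ez al).
Proof. by move=> t v; rewrite /ez dz_shift mulrDr expiD expi_2pi mulr1. Qed.

Lemma dz_act al s b t : dz al (act s b t)
  = dz (\row_i ((-1) ^+ b (s^-1 i)%g * al 0 (s^-1 i)%g)) t.
Proof.
rewrite /dz (reindex_inj (@perm_inj _ s^-1)%g); apply: eq_bigr => i _.
by rewrite !mxE permKV intrM rmorphXn /= mulrA [_ * (-1) ^+ _]mulrC.
Qed.

Lemma dz_lipschitz al t t' :
  `|dz al t - dz al t'| <= \sum_i `|(al 0 i)%:~R| * `|t 0 i - t' 0 i|.
Proof.
rewrite -sumrB; apply: le_trans (ler_norm_sum _ _ _) _.
by apply: ler_sum => i _; rewrite -mulrBr normrM.
Qed.

Lemma dz_ucont al e : 0 < e -> exists2 d, 0 < d &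
  forall t t', near_row d t t' -> `|2 * dz al t - 2 * dz al t'| < e.
Proof.
move=> e0; pose K : R := 2 * (\sum_i `|(al 0 i)%:~R|) + 1.
have S0 : 0 <= \sum_i `|(al 0 i)%:~R| :> R by exact: sumr_ge0.
have K0 : 0 < K by rewrite ltr_wpDl// mulr_ge0.
exists (e / K); first by rewrite divr_gt0.
move=> t t' tt'; rewrite -mulrBr normrM ger0_norm//.
have h : `|dz al t - dz al t'| <= (\sum_i `|(al 0 i)%:~R|) * (e / K).
  apply: le_trans (dz_lipschitz _ _ _) _; rewrite mulr_suml.
  by apply: ler_sum => i _; rewrite ler_wpM2l// ltW.
apply: (@le_lt_trans _ _ (2 * ((\sum_i `|(al 0 i)%:~R|) * (e / K)))).
  by rewrite ler_wpM2l.
have eK : 0 < e / K by rewrite divr_gt0.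
by rewrite -[ltRHS](divfK (lt0r_neq0 K0)) mulrA mulrC ltr_pM2l// /K ltrDl.
Qed.

Lemma ucont_cos al : ucont near_row (fun t => cos (2 * dz al t)).
Proof.
split; first by exists 1 => d x y _; rewrite !ler_norml !cos_geN1 !cos_le1.
move=> e /(dz_ucont al)[d d0 h]; exists d => // x y /h.
exact/le_lt_trans/cos_lipschitz.
Qed.

Lemma ucont_sin al : ucont near_row (fun t => sin (2 * dz al t)).
Proof.
split; first by exists 1 => d x y _; rewrite !ler_norml !sin_geN1 !sin_le1.
move=> e /(dz_ucont al)[d d0 h]; exists d => // x y /h.
exact/le_lt_trans/sin_lipschitz.
Qed.

Lemma cos_periodic al : pi_periodic (fun t => cos (2 * dz al t)).
Proof. by move=> t v; have := ez_periodic al t v; rewrite /ez /expi => -[]. Qed.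

Lemma sin_periodic al : pi_periodic (fun t => sin (2 * dz al t)).
Proof. by move=> t v; have := ez_periodic al t v; rewrite /ez /expi => -[]. Qed.

Lemma is_derive_dz al j t : is_derive t (eps j) (fun u => 2 * dz al u) (2 * (al 0 j)%:~R).
Proof.
apply/is_derive_line0.
have -> : (fun h : R => 2 * dz al (h *: eps j + t))
    = (fun h : R => (2 * (al 0 j)%:~R) *: h + 2 * dz al t).
  by apply/funext => h; rewrite dz_line /GRing.scale /=; ring.
have := is_deriveD (is_deriveZ (2 * (al 0 j)%:~R) (is_derive_id (0:R) (1:R)))
  (is_derive_cst (2 * dz al t) (0:R) (1:R)).
by rewrite addr0 [_ *: 1]mulr1.
Qed.

Lemma is_derive_cos_dz al j t : is_derive t (eps j) (fun u => cos (2 * dz al u))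
  (- (2 * (al 0 j)%:~R) * sin (2 * dz al t)).
Proof.
have := is_derive_compR (is_derive_cos _) (is_derive_dz al j t).
by congr (is_derive _ _ _ _); ring.
Qed.

Lemma is_derive_sin_dz al j t : is_derive t (eps j) (fun u => sin (2 * dz al u))
  (2 * (al 0 j)%:~R * cos (2 * dz al t)).
Proof.
have := is_derive_compR (is_derive_sin _) (is_derive_dz al j t).
by congr (is_derive _ _ _ _); ring.
Qed.

End Characters.

(** * The weight *)

Section UniformLimits.
Context {R : realType} {T : Type}.
Implicit Types (F G : R -> T -> R).

Definition bounded_fun (f : T -> R) : Prop := exists M, forall t, `|f t| <= M.

Lemma bounded_funM f g : bounded_fun f -> bounded_fun g ->
  bounded_fun (fun t => f t * g t).
Proof.
by move=> [M fM] [N gN]; exists (M * N) => t; rewrite normrM ler_pM.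
Qed.

Lemma bounded_fun_prod (I : Type) (s : seq I) (P : pred I) (f : I -> T -> R) :
  (forall i, P i -> bounded_fun (f i)) ->
  bounded_fun (fun t => \prod_(i <- s | P i) f i t).
Proof.
move=> fb; elim: s => [|i s [M IH]].
  by exists 1 => t; rewrite big_nil normr1.
have [Pi|Pi] := boolP (P i); last first.
  by exists M => t; rewrite big_cons (negbTE Pi).
have [N fN] := fb i Pi; exists (N * M) => t.
by rewrite big_cons Pi normrM ler_pM.
Qed.

Definition unif_lim0 F (f : T -> R) : Prop := forall y, 0 < y ->
  exists2 d, 0 < d & forall h t, 0 < h <= 1 -> h < d -> `|F h t - f t| <= y.

Lemma unif_lim0D F G f g : unif_lim0 F f -> unif_lim0 G g ->
  unif_lim0 (fun h t => F h t + G h t) (fun t => f t + g t).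
Proof.
move=> Ff Gg y y0; have y2 : 0 < y / 2 by rewrite divr_gt0.
have [d1 d10 h1] := Ff _ y2; have [d2 d20 h2] := Gg _ y2.
exists (Num.min d1 d2) => [|h t h01]; first by rewrite lt_min d10.
rewrite lt_min => /andP[/(h1 h t h01) k1 /(h2 h t h01) k2].
by rewrite opprD addrACA [y]splitr (le_trans (ler_normD _ _))// lerD.
Qed.

Lemma unif_lim0_bounded F f g : bounded_fun g -> unif_lim0 F f ->
  unif_lim0 (fun h t => g t * F h t) (fun t => g t * f t).
Proof.
move=> [M gM] Ff y y0; pose K := `|M| + 1; have K0 : 0 < K by rewrite ltr_wpDl.
have [d d0 h] := Ff _ (divr_gt0 y0 K0); exists d => // e t e01 ed.
rewrite -mulrBr normrM.
have -> : y = K * (y / K) by field; rewrite gt_eqF.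
apply: ler_pM => //; last exact: h.
by apply: le_trans (gM t) _; apply: le_trans (ler_norm _) _; rewrite lerDl.
Qed.

Lemma unif_lim0_sum (I : Type) (s : seq I) (P : pred I) (F : I -> R -> T -> R)
    (f : I -> T -> R) : (forall i, P i -> unif_lim0 (F i) (f i)) ->
  unif_lim0 (fun h t => \sum_(i <- s | P i) F i h t)
    (fun t => \sum_(i <- s | P i) f i t).
Proof.
move=> Ff; elim: s => [|i s IH].
  move=> y y0; exists 1 => // h t _ _; rewrite !big_nil subrr normr0.
  exact: ltW.
have [Pi|Pi] := boolP (P i) => y y0.
  have [d d0 k] := unif_lim0D (Ff i Pi) IH y0; exists d => // h t h1 h2.
  by rewrite !big_cons Pi; exact: k.
have [d d0 k] := IH y y0; exists d => // h t h1 h2.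
by rewrite !big_cons (negbTE Pi); exact: k.
Qed.

Definition small_at (q f : T -> R) : Prop := forall y, 0 < y ->
  exists2 d, 0 < d & forall t, q t < d -> `|f t| <= y.

Lemma small_atM q f g : small_at q f -> bounded_fun g ->
  small_at q (fun t => f t * g t).
Proof.
move=> qf [M gM] y y0; pose K := `|M| + 1; have K0 : 0 < K by rewrite ltr_wpDl.
have [d d0 h] := qf _ (divr_gt0 y0 K0); exists d => // t /h ft.
have -> : y = y / K * K by field; rewrite gt_eqF.
rewrite normrM; apply: ler_pM => //.
by apply: le_trans (gM t) _; apply: le_trans (ler_norm _) _; rewrite lerDl.
Qed.

Lemma small_at_ext q f g : f =1 g -> small_at q f -> small_at q g.
Proof. by move=> /funext->. Qed.

Lemma small_at_prod (I : finType) (P : pred I) (q : T -> R) (f : I -> T -> R) i :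
  P i -> (forall i, P i -> bounded_fun (f i)) -> small_at q (f i) ->
  small_at q (fun t => \prod_(i | P i) f i t).
Proof.
move=> Pi fb fi.
apply: (@small_at_ext _ (fun t => f i t * \prod_(k | P k && (k != i)) f k t)).
  by move=> t; rewrite [RHS](bigD1 i).
by apply: small_atM => //; apply: bounded_fun_prod => k /andP[/fb].
Qed.

Lemma small_at_powR (q : T -> R) (p : R) : 0 < p -> (forall t, 0 <= q t) ->
  small_at q (fun t => (q t + 0) `^ p).
Proof.
move=> p0 q0 y y0; exists (y `^ p^-1); first by rewrite powR_gt0.
move=> t qt; rewrite addr0 ger0_norm ?powR_ge0//.
rewrite -(powRr1 (ltW y0)) -(mulVf (lt0r_neq0 p0)) powRrM.
by apply: ge0_ler_powR; rewrite ?nnegrE ?powR_ge0 ?q0 ?ltW.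
Qed.

End UniformLimits.

Section Weight.
Local Open Scope classical_set_scope.
Local Open Scope ring_scope.
Context {R : realType} {r : nat}.
Implicit Types (al : 'rV[int]_r) (t : 'rV[R]_r).

Notation de i := (delta_mx 0 i : 'rV[int]_r).

(** This is |1 - ez al t|^2 = 4 sin^2 (dz al t), a smooth function whose powers make up the
    density. *)
Definition qroot al t : R := 2 - 2 * cos (2 * dz al t).

(** The square of the cosine of t_i for e = 1, of the sine for e = -1. *)
Definition qcos (e : R) (i : 'I_r) t : R := (1 + e * cos (2 * dz (de i) t)) / 2.

Lemma qroot_itv al t : 0 <= qroot al t <= 4.
Proof.
rewrite /qroot; have := cos_geN1 (2 * dz al t); have := cos_le1 (2 * dz al t).
by move=> ? ?; apply/andP; split; lra.
Qed.

Lemma qcos_itv (e : R) i t : e = 1 \/ e = -1 -> 0 <= qcos e i t <= 1.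
Proof.
rewrite /qcos; have := cos_geN1 (2 * dz (de i) t).
have := cos_le1 (2 * dz (de i) t).
by move=> ? ? [|] ->; apply/andP; split; lra.
Qed.

Lemma regular_weight_qroot j al (p : R) : 0 <= p ->
  regular_weight j (fun h t => (qroot al t + h) `^ p)
    (fun h t => p * (4 * (al 0 j)%:~R * sin (2 * dz al t) / (qroot al t + h))).
Proof.
move=> p0; apply: regular_weight_powR => //; last exact: qroot_itv.
- by move=> t v; rewrite /qroot (cos_periodic al).
- apply: (ucontD (@near_rowW R r)); first exact: ucont_cst.
  apply: ucontN; first exact: near_rowW.
  by apply: (ucontM (@near_rowW R r)); [exact: ucont_cst|exact: ucont_cos].
- by apply: (ucontM (@near_rowW R r)); [exact: ucont_cst|exact: ucont_sin].
- move=> t; have := is_deriveB (is_derive_cst (2 : R) t (eps j))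
    (is_deriveZ 2 (is_derive_cos_dz al j t)).
  by congr (is_derive _ _ _ _); rewrite /GRing.scale /=; ring.
Qed.

Lemma regular_weight_qcos j (e : R) i (p : R) : e = 1 \/ e = -1 -> 0 <= p ->
  regular_weight j (fun h t => (qcos e i t + h) `^ p)
    (fun h t => p * (- e * (de i 0 j)%:~R * sin (2 * dz (de i) t) / (qcos e i t + h))).
Proof.
move=> e1 p0; apply: regular_weight_powR => //.
- by move=> t v; rewrite /qcos (cos_periodic (de i)).
- apply: (ucontM (@near_rowW R r)); last exact: ucont_cst.
  apply: (ucontD (@near_rowW R r)); first exact: ucont_cst.
  by apply: (ucontM (@near_rowW R r)); [exact: ucont_cst|exact: ucont_cos].
- by apply: (ucontM (@near_rowW R r)); [exact: ucont_cst|exact: ucont_sin].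
- move=> t; have := is_deriveZ 2^-1 (is_deriveD (is_derive_cst (1 : R) t (eps j))
    (is_deriveZ e (is_derive_cos_dz (de i) j t))).
  have -> : 2^-1 \*: (cst 1 + e \*: (fun u => cos (2 * dz (de i) u))) = qcos e i.
    by apply/funext => u; rewrite /qcos mulrC.
  by congr (is_derive _ _ _ _); rewrite /GRing.scale /=; field.
- by move=> t; have /andP[? ?] := qcos_itv i t e1; apply/andP; split; lra.
Qed.

(* The reflections that enter the [j]-th Cherednik operator: [inl (k, s)] is the
   root [eps j + eps k] or [eps j - eps k], according to [s]; [inr true] is
   [eps j] and [inr false] is [2 *: eps j].  The value of [rmult] is the
   multiplicity of the root times its [j]-th coordinate. *)
Definition rindex : finType := ('I_r * bool + bool)%type.

Definition rvalid (j : 'I_r) (i : rindex) : bool :=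
  if i is inl ks then ks.1 != j else true.

Definition rmult (a b iota : R) (i : rindex) : R :=
  match i with inl _ => a | inr true => 2 * b | inr false => 2 * iota end.

Definition rvec (j : 'I_r) (i : rindex) : 'rV[int]_r :=
  match i with
  | inl (k, true) => de j + de k
  | inl (k, false) => de j - de k
  | inr true => de j
  | inr false => de j *+ 2
  end.

Definition rrefl {F : numFieldType} (j : 'I_r) (i : rindex) (t : 'rV[F]_r) : 'rV[F]_r :=
  match i with
  | inl (k, s) => act (tperm j k) (fun l => s && ((l == j) || (l == k))) t
  | inr _ => act 1%g (pred1 j) t
  end.

(** At h = 0 this is the density times |Cos|^(2 kappa) or |Sin|^(2 kappa). The exponents are halved
    because [qroot] and [qcos] are squares, and that of the pairs once more because ordered pairs
    count each root twice; the symmetric indexing makes invariance under signed permutations a mere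
    reindexing. *)
Definition weight (a b iota e kappa h : R) t : R :=
  (\prod_(i < r) \prod_(k < r | k != i)
    ((qroot (de i - de k) t + h) `^ (a / 4) * (qroot (de i + de k) t + h) `^ (a / 4)))
  * \prod_(i < r) ((qroot (de i) t + h) `^ b * (qroot (de i *+ 2) t + h) `^ (iota / 2)
      * (qcos e i t + h) `^ kappa).

Definition weight_logder (a b iota e kappa : R) (j : 'I_r) (h : R) t : R :=
  \sum_(i : rindex | rvalid j i)
    2 * rmult a b iota i * (sin (2 * dz (rvec j i) t) / (qroot (rvec j i) t + h))
  + kappa * (- e * sin (2 * dz (de j) t) / (qcos e j t + h)).

Lemma sum_rindex (V : nmodType) (j : 'I_r) (f : rindex -> V) :
  \sum_(i : rindex | rvalid j i) f i
  = \sum_(k < r | k != j) (f (inl (k, true)) + f (inl (k, false)))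
    + (f (inr true) + f (inr false)).
Proof.
rewrite big_sumType /= big_bool; congr (_ + _).
transitivity (\sum_(p : 'I_r * bool | (p.1 != j) && true) f (inl (p.1, p.2))).
  by apply: eq_big => -[k s]; rewrite /= ?andbT.
rewrite -(pair_big (fun k => k != j) xpredT (fun k s => f (inl (k, s)))) /=.
by apply: eq_bigr => k _; rewrite big_bool.
Qed.

Lemma sum_pairs_at (T : 'I_r -> 'I_r -> R) (j : 'I_r) :
  (forall i k, T i k = T k i) -> (forall i k, i != j -> k != j -> T i k = 0) ->
  \sum_(i < r) \sum_(k < r | k != i) T i k = 2 * \sum_(k < r | k != j) T j k.
Proof.
move=> Ts T0; rewrite (bigD1 j) //= mulrDl mul1r; congr (_ + _).
apply: eq_bigr => i ij; rewrite (bigD1 j) /=; last by rewrite eq_sym.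
by rewrite big1 ?addr0// => k /andP[_ kj]; exact: T0.
Qed.

Lemma dz_deB (i k : 'I_r) t : dz (de i - de k) t = t 0 i - t 0 k.
Proof. by rewrite dzD dzN !dz_delta. Qed.

Lemma dz_deD (i k : 'I_r) t : dz (de i + de k) t = t 0 i + t 0 k.
Proof. by rewrite dzD !dz_delta. Qed.

Lemma qroot_deC (i k : 'I_r) t : qroot (de i - de k) t = qroot (de k - de i) t.
Proof. by rewrite /qroot !dz_deB -[t 0 k - _]opprB mulrN cosN. Qed.

Lemma regular_weight_weight (a b iota e kappa : R) j : 0 <= a -> 0 <= b -> 0 <= iota ->
  e = 1 \/ e = -1 -> 0 <= kappa ->
  regular_weight j (weight a b iota e kappa) (weight_logder a b iota e kappa j).
Proof.
move=> a0 b0 i0 e1 k0.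
have h := regular_weightM
  (@regular_weight_prod R r j _ (index_enum 'I_r) xpredT _ _ (fun i _ =>
    @regular_weight_prod R r j _ (index_enum 'I_r) (fun k => k != i) _ _ (fun k _ =>
      regular_weightM (@regular_weight_qroot j (de i - de k) (a / 4) ltac:(lra))
        (@regular_weight_qroot j (de i + de k) (a / 4) ltac:(lra)))))
  (@regular_weight_prod R r j _ (index_enum 'I_r) xpredT _ _ (fun i _ =>
    regular_weightM
      (regular_weightM (@regular_weight_qroot j (de i) b b0)
        (@regular_weight_qroot j (de i *+ 2) (iota / 2) ltac:(lra)))
      (@regular_weight_qcos j e i kappa e1 k0))).
move: h; congr (regular_weight _ _ _).
apply/funext => h; apply/funext => t; rewrite /weight_logder sum_rindex -addrA.
congr (_ + _).
  rewrite (@sum_pairs_at _ j).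
  - rewrite mulr_sumr; apply: eq_bigr => k kj.
    rewrite !mxE !eqxx [j == k]eq_sym (negbTE kj) /=.
    set X := (qroot (de j - de k) t + h)^-1.
    by set Y := (qroot (de j + de k) t + h)^-1; field.
  - move=> i k; rewrite [de k + de i]addrC (qroot_deC k i).
    congr (_ * (_ / _) + _); rewrite !dz_deB -[t 0 k - _]opprB mulrN sinN.
    by rewrite !mxE !intrB /=; ring.
  - move=> i k ij kj; rewrite !mxE /= [j == i]eq_sym [j == k]eq_sym.
    by rewrite (negbTE ij) (negbTE kj) /=; ring.
rewrite (bigD1 j) //= big1 => [|i ij].
  rewrite !mxE !eqxx /=; set X := (qroot (de j) t + h)^-1.
  by set Y := (qroot (de j *+ 2) t + h)^-1; set Z := (qcos e j t + h)^-1; field.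
by rewrite !mxE [j == i]eq_sym (negbTE ij) /=; ring.
Qed.

End Weight.

Arguments rindex r : clear implicits.

(** * Integration by parts against the singular weight *)

Section WeightStokes.
Local Open Scope classical_set_scope.
Local Open Scope ring_scope.
Context {R : realType} {r : nat}.
Variables a b iota e kappa : R.
Hypotheses (a0 : 0 <= a) (b0 : 0 <= b) (iota0 : 0 <= iota) (kappa0 : 0 <= kappa).
Hypothesis e1 : e = 1 \/ e = -1.
Implicit Types (t : 'rV[R]_r).

Notation de i := (delta_mx 0 i : 'rV[int]_r).
Notation W := (@weight R r a b iota e kappa).
Notation mult := (@rmult R r a b iota).

Lemma rrefl_actE j i : exists s c, forall t : 'rV[R]_r, rrefl j i t = act s c t.
Proof.
case: i => [[k s]|s]; first by exists (tperm j k); eexists => t; reflexivity.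
by exists 1%g; eexists => t; reflexivity.
Qed.

Lemma dz_rvec_rrefl j i t : rvalid j i ->
  dz (rvec j i) (rrefl j i t) = - dz (rvec j i) t.
Proof.
case: i => [[k s]|[]] /= kj.
- case: s; rewrite ?dz_deD ?dz_deB !mxE tpermL tpermR /= ?eqxx ?orbT /=; ring.
- by rewrite !dz_delta !mxE perm1 /= eqxx /=; ring.
- by rewrite !mulr2n !dzD !dz_delta !mxE perm1 /= eqxx /=; ring.
Qed.

Lemma qroot_rvec_rrefl j i t : rvalid j i ->
  qroot (rvec j i) (rrefl j i t) = qroot (rvec j i) t.
Proof. by move=> ji; rewrite /qroot dz_rvec_rrefl// mulrN cosN. Qed.

Lemma weight_act s c h t : W h (act s c t) = W h t.
Proof.
rewrite /weight; congr (_ * _).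
  rewrite [RHS](reindex_inj (@perm_inj _ s)) /=; apply: eq_bigr => i _.
  rewrite [RHS](reindex_inj (@perm_inj _ s)) /=.
  apply: eq_big => [k|k ki]; first by rewrite (inj_eq perm_inj).
  rewrite /qroot !dz_deB !dz_deD !mxE.
  set x := t 0 (s i); set y := t 0 (s k).
  case: (c i); case: (c k); rewrite /= ?expr0 ?expr1 ?mulN1r ?mul1r.
  - by rewrite -!opprD !mulrN !cosN.
  - by rewrite -opprD [- x + y]addrC -[y - x]opprB !mulrN !cosN mulrC.
  - by rewrite opprK mulrC.
  - by [].
rewrite [RHS](reindex_inj (@perm_inj _ s)) /=; apply: eq_bigr => i _.
rewrite /qcos /qroot !mulr2n !dzD !dz_delta !mxE.
by case: (c i); rewrite /= ?expr1 ?expr0 ?mulN1r ?mul1r -?opprD ?mulrN ?cosN.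
Qed.

Lemma weight_rrefl j i h t : W h (rrefl j i t) = W h t.
Proof. by have [s [c ->]] := rrefl_actE j i; rewrite weight_act. Qed.

Lemma weight_ucont : ucont near_par (fun x : R * 'rV[R]_r => W x.1 x.2).
Proof.
case: (posnP r) => [r0|r0]; last first.
  exact: (rw_ucont (regular_weight_weight (Ordinal r0) a0 b0 iota0 e1 kappa0)).
have noI (i : 'I_r) : False by have := ltn_ord i; rewrite {2}r0.
by apply: ucont_ext (ucont_cst 1) => -[h t]; rewrite /weight !big1 ?mulr1// => i.
Qed.

Lemma weight_ge0 h t : 0 <= W h t.
Proof.
apply: mulr_ge0; apply: prodr_ge0 => i _.
  by apply: prodr_ge0 => k _; rewrite mulr_ge0 ?powR_ge0.
by rewrite !mulr_ge0 ?powR_ge0.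
Qed.

Lemma weight_periodic h : pi_periodic (W h).
Proof.
move=> t v; rewrite /weight /qroot /qcos.
congr (_ * _); apply: eq_bigr => i _.
  by apply: eq_bigr => k _; rewrite (cos_periodic (de i - de k)) (cos_periodic (de i + de k)).
by rewrite (cos_periodic (de i)) (cos_periodic (de i *+ 2)).
Qed.

Lemma weight0_ucont : ucont near_row (W 0).
Proof. by apply: ucont_par_slice weight_ucont; rewrite lexx ler01. Qed.

Lemma bounded_powR (q : 'rV[R]_r -> R) (p : R) : 0 <= p -> (forall t, 0 <= q t <= 4) ->
  bounded_fun (fun t => (q t + 0) `^ p).
Proof.
move=> p0 q4; exists (4 `^ p) => t; rewrite addr0 ger0_norm ?powR_ge0//.
have /andP[? ?] := q4 t; by apply: ge0_ler_powR; rewrite ?nnegrE.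
Qed.

Lemma bounded_qroot (al : 'rV[int]_r) (p : R) : 0 <= p ->
  bounded_fun (fun t => (qroot al t + 0) `^ p).
Proof. by move=> p0; apply: bounded_powR => // t; exact: qroot_itv. Qed.

Lemma bounded_qcos (i : 'I_r) (p : R) : 0 <= p -> bounded_fun (fun t => (qcos e i t + 0) `^ p).
Proof.
move=> p0; apply: bounded_powR => // t.
by have /andP[? ?] := qcos_itv i t e1; apply/andP; split; lra.
Qed.

Let a4_ge0 : 0 <= a / 4. Proof. exact: divr_ge0. Qed.
Let iota2_ge0 : 0 <= iota / 2. Proof. exact: divr_ge0. Qed.

Let bnd_pair i k : bounded_fun (fun t =>
  (qroot (de i - de k) t + 0) `^ (a / 4) * (qroot (de i + de k) t + 0) `^ (a / 4)).
Proof. by apply: bounded_funM; exact: bounded_qroot. Qed.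

Let bnd_single i : bounded_fun (fun t => (qroot (de i) t + 0) `^ b
  * (qroot (de i *+ 2) t + 0) `^ (iota / 2) * (qcos e i t + 0) `^ kappa).
Proof.
apply: bounded_funM; last exact: bounded_qcos.
by apply: bounded_funM; exact: bounded_qroot.
Qed.

Let bpair i' : bounded_fun (fun t => \prod_(k < r | k != i')
  ((qroot (de i' - de k) t + 0) `^ (a / 4) * (qroot (de i' + de k) t + 0) `^ (a / 4))).
Proof. by apply: bounded_fun_prod => k _; exact: bnd_pair. Qed.

(** The weight vanishes on the wall of a root only if its multiplicity is not 0. For a root of
    multiplicity 0 the term concerned has coefficient 0 instead. *)
Lemma weight_small_root (j : 'I_r) i : rvalid j i -> mult i != 0 ->
  small_at (qroot (rvec j i)) (W 0).
Proof.
have q_ge0 al t : 0 <= qroot al t by case/andP: (qroot_itv al t).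
case: i => [[k s]|s] /= kj m0.
  have a4 : 0 < a / 4 by rewrite divr_gt0// lt_neqAle eq_sym m0.
  apply: small_atM; last by apply: bounded_fun_prod => i _; exact: bnd_single.
  apply: (@small_at_prod _ _ _ _ _ _ j) => //.
  apply: (@small_at_prod _ _ _ _ _ _ k) => //.
  case: s; last first.
    by apply: small_atM; [exact: small_at_powR|exact: bounded_qroot].
  apply: small_at_ext (small_atM (small_at_powR a4 (q_ge0 (de j + de k)))
    (@bounded_qroot (de j - de k) (a / 4) a4_ge0)) => t.
  by rewrite mulrC.
have hs : small_at (qroot (rvec j (inr s))) (fun t => (qroot (de j) t + 0) `^ b
    * (qroot (de j *+ 2) t + 0) `^ (iota / 2) * (qcos e j t + 0) `^ kappa).
  apply: small_atM; last exact: bounded_qcos.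
  case: s m0 => m0; rewrite mulf_eq0 pnatr_eq0 /= in m0.
    apply: small_atM; last exact: bounded_qroot.
    by apply: small_at_powR => //; rewrite lt_neqAle eq_sym m0.
  have i2 : 0 < iota / 2 by rewrite divr_gt0// lt_neqAle eq_sym m0.
  apply: small_at_ext (small_atM (small_at_powR i2 (q_ge0 (de j *+ 2)))
    (@bounded_qroot (de j) b b0)) => t.
  by rewrite mulrC.
have := small_atM (@small_at_prod _ _ _ xpredT _ _ j isT (fun i _ => bnd_single i) hs)
  (@bounded_fun_prod _ _ _ (index_enum 'I_r) xpredT _ (fun i _ => bpair i)).
by apply: small_at_ext => t; rewrite /weight mulrC.
Qed.

Lemma weight_small_cos (j : 'I_r) : kappa != 0 -> small_at (qcos e j) (W 0).
Proof.
move=> k0; have q_ge0 i t : 0 <= qcos e i t by case/andP: (qcos_itv i t e1).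
have kp : 0 < kappa by rewrite lt_neqAle eq_sym k0.
have hs : small_at (qcos e j) (fun t => (qroot (de j) t + 0) `^ b
    * (qroot (de j *+ 2) t + 0) `^ (iota / 2) * (qcos e j t + 0) `^ kappa).
  apply: small_at_ext (small_atM (small_at_powR kp (q_ge0 j))
    (bounded_funM (@bounded_qroot (de j) b b0)
      (@bounded_qroot (de j *+ 2) (iota / 2) iota2_ge0))) => t.
  by rewrite mulrC.
have := small_atM (@small_at_prod _ _ _ xpredT _ _ j isT (fun i _ => bnd_single i) hs)
  (@bounded_fun_prod _ _ _ (index_enum 'I_r) xpredT _ (fun i _ => bpair i)).
by apply: small_at_ext => t; rewrite /weight mulrC.
Qed.

Lemma unif_lim0_weight : unif_lim0 W (W 0).
Proof.
move=> y y0; have [_ /(_ _ y0)[d d0 h]] := weight_ucont.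
exists d => // e' t /andP[e'0 e'1] e'd; apply/ltW/(h (e', t) (0, t)).
split => /=; rewrite ?lexx ?ler01 ?(ltW e'0)//.
  by rewrite subr0 gtr0_norm.
by move=> i; rewrite subrr normr0.
Qed.

Lemma unif_lim0_term (Z q : 'rV[R]_r -> R) L : (forall t, 0 <= q t) ->
  (forall t, `|Z t| <= L * q t) -> small_at q (W 0) ->
  unif_lim0 (fun h t => Z t / (q t + h) * W h t) (fun t => Z t / q t * W 0 t).
Proof.
move=> q0 ZL qs y y0.
apply: (regularised_term_cvg weight_ucont (fun h t _ => weight_ge0 h t) q0 ZL) => //.
move=> y' /qs[d d0 h]; exists d => // t /h; rewrite ger0_norm//.
exact: weight_ge0.
Qed.

(* Pairing the term of each root with its reflection turns the logarithmic
   derivative of the weight into divided differences of [G]. *)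
Lemma stokes_symmetrised j (G G' : 'rV[R]_r -> R) L :
  pi_periodic G -> ucont near_row G -> ucont near_row G' ->
  (forall t, is_derive t (eps j) G (G' t)) ->
  (forall i, rvalid j i -> forall t,
    `|(G t - G (rrefl j i t)) * sin (2 * dz (rvec j i) t)| <= L * qroot (rvec j i) t) ->
  (kappa != 0 -> forall t, `|- e * sin (2 * dz (de j) t) * G t| <= L * qcos e j t) ->
  gmean n.+1 (fun t => (G' t
      + (\sum_(i : rindex r | rvalid j i) mult i *
          ((G t - G (rrefl j i t)) * sin (2 * dz (rvec j i) t) / qroot (rvec j i) t))
      + kappa * (- e * sin (2 * dz (de j) t) * G t / qcos e j t)) * W 0 t)
    @[n --> \oo] --> 0.
Proof.
move=> Gp Gu G'u Gd GL GK.
have RW := regular_weight_weight j a0 b0 iota0 e1 kappa0.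
pose A h t := (G' t
      + (\sum_(i : rindex r | rvalid j i) mult i *
          ((G t - G (rrefl j i t)) * sin (2 * dz (rvec j i) t) / (qroot (rvec j i) t + h)))
      + kappa * (- e * sin (2 * dz (de j) t) * G t / (qcos e j t + h))) * W h t.
have symm n h : gmean n.+1 (fun t =>
    (G' t + weight_logder a b iota e kappa j h t * G t) * W h t) = gmean n.+1 (A h).
  apply/eqP; rewrite -subr_eq0 -gmeanB; apply/eqP.
  (* Write 2 G as (G - G o s) + (G + G o s) for the reflection s of each root. The sine is odd under
     s, the weight and [qroot] are even, so the symmetric part [B] has mean 0; this absorbs the
     factor 2 of [weight_logder]. *)
  pose B i t := mult i * (sin (2 * dz (rvec j i) t) / (qroot (rvec j i) t + h))
    * (G t + G (rrefl j i t)) * W h t.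
  transitivity (gmean n.+1 (fun t => \sum_(i : rindex r | rvalid j i) B i t)).
    apply: gmean_ext => t; rewrite /A -mulrBl -mulr_suml; congr (_ * _).
    rewrite /weight_logder mulrDl mulr_suml.
    set S1 := \sum_(_ | _) _; set S2 := \sum_(_ | _) _.
    have -> : G' t + (S1 + kappa * (- e * sin (2 * dz 'e_j t) / (qcos e j t + h)) * G t)
       - (G' t + S2 + kappa * (- e * sin (2 * dz 'e_j t) * G t / (qcos e j t + h)))
       = S1 - S2 by ring.
    rewrite -sumrB; apply: eq_bigr => i _; ring.
  rewrite gmean_sum big1// => i ij.
  have Bp : pi_periodic (B i).
    have Gsp : pi_periodic (fun t => G (rrefl j i t)).
      have [s [c rE]] := rrefl_actE j i => t v; rewrite !rE.
      have -> : act s c (t + \row_k (pi * (v k)%:~R))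
          = act s c t + \row_k (pi * ((-1) ^+ c k * v (s k))%:~R).
        apply/rowP => k; rewrite !mxE mulrDr intrM rmorphXn /=; ring.
      exact: Gp.
    move=> t v; rewrite /B /qroot (sin_periodic (rvec j i)) (cos_periodic (rvec j i)).
    by rewrite Gp Gsp weight_periodic.
  have [s [c rE]] := rrefl_actE j i.
  have : gmean n.+1 (B i) = - gmean n.+1 (B i).
    rewrite -[LHS](gmean_act s c Bp)// -gmeanN; apply: gmean_ext => t.
    rewrite -rE /B weight_rrefl dz_rvec_rrefl// qroot_rvec_rrefl// mulrN sinN.
    have -> : rrefl j i (rrefl j i t) = t.
      case: i ij {Bp rE B} => [[k s']|s'] /= kj; apply/rowP => l; rewrite !mxE; last first.
        by rewrite !perm1 /=; case: (l == j); rewrite /=; ring.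
      rewrite tpermK; case: tpermP => [->|->|/eqP/negbTE-> /eqP/negbTE->];
        rewrite ?eqxx ?(negbTE kj) ?[j == k]eq_sym ?(negbTE kj) /= ?andbT ?andbF /=;
        by case: s' => /=; ring.
    by ring.
  by move/eqP; rewrite -subr_eq0 opprK -mulr2n mulrn_eq0 => /eqP.
have lim : unif_lim0 A (A 0).
  have EA h : A h = fun t => G' t * W h t
      + \sum_(i : rindex r | rvalid j i) (mult i *
          ((G t - G (rrefl j i t)) * sin (2 * dz (rvec j i) t) / (qroot (rvec j i) t + h) * W h t))
      + kappa * (- e * sin (2 * dz (de j) t) * G t / (qcos e j t + h) * W h t).
    apply/funext => t; rewrite /A !mulrDl mulr_suml; congr (_ + _ + _); last by rewrite -mulrA.
    by apply: eq_bigr => i _; rewrite -mulrA.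
  have -> : A = fun h => A h by [].
  under [X in unif_lim0 X _]eq_fun do rewrite EA.
  rewrite EA.
  apply: unif_lim0D.
    apply: unif_lim0D.
      apply: unif_lim0_bounded unif_lim0_weight.
      have [[M WM] _] := G'u; exists M => t.
      by case: (WM 1 t t) => [i|//]; rewrite subrr normr0.
    apply: unif_lim0_sum => i ij.
    have [m0|m0] := eqVneq (mult i) 0.
      move=> y y0; exists 1 => // h t _ _.
      by rewrite m0 !mul0r subrr normr0 ltW.
    apply: unif_lim0_bounded; first by exists `|mult i|.
    have := @unif_lim0_term (fun t => (G t - G (rrefl j i t)) * sin (2 * dz (rvec j i) t))
      (qroot (rvec j i)) L (fun t => proj1 (andP (qroot_itv _ t))) (GL i ij)
      (weight_small_root ij m0).
    by under [X in _ -> unif_lim0 _ X]eq_fun do rewrite addr0.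
  have [k0|k0] := eqVneq kappa 0.
    move=> y y0; exists 1 => // h t _ _.
    by rewrite k0 !mul0r subrr normr0 ltW.
  apply: unif_lim0_bounded; first by exists `|kappa|.
  have := @unif_lim0_term (fun t => - e * sin (2 * dz (de j) t) * G t)
    (qcos e j) L (fun t => proj1 (andP (qcos_itv _ t e1))) (GK k0)
    (weight_small_cos j k0).
  by under [X in _ -> unif_lim0 _ X]eq_fun do rewrite addr0.
have <- : A 0 = fun t => (G' t
      + (\sum_(i : rindex r | rvalid j i) mult i *
          ((G t - G (rrefl j i t)) * sin (2 * dz (rvec j i) t) / qroot (rvec j i) t))
      + kappa * (- e * sin (2 * dz (de j) t) * G t / qcos e j t)) * W 0 t.
  apply/funext => t; rewrite /A addr0; congr ((_ + _ + _) * _).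
  by apply: eq_bigr => i _; rewrite addr0.
apply/cvgrPdist_le => y y0; have y2 : 0 < y / 2 by rewrite divr_gt0.
have [d d0 hd] := lim _ y2.
(* One fixed h is enough: the error made by passing from h to 0 is uniform in n, so the two limits
   need not be exchanged. *)
pose h := Num.min 1 (d / 2).
have h01 : 0 < h <= 1 by rewrite lt_min ltr01 divr_gt0//= ge_min lexx.
have hd' : h < d.
  rewrite /h gt_min; apply/orP; right; rewrite ltr_pdivrMr// ltr_pMr// ltr1n.
  by [].
have := stokes_regularised RW Gp Gu G'u Gd h01.
move=> /cvgrPdist_le /(_ _ y2) [N _ hN]; exists N => // n /= Nn.
have := hN n Nn; rewrite /= symm !sub0r !normrN => k1.
have k2 : `|gmean n.+1 (A h) - gmean n.+1 (A 0)| <= y / 2.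
  by rewrite -gmeanB; apply: gmean_norm => [|t]; [exact: ltW|exact: hd].
rewrite [y]splitr; have -> : gmean n.+1 (A 0)
    = gmean n.+1 (A h) - (gmean n.+1 (A h) - gmean n.+1 (A 0)) by ring.
by apply: le_trans (ler_normB _ _) _; exact: lerD.
Qed.

End WeightStokes.

(** * Cherednik operators on trigonometric polynomials *)

Section TrigPolynomials.
Local Open Scope classical_set_scope.
Local Open Scope ring_scope.
Local Open Scope complex_scope.
Context {R : realType} {r : nat}.
Implicit Types (mu al : 'rV[int]_r) (t : 'rV[R]_r) (F G : 'rV[R]_r -> R[i]).

Notation de i := (delta_mx 0 i : 'rV[int]_r).

Lemma derive_line (f : 'rV[R]_r -> R) t v :
  'D_v f t = 'D_(1 : R) (fun h : R => f (h *: v + t)) (0 : R).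
Proof.
set g := fun h : R => f (h *: v + t).
rewrite /derive; suff -> : (fun h : R => h^-1 *: ((f \o shift t) (h *: v) - f t))
    = (fun h : R => h^-1 *: ((g \o shift (0 : R)) (h *: (1 : R)) - g 0)) by [].
by apply/funext => h; rewrite /g /= addr0 scale0r add0r [h *: 1]mulr1.
Qed.

Definition is_partialC (j : 'I_r) F t (d : R[i]) : Prop :=
  is_derive t (eps j) (fun u => complex.Re (F u)) (complex.Re d) /\
  is_derive t (eps j) (fun u => complex.Im (F u)) (complex.Im d).

Lemma is_partialC_val j F t d : is_partialC j F t d -> partialC j F t = d.
Proof.
move=> [[_ dR] [_ dI]]; apply/eqP.
by rewrite /partialC dR dI eq_complex /= !eqxx.
Qed.

Lemma is_partialC_cst j (c : R[i]) t : is_partialC j (fun=> c) t 0.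
Proof. by split; exact: is_derive_cst. Qed.

Lemma complex_ReD (x y : R[i]) : complex.Re (x + y) = complex.Re x + complex.Re y.
Proof. by case: x; case: y. Qed.

Lemma complex_ImD (x y : R[i]) : complex.Im (x + y) = complex.Im x + complex.Im y.
Proof. by case: x; case: y. Qed.

Lemma complex_ReM (x y : R[i]) :
  complex.Re (x * y) = complex.Re x * complex.Re y - complex.Im x * complex.Im y.
Proof. by case: x; case: y. Qed.

Lemma complex_ImM (x y : R[i]) :
  complex.Im (x * y) = complex.Re x * complex.Im y + complex.Im x * complex.Re y.
Proof. by case: x; case: y. Qed.

Lemma is_partialCD j F G t d d' : is_partialC j F t d -> is_partialC j G t d' ->
  is_partialC j (fun u => F u + G u) t (d + d').
Proof.
move=> [FR FI] [GR GI]; split.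
  have := is_deriveD FR GR; rewrite -complex_ReD.
  by congr (is_derive _ _ _ _); apply/funext => u; rewrite complex_ReD.
have := is_deriveD FI GI; rewrite -complex_ImD.
by congr (is_derive _ _ _ _); apply/funext => u; rewrite complex_ImD.
Qed.

Lemma is_partialCM j F G t d d' : is_partialC j F t d -> is_partialC j G t d' ->
  is_partialC j (fun u => F u * G u) t (d * G t + F t * d').
Proof.
move=> [FR FI] [GR GI]; split.
  have := is_deriveB (is_derive_mulR FR GR) (is_derive_mulR FI GI).
  congr (is_derive _ _ _ _); first by apply/funext => u; rewrite complex_ReM.
  by rewrite complex_ReD !complex_ReM; ring.
have := is_deriveD (is_derive_mulR FR GI) (is_derive_mulR FI GR).
congr (is_derive _ _ _ _); first by apply/funext => u; rewrite complex_ImM.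
by rewrite complex_ImD !complex_ImM; ring.
Qed.

Lemma is_partialC_ez j mu t :
  is_partialC j (ez mu) t (2 * 'i%C * (mu 0 j)%:~R * ez mu t).
Proof.
split.
  have := is_derive_cos_dz mu j t; congr (is_derive _ _ _ _).
  rewrite /ez /expi -[(mu 0 j)%:~R in RHS](rmorph_int (real_complex R)) /=; ring.
have := is_derive_sin_dz mu j t; congr (is_derive _ _ _ _).
rewrite /ez /expi -[(mu 0 j)%:~R in RHS](rmorph_int (real_complex R)) /=; ring.
Qed.

(** A formal combination of exponentials, repetitions allowed. Lifting the operators to such lists
    makes it possible to inspect which exponents occur. *)
Definition trig_poly : Type := seq (R[i] * 'rV[int]_r).

Definition ev (l : trig_poly) t : R[i] := \sum_(x <- l) x.1 * ez x.2 t.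

Definition tscale (c : R[i]) (l : trig_poly) : trig_poly :=
  [seq (c * x.1, x.2) | x <- l].

Lemma ev_nil t : ev [::] t = 0.
Proof. by rewrite /ev big_nil. Qed.

Lemma ev_cons x l t : ev (x :: l) t = x.1 * ez x.2 t + ev l t.
Proof. by rewrite /ev big_cons. Qed.

Lemma ev_cat l l' t : ev (l ++ l') t = ev l t + ev l' t.
Proof. by rewrite /ev big_cat. Qed.

Lemma ev_scale c l t : ev (tscale c l) t = c * ev l t.
Proof. by rewrite /ev big_map mulr_sumr; apply: eq_bigr => x _ /=; rewrite mulrA. Qed.

Lemma ev_flatten ls t : ev (flatten ls) t = \sum_(l <- ls) ev l t.
Proof. by rewrite /ev big_flatten. Qed.

Lemma is_partialC_ev j l t :
  is_partialC j (ev l) t (\sum_(x <- l) x.1 * (2 * 'i%C * (x.2 0 j)%:~R * ez x.2 t)).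
Proof.
elim: l => [|x l IH].
  rewrite big_nil (_ : ev [::] = fun=> 0); first exact: is_partialC_cst.
  by apply/funext => u; rewrite ev_nil.
rewrite big_cons (_ : ev (x :: l) = fun u => x.1 * ez x.2 u + ev l u); last first.
  by apply/funext => u; rewrite ev_cons.
apply: is_partialCD IH.
have := is_partialCM (is_partialC_cst j x.1 t) (is_partialC_ez j x.2 t).
by rewrite mul0r add0r.
Qed.

(** The divided difference of an exponential, as a geometric sum. For n >= 0 the string runs from mu
    to mu - (n - 1) al, and for n < 0 from mu + al to mu - n al with sign -1. The end mu thus occurs
    only in the first case and the reflected end only in the second; this asymmetry is what makes
    the operators triangular. *)
Definition geo (mu al : 'rV[int]_r) (n : int) : trig_poly :=
  match n with
  | Posz m => mkseq (fun i => (1, mu - al *+ i)) m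
  | Negz m => mkseq (fun i => (-1, mu + al *+ i.+1)) m.+1
  end.

Lemma ev_geo mu al n t : ez al t != 1 ->
  (ez mu t - ez (mu - al *~ n) t) / (1 - ez (- al) t) = ev (geo mu al n) t.
Proof.
move=> al1; have v0 : 1 - ez (- al) t != 0.
  rewrite subr_eq0 ezV eq_sym; apply: contra al1 => /eqP h.
  by rewrite -[ez al t]invrK h invr1.
apply: (mulIf v0); rewrite divfK// ezD -mulrN.
case: n => m /=.
  rewrite /ev big_map -[X in seq.iota 0 X]subn0 -/(index_iota 0 m) big_mkord /=.
  rewrite (eq_bigr (fun i : 'I_m => ez mu t * ez (- al) t ^+ i)) => [|i _]; last first.
    by rewrite mul1r ezD -mulNrn ezMn.
  rewrite -mulr_sumr -mulrA [_ * (1 - _)]mulrC -opprB mulNr -subrX1 opprB.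
  by rewrite -pmulrn -mulNrn ezMn mulrBr mulr1 mulrN.
rewrite /ev big_map -[X in seq.iota 0 X]subn0 -/(index_iota 0 m.+1) big_mkord /=.
rewrite (eq_bigr (fun i : 'I_m.+1 => - (ez mu t * ez al t) * ez al t ^+ i)) => [|i _]; last first.
  by rewrite mulN1r ezD ezMn exprS mulrA mulNr.
rewrite -mulr_sumr NegzE mulrNz opprK -pmulrn ezMn ezV.
have x0 := ez_neq0 al t; set x := ez al t in x0 *.
have -> : 1 - x^-1 = (x - 1) / x by field.
transitivity (- (ez mu t) * ((x - 1) * \sum_(i < m.+1) x ^+ i)); last by field.
by rewrite -subrX1; ring.
Qed.

Variables a b iota : R.
Notation regular := (@regular R r a b iota).
Notation cherednik := (@cherednik R r a b iota).
Notation mult := (@rmult R r a b iota).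

(* Each root enters the [j]-th operator as a positive root [pvec j i], which is
   [- rvec j i] when [pneg j i]. *)
Definition pneg (j : 'I_r) (i : rindex r) : bool :=
  if i is inl (k, false) then (k < j)%N else false.

Definition pvec (j : 'I_r) (i : rindex r) : 'rV[int]_r :=
  if pneg j i then - rvec j i else rvec j i.

Definition pcoef (j : 'I_r) (i : rindex r) : R :=
  if pneg j i then - mult i else mult i.

(** The integer 2 (mu, al) / (al, al) for al = [pvec j i], that is, the pairing of mu with the
    coroot. *)
Definition ppair (j : 'I_r) (i : rindex r) (mu : 'rV[int]_r) : int :=
  let n := match i with
    | inl (k, true) => mu 0 j + mu 0 k
    | inl (k, false) => mu 0 j - mu 0 k
    | inr true => mu 0 j *+ 2
    | inr false => mu 0 j
    end in
  if pneg j i then - n else n.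

Lemma pvec_ppair j i mu : pvec j i *~ ppair j i mu =
  rvec j i *~ (if pneg j i then - ppair j i mu else ppair j i mu).
Proof.
by rewrite /pvec; case: ifP => // _; rewrite mulNrz mulrNz.
Qed.

Lemma mulmz_coord (al : 'rV[int]_r) (n : int) l : (al *~ n) 0 l = al 0 l * n.
Proof.
case: n => m; first by rewrite -pmulrn mulmxnE -mulr_natr natz.
by rewrite NegzE mulrNz mxE -pmulrn mulmxnE -mulr_natr natz mulrN.
Qed.

Lemma ez_rrefl j i mu t : rvalid j i ->
  ez mu (rrefl j i t) = ez (mu - pvec j i *~ ppair j i mu) t.
Proof.
move=> ji; rewrite pvec_ppair.
have -> : (if pneg j i then - ppair j i mu else ppair j i mu) =
    match i with
    | inl (k, true) => mu 0 j + mu 0 k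
    | inl (k, false) => mu 0 j - mu 0 k
    | inr true => mu 0 j *+ 2
    | inr false => mu 0 j
    end.
  by rewrite /ppair; case: (pneg j i); rewrite ?opprK.
rewrite /ez; congr (expi (2 * _)).
case: i ji => [[k s]|s] /= kj; rewrite dz_act.
  congr (dz _ t); apply/rowP => l; rewrite tpermV mxE [RHS]mxE [in RHS]mxE mulmz_coord.
  by case: tpermP => [->|->|/eqP/negbTE lj /eqP/negbTE lk];
    rewrite ?eqxx ?orbT ?andbT ?lj ?lk; case: s;
    rewrite !mxE ?eqxx /= ?(negbTE kj) ?[j == k]eq_sym ?(negbTE kj) ?lj ?lk /=; ring.
congr (dz _ t); apply/rowP => l; rewrite mxE [RHS]mxE [in RHS]mxE mulmz_coord.
rewrite invg1 perm1 /=; have [->|lj] := eqVneq l j; case: s;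
  by rewrite ?mulmxnE !mxE ?eqxx ?(negbTE lj) /=; ring.
Qed.

(* Holds at every [t]: both sides use the same quotients, junk [x / 0 = 0] included. *)
Lemma cherednikE j F t : cherednik j F t = partialC j F t
  + \sum_(i : rindex r | rvalid j i) 'i%C * (pcoef j i)%:C *
      ((F t - F (rrefl j i t)) / (1 - ez (- pvec j i) t))
  - 'i%C * (rho a b iota j)%:C * F t.
Proof.
have termE k s : k != j -> (F t - F (rrefl j (inl (k, s)) t)) / (1 - ez (- pvec j (inl (k, s))) t)
    = if s then (F t - F (refl (eps j + eps k) t)) / (1 - expi (- 2 * (t 0 j + t 0 k)))
      else if (k < j)%N then
        (F t - F (refl (eps k - eps j) t)) / (1 - expi (- 2 * (t 0 k - t 0 j)))
      else (F t - F (refl (eps j - eps k) t)) / (1 - expi (- 2 * (t 0 j - t 0 k))).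
  rewrite eq_sym => jk; rewrite /ez dzN mulrN -mulNr; case: s.
    by rewrite /pvec /= dz_deD refl_add.
  rewrite /pvec /=; case: ifP => _; last by rewrite dz_deB refl_sub.
  by rewrite opprB dz_deB -[eps k - eps j]opprB reflN refl_sub.
rewrite sum_rindex /cherednik.
have coefE k (s : bool) : pcoef j (inl (k, s)) = if s then a else if (k < j)%N then - a else a.
  by case: s.
under [X in _ = _ + (X + _) - _]eq_bigr => k kj do
  rewrite !termE// !coefE.
rewrite big_split /= -mulr_sumr.
have -> : \sum_(k < r | k != j) 'i%C * (if (k < j)%N then - a else a)%:C *
      (if (k < j)%N then
        ((F t - F (refl (eps k - eps j) t)) / (1 - expi (- 2 * (t 0 k - t 0 j))))
      else ((F t - F (refl (eps j - eps k) t)) / (1 - expi (- 2 * (t 0 j - t 0 k)))))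
    = - ('i%C * a%:C * \sum_(k < r | (k < j)%N)
        ((F t - F (refl (eps k - eps j) t)) / (1 - expi (- 2 * (t 0 k - t 0 j)))))
      + 'i%C * a%:C * \sum_(k < r | (j < k)%N)
        ((F t - F (refl (eps j - eps k) t)) / (1 - expi (- 2 * (t 0 j - t 0 k)))).
  rewrite (bigID (fun k : 'I_r => (k < j)%N)) /= !mulr_sumr -sumrN; congr (_ + _).
    apply: eq_big => [k|k /andP[_ ->]]; last by rewrite rmorphN /=; ring.
    by rewrite -val_eqE /= neq_ltn; case: ltngtP.
  apply: eq_big => [k|k /andP[_ /negbTE->] //].
  by rewrite -val_eqE /= neq_ltn; case: ltngtP.
have -> : pcoef j (inr true) = 2 * b by [].
have -> : pcoef j (inr false) = 2 * iota by [].
have -> : ez (- pvec j (inr true)) t = expi (- 2 * t 0 j).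
  by rewrite /ez /pvec /= dzN dz_delta mulrN mulNr.
have -> : ez (- pvec j (inr false)) t = expi (- 4 * t 0 j).
  by rewrite /ez /pvec /= dzN mulr2n dzD dz_delta; congr expi; ring.
rewrite !refl_eps /= !rmorphM /= (rmorph_nat (real_complex R) 2).
ring.
Qed.

Definition Dmono (j : 'I_r) (mu : 'rV[int]_r) : trig_poly :=
  (2 * 'i%C * (mu 0 j)%:~R - 'i%C * (rho a b iota j)%:C, mu)
  :: flatten [seq tscale ('i%C * (pcoef j i)%:C) (geo mu (pvec j i) (ppair j i mu))
             | i <- enum (rvalid j)].

Definition Dpoly (j : 'I_r) (l : trig_poly) : trig_poly :=
  flatten [seq tscale x.1 (Dmono j x.2) | x <- l].

Lemma ev_Dmono j mu t : ev (Dmono j mu) t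
  = (2 * 'i%C * (mu 0 j)%:~R - 'i%C * (rho a b iota j)%:C) * ez mu t
    + \sum_(i : rindex r | rvalid j i) 'i%C * (pcoef j i)%:C *
        ev (geo mu (pvec j i) (ppair j i mu)) t.
Proof.
rewrite /Dmono ev_cons ev_flatten big_map big_enum /=; congr (_ + _).
by apply: eq_bigr => i _; rewrite ev_scale.
Qed.

Lemma ev_Dpoly j l t : ev (Dpoly j l) t = \sum_(x <- l) x.1 * ev (Dmono j x.2) t.
Proof. by rewrite ev_flatten big_map; apply: eq_bigr => x _; rewrite ev_scale. Qed.

Lemma qroot_eq0 al t : (qroot al t == 0) = (ez al t == 1).
Proof.
rewrite /ez expi_eq1 /qroot -(sqrf_eq0 (sin _)); set x := sin _ ^+ 2.
have -> : cos (2 * dz al t) = (1 - x) *+ 2 - 1 by rewrite mulr_natl cos_mulr2n cos2sin2.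
have -> : 2 - 2 * ((1 - x) *+ 2 - 1) = 4 * x by ring.
by rewrite mulf_eq0 pnatr_eq0.
Qed.

Lemma ezN_eq1 al t : (ez (- al) t == 1) = (ez al t == 1).
Proof. by rewrite ezV -[1 in LHS]invr1 (inj_eq invr_inj). Qed.

Lemma expi_dot_eq1 (al : 'rV[R]_r) mu t : dot al t = dz mu t ->
  (expi (- 2 * dot al t) == 1) = (ez mu t == 1).
Proof. by move=> ->; rewrite -ezN_eq1 /ez dzN mulrN -mulNr. Qed.

Lemma regularP t : regular t <->
  forall j i, rvalid j i -> mult i != 0 -> ez (rvec j i) t != 1.
Proof.
have dotB j k : dot (eps j - eps k) t = dz (de j - de k) t.
  by rewrite dotDl_field dotNl_field !dot_epsl dz_deB.
have dotD j k : dot (eps j + eps k) t = dz (de j + de k) t.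
  by rewrite dotDl_field !dot_epsl dz_deD.
have dot1 j : dot (eps j) t = dz (de j) t by rewrite dot_epsl dz_delta.
have dot2 j : dot (2 *: eps j) t = dz (de j *+ 2) t.
  by rewrite dotZl_field dot_epsl mulr2n dzD !dz_delta; ring.
split=> [h j i|h al].
  case: i => [[k s]|[]] /= kj m0.
  - case: s.
      rewrite -(expi_dot_eq1 (dotD j k)); apply: h.
      move: kj; rewrite -val_eqE /= neq_ltn => /orP[kj|kj].
        by rewrite addrC; left; apply: PosAdd.
      by left; apply: PosAdd.
    rewrite -(expi_dot_eq1 (dotB j k)); apply: h.
    move: kj; rewrite -val_eqE /= neq_ltn => /orP[kj|kj].
      by right; rewrite opprB; apply: PosSub.
    by left; apply: PosSub.
  - rewrite -(expi_dot_eq1 (dot1 j)); apply: h; left; apply: PosShort.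
    by apply: contra m0 => /eqP->; rewrite mulr0.
  - rewrite -(expi_dot_eq1 (dot2 j)); apply: h; left; apply: PosLong.
    by apply: contra m0 => /eqP->; rewrite mulr0.
have pos be : pos_root a b iota be -> expi (- 2 * dot be t) != 1.
  have n2 : 2 != 0 :> R by rewrite pnatr_eq0.
  case=> [j k jk m0|j k jk m0|j m0|j m0].
  - rewrite (expi_dot_eq1 (dotB j k)); apply: (h j (inl (k, false))) => //=.
    by rewrite -val_eqE neq_ltn jk orbT.
  - rewrite (expi_dot_eq1 (dotD j k)); apply: (h j (inl (k, true))) => //=.
    by rewrite -val_eqE neq_ltn jk orbT.
  - by rewrite (expi_dot_eq1 (dot1 j)); apply: (h j (inr true)); rewrite //= mulf_neq0.
  - by rewrite (expi_dot_eq1 (dot2 j)); apply: (h j (inr false)); rewrite //= mulf_neq0.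
case=> [/pos//|/pos]; rewrite dotNl_field mulrN -expi_conj.
by apply: contra => /eqP->; rewrite conjc1.
Qed.

(** All points that are not regular are zeros of the weight. Integrands may therefore be rewritten
    by identities that hold at regular points only, where no quotient takes its default value. *)
Lemma weight_neq0_regular e kappa t : weight a b iota e kappa 0 t != 0 -> regular t.
Proof.
rewrite mulf_eq0 negb_or => /andP[/prodf_neq0 W1 /prodf_neq0 W2].
apply/regularP => j [[k s]|s] /= kj m0.
  have /prodf_neq0/(_ k kj) := W1 j isT.
  have a4 : a / 4 != 0 by rewrite mulf_neq0// invr_eq0 pnatr_eq0.
  rewrite mulf_eq0 negb_or !powR_eq0 a4 !andbT !addr0 !qroot_eq0 => /andP[? ?].
  by case: s.
have := W2 j isT; rewrite !mulf_eq0 !negb_or !powR_eq0 !addr0 !qroot_eq0 -andbA.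
move=> /and3P[]; case: s m0; rewrite mulf_eq0 pnatr_eq0 /= => m0.
  by rewrite m0 andbT.
by rewrite mulf_neq0 ?invr_eq0 ?pnatr_eq0// andbT.
Qed.

Lemma regular_weight_neq0 t : regular t -> weight a b iota 1 0 0 t != 0.
Proof.
move=> /regularP h; rewrite mulf_neq0//; apply/prodf_neq0 => i _.
  apply/prodf_neq0 => k ki; rewrite mulf_neq0// powR_eq0 addr0 qroot_eq0 negb_and;
    have [a0|a0] := eqVneq a 0; rewrite ?a0 ?mul0r ?eqxx ?orbT//; apply/orP; left.
    exact: (h i (inl (k, false))).
  exact: (h i (inl (k, true))).
rewrite powRr0 mulr1 mulf_neq0// powR_eq0 addr0 qroot_eq0 negb_and.
  have [b0|b0] := eqVneq b 0; rewrite ?orbT//; apply/orP; left.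
  by apply: (h i (inr true)); rewrite //= mulf_neq0 ?pnatr_eq0.
have [i0|i0] := eqVneq iota 0; first by rewrite i0 mul0r eqxx orbT.
by apply/orP; left; apply: (h i (inr false)); rewrite //= mulf_neq0 ?pnatr_eq0.
Qed.

Lemma regular_act s c t : regular t -> regular (act s c t).
Proof.
move=> /regular_weight_neq0 h; apply: (@weight_neq0_regular 1 0).
by rewrite weight_act.
Qed.

Lemma regular_rrefl j i t : regular t -> regular (rrefl j i t).
Proof. by have [s [c ->]] := rrefl_actE (R := R) j i; exact: regular_act. Qed.

Lemma near_regular j t : 0 <= a -> 0 <= b -> 0 <= iota -> regular t ->
  \forall h \near (0 : R), regular (h *: eps j + t).
Proof.
move=> a0 b0 i0 /regular_weight_neq0 wt.
have [_ /(_ `|weight a b iota 1 0 0 t|)] :=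
  weight0_ucont (r := r) a0 b0 i0 (lexx (0 : R)) (or_introl (erefl (1 : R))).
rewrite normr_gt0 => /(_ wt)[d d0 hd]; near=> h.
apply: (@weight_neq0_regular 1 0); apply/eqP => w0.
have := hd (h *: eps j + t) t; rewrite w0 sub0r normrN ltxx => /(_ _)/negP; apply => k.
rewrite !mxE eqxx /= addrK normrM.
apply: (@le_lt_trans _ _ `|h|).
  by rewrite ler_piMr//; case: (k == j); rewrite ?normr1 ?normr0.
near: h; apply/nbhs_ballP; exists d => // x; rewrite /ball/= sub0r normrN.
by [].
Unshelve. all: by end_near.
Qed.

(** The regular points form an open set, so the partial derivatives respect this relation, and a
    W-stable one, so the divided differences do too. *)
Definition eq_reg F G : Prop := forall t, regular t -> F t = G t.

Hypotheses (a_ge0 : 0 <= a) (b_ge0 : 0 <= b) (iota_ge0 : 0 <= iota).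

Lemma partialC_eq_reg j F G t : eq_reg F G -> regular t -> partialC j F t = partialC j G t.
Proof.
move=> FG rt; rewrite /partialC !(derive_line _ t).
have nr := near_regular j a_ge0 b_ge0 iota_ge0 rt.
by congr (_ +i* _); apply: near_eq_derive; near=> h; rewrite FG//; near: h.
Unshelve. all: by end_near.
Qed.

Lemma cherednik_eq_reg j F G : eq_reg F G -> eq_reg (cherednik j F) (cherednik j G).
Proof.
move=> FG t rt; rewrite !cherednikE (partialC_eq_reg j FG rt) FG//.
congr (_ + _ - _); apply: eq_bigr => i ij.
by rewrite FG//; exact: regular_rrefl.
Qed.

Lemma cherednik_ev j F l : eq_reg F (ev l) -> eq_reg (cherednik j F) (ev (Dpoly j l)).
Proof.
move=> Fl t rt; rewrite (cherednik_eq_reg j Fl rt) cherednikE ev_Dpoly.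
rewrite (is_partialC_val (is_partialC_ev j l t)).
have termE i : rvalid j i -> 'i%C * (pcoef j i)%:C *
    ((ev l t - ev l (rrefl j i t)) / (1 - ez (- pvec j i) t))
    = \sum_(x <- l) x.1 * ('i%C * (pcoef j i)%:C *
        ev (geo x.2 (pvec j i) (ppair j i x.2)) t).
  (* Regularity does not keep t off the wall of a root of multiplicity 0; there the coefficient
     vanishes instead. *)
  move=> ij; have [m0|m0] := eqVneq (mult i) 0.
    have -> : (pcoef j i)%:C = 0 by rewrite /pcoef m0 oppr0 if_same.
    by rewrite mulr0 mul0r big1// => x _; rewrite mul0r mulr0.
  have v1 : ez (pvec j i) t != 1.
    by rewrite /pvec; case: ifP => _; rewrite ?ezN_eq1; exact: (proj1 (regularP t) rt).
  rewrite /ev -sumrB mulr_suml mulr_sumr; apply: eq_bigr => x _.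
  rewrite -mulrBr ez_rrefl//.
  by rewrite -/(ev (geo x.2 (pvec j i) (ppair j i x.2)) t) -ev_geo//; ring.
rewrite (eq_bigr _ termE) exchange_big /= -[X in X - _]big_split /=.
rewrite {3}/ev mulr_sumr -sumrB; apply: eq_bigr => x _.
by rewrite -/(ev (Dmono j x.2) t) ev_Dmono -mulr_sumr; ring.
Qed.

End TrigPolynomials.

(** * The inner product and skew-adjointness *)

Section ComplexMeans.
Local Open Scope classical_set_scope.
Local Open Scope ring_scope.
Local Open Scope complex_scope.
Context {R : realType} {r : nat}.
Implicit Types (F G : 'rV[R]_r -> R[i]) (t : 'rV[R]_r).

Notation nr := (@near_row R r).

Definition cnice F : Prop :=
  [/\ ucont near_row (fun t => complex.Re (F t)),
      ucont near_row (fun t => complex.Im (F t)) & pi_periodic F].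

Definition cmean_to F (l : R[i]) : Prop :=
  (gmean n.+1 (fun t => complex.Re (F t)) @[n --> \oo] --> complex.Re l) /\
  (gmean n.+1 (fun t => complex.Im (F t)) @[n --> \oo] --> complex.Im l).

Definition cmean F : R[i] :=
  lim (gmean n.+1 (fun t => complex.Re (F t)) @[n --> \oo])
    +i* lim (gmean n.+1 (fun t => complex.Im (F t)) @[n --> \oo]).

Lemma cmean_to_val F l : cmean_to F l -> cmean F = l.
Proof.
move=> [FR FI]; apply/eqP; rewrite /cmean eq_complex /=.
by rewrite (cvg_lim _ FR)// (cvg_lim _ FI)// !eqxx.
Qed.

Lemma cmeanP F : cnice F -> cmean_to F (cmean F).
Proof.
move=> [FR FI Fp]; split; apply/cvg_ex.
  eexists; apply: (@cvg_gmean R r (fun=> 1%N) (fun t => complex.Re (F t))) => //.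
  by move=> t v; rewrite Fp.
eexists; apply: (@cvg_gmean R r (fun=> 1%N) (fun t => complex.Im (F t))) => //.
by move=> t v; rewrite Fp.
Qed.

Lemma cniceD F G : cnice F -> cnice G -> cnice (fun t => F t + G t).
Proof.
move=> [FR FI Fp] [GR GI Gp]; split; last by move=> t v; rewrite Fp Gp.
  apply: ucont_ext (ucontD (@near_rowW R r) FR GR) => t; exact/esym/complex_ReD.
apply: ucont_ext (ucontD (@near_rowW R r) FI GI) => t; exact/esym/complex_ImD.
Qed.

Lemma cniceM F G : cnice F -> cnice G -> cnice (fun t => F t * G t).
Proof.
have M := @ucontM R _ nr (@near_rowW R r); have D := @ucontD R _ nr (@near_rowW R r).
have N := @ucontN R _ nr (@near_rowW R r).
move=> [FR FI Fp] [GR GI Gp]; split; last by move=> t v; rewrite Fp Gp.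
  apply: ucont_ext (D _ _ (M _ _ FR GR) (N _ (M _ _ FI GI))) => t.
  exact/esym/complex_ReM.
apply: ucont_ext (D _ _ (M _ _ FR GI) (M _ _ FI GR)) => t; exact/esym/complex_ImM.
Qed.

Lemma cnice_conj F : cnice F -> cnice (fun t => (F t)^*).
Proof.
move=> [FR FI Fp]; split; last by move=> t v; rewrite Fp.
  by apply: ucont_ext FR => t; case: (F t).
by apply: ucont_ext (ucontN (@near_rowW R r) FI) => t; case: (F t).
Qed.

Lemma cnice_cst c : cnice (fun=> c).
Proof. by split => //; exact: ucont_cst. Qed.

Lemma cnice_real (f : 'rV[R]_r -> R) : ucont near_row f -> pi_periodic f ->
  cnice (fun t => (f t)%:C).
Proof. by move=> fu fp; split => //; [exact: ucont_cst|move=> t v; rewrite fp]. Qed.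

Lemma cnice_ez mu : cnice (ez mu).
Proof. by split; [exact: ucont_cos|exact: ucont_sin|exact: ez_periodic]. Qed.

Lemma cnice_ev l : cnice (ev l).
Proof.
elim: l => [|x l IH].
  by rewrite (_ : ev [::] = fun=> 0); [exact: cnice_cst|apply/funext => t; rewrite ev_nil].
rewrite (_ : ev (x :: l) = fun t => x.1 * ez x.2 t + ev l t).
  by apply: cniceD IH; apply: cniceM; [exact: cnice_cst|exact: cnice_ez].
by apply/funext => t; rewrite ev_cons.
Qed.

Lemma cmean_toD F G l l' : cmean_to F l -> cmean_to G l' ->
  cmean_to (fun t => F t + G t) (l + l').
Proof.
move=> [FR FI] [GR GI]; split.
  rewrite complex_ReD.
  under eq_fun do under gmean_ext do rewrite complex_ReD.
  by under eq_fun do rewrite gmeanD; exact: cvgD.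
rewrite complex_ImD.
under eq_fun do under gmean_ext do rewrite complex_ImD.
by under eq_fun do rewrite gmeanD; exact: cvgD.
Qed.

Lemma cmean_toZ c F l : cmean_to F l -> cmean_to (fun t => c * F t) (c * l).
Proof.
move=> [FR FI]; split.
  rewrite complex_ReM; under eq_fun do under gmean_ext do rewrite complex_ReM.
  under eq_fun do rewrite gmeanB !gmeanZ.
  by apply: cvgB; apply: cvgMr => //; exact: cvg_cst.
rewrite complex_ImM; under eq_fun do under gmean_ext do rewrite complex_ImM.
under eq_fun do rewrite gmeanD !gmeanZ.
by apply: cvgD; apply: cvgMr => //; exact: cvg_cst.
Qed.

Lemma cmeanD F G : cnice F -> cnice G ->
  cmean (fun t => F t + G t) = cmean F + cmean G.
Proof.
by move=> /cmeanP hF /cmeanP hG; apply: cmean_to_val; exact: cmean_toD.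
Qed.

Lemma cmeanZ c F : cnice F -> cmean (fun t => c * F t) = c * cmean F.
Proof. by move=> /cmeanP hF; apply: cmean_to_val; exact: cmean_toZ. Qed.

Lemma cmean_ext F G : F =1 G -> cmean F = cmean G.
Proof. by move=> /funext->. Qed.

Lemma complex_Re_sum (I : Type) (s : seq I) (P : pred I) (f : I -> R[i]) :
  complex.Re (\sum_(i <- s | P i) f i) = \sum_(i <- s | P i) complex.Re (f i).
Proof. exact: (big_morph _ complex_ReD). Qed.

Lemma complex_Im_sum (I : Type) (s : seq I) (P : pred I) (f : I -> R[i]) :
  complex.Im (\sum_(i <- s | P i) f i) = \sum_(i <- s | P i) complex.Im (f i).
Proof. exact: (big_morph _ complex_ImD). Qed.

Lemma complex_ReZ (x : R) (y : R[i]) : complex.Re (x%:C * y) = x * complex.Re y.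
Proof. by case: y => y1 y2 /=; rewrite mul0r subr0. Qed.

Lemma complex_ImZ (x : R) (y : R[i]) : complex.Im (x%:C * y) = x * complex.Im y.
Proof. by case: y => y1 y2 /=; rewrite mul0r addr0. Qed.

Lemma real_complexV (x : R) : (x%:C)^-1 = (x^-1)%:C.
Proof. by rewrite fmorphV. Qed.

Lemma gmean_Re n F : gmean n (fun t => complex.Re (F t)) = complex.Re (gmean n F).
Proof.
rewrite /gmean -(rmorph_nat (real_complex R)) real_complexV complex_ReZ.
by rewrite complex_Re_sum.
Qed.

Lemma gmean_Im n F : gmean n (fun t => complex.Im (F t)) = complex.Im (gmean n F).
Proof.
rewrite /gmean -(rmorph_nat (real_complex R)) real_complexV complex_ImZ.
by rewrite complex_Im_sum.
Qed.

Lemma cmean_to_eq_gmean F G l : (forall n, gmean n.+1 F = gmean n.+1 G) ->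
  cmean_to F l -> cmean_to G l.
Proof.
move=> FG [FR FI]; split.
  by move: FR; under eq_fun do rewrite gmean_Re FG -gmean_Re.
by move: FI; under eq_fun do rewrite gmean_Im FG -gmean_Im.
Qed.

(** Positivity at one point has to survive the limit. The translates of f by the points of a fixed
    coarse grid add up to at least [f t0 / 2] everywhere, since some translate, modulo periods,
    falls close to t0; on a finer grid that contains the coarse one all these translates have the
    same mean. *)
Lemma gmean_lim_gt0 (f : 'rV[R]_r -> R) t0 (l : R) : ucont near_row f -> pi_periodic f ->
  (forall t, 0 <= f t) -> 0 < f t0 -> gmean n.+1 f @[n --> \oo] --> l -> 0 < l.
Proof.
move=> [_ fu] fp f0 ft0 fl.
have c0 : 0 < f t0 / 2 by rewrite divr_gt0.
have [d d0 hd] := fu _ c0.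
have [N0 hN] := grid_step d0; set N := N0.+1; have {hN} hN := hN N0 (leqnn _).
rewrite -/N in hN.
have N_gt0 : 0 < (N ^ r)%:R :> R by rewrite ltr0n expn_gt0.
have NR : 0 < N%:R :> R by rewrite ltr0n.
have cover t : f t0 / 2 <= \sum_(s : 'rV['I_N]_r) f (gridpt s + t).
  pose q j := Num.floor ((t0 0 j - t 0 j) * N%:R / pi).
  pose s : 'rV['I_N]_r := \row_j inZp (`|(q j %% N)%Z|)%N.
  pose v j := (q j %/ N)%Z.
  apply: (@le_trans _ _ (f (gridpt s + t))); last first.
    by rewrite (bigD1 s) //= lerDl sumr_ge0.
  rewrite -(fp (gridpt s + t) v).
  have : near_row d (gridpt s + t + \row_j (pi * (v j)%:~R)) t0.
    move=> j; rewrite !mxE.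
    have qE : (pi * (inZp `|(q j %% N)%Z|%N : 'I_N)%:R / N%:R + t 0 j + pi * (v j)%:~R : R)
       = pi * (q j)%:~R / N%:R + t 0 j.
      rewrite /= modn_small; last first.
        by rewrite -ltz_nat gez0_abs ?modz_ge0// ltz_pmod.
      have -> : (`|(q j %% N)%Z|%N)%:R = ((q j %% N)%Z)%:~R :> R.
        by rewrite pmulrn gez0_abs ?modz_ge0.
      have -> : (q j)%:~R = (v j)%:~R * N%:R + ((q j %% N)%Z)%:~R :> R.
        by rewrite {1}(divz_eq (q j) N) rmorphD rmorphM.
      by field; rewrite gt_eqF.
    rewrite qE; have := floor_itv ((t0 0 j - t 0 j) * N%:R / pi).
    rewrite -/(q j) intrD1 => /andP[h1 h2].
    have p0 := pi_gt0 R.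
    have k1 : pi * (q j)%:~R / N%:R <= t0 0 j - t 0 j.
      by rewrite ler_pdivrMr// mulrC -ler_pdivlMr.
    have k2 : t0 0 j - t 0 j < pi * (q j)%:~R / N%:R + pi / N%:R.
      by rewrite -mulrDl ltr_pdivlMr// -{2}[pi]mulr1 -mulrDr -ltr_pdivrMl// mulrC.
    rewrite ltr_norml; apply/andP; split; lra.
  by move=> /hd; rewrite ltr_norml => /andP[h1 h2]; lra.
suff : f t0 / 2 / (N ^ r)%:R <= l by apply: lt_le_trans; rewrite !divr_gt0.
apply/ler_addgt0Pr => e e0.
move/cvgrPdist_lt: fl => /(_ _ e0)[M _ hM].
(* The number of points per side, [m.+1], is a multiple of N, so that the coarse grid is contained
   in this one. *)
pose m := (N * M.+1)%N.-1; have mE : m.+1 = (N * M.+1)%N by rewrite prednK// muln_gt0.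
have /hM : (M <= m)%N by rewrite -ltnS mE; apply: leq_trans (leq_pmull _ _).
rewrite ltr_norml => /andP[h1 h2].
have hs (s : 'rV['I_N]_r) : gmean m.+1 (fun t => f (gridpt s + t)) = gmean m.+1 f.
  rewrite -(gmean_translate m (fun j => (s ord0 j * M.+1)%N) fp).
  apply: gmean_ext => t; congr (f (_ + _)); apply/rowP => j; rewrite !mxE mE !natrM.
  by field; rewrite gt_eqF// pnatr_eq0.
have : f t0 / 2 <= (N ^ r)%:R * gmean m.+1 f.
  rewrite -[leLHS](@gmean_cst R r R m.+1)//.
  apply: le_trans (le_gmean _ cover) _; rewrite gmean_sum.
  rewrite (eq_bigr _ (fun s _ => hs s)) sumr_const card_mx card_ord mul1n.
  by rewrite mulr_natl.
rewrite -ler_pdivrMl// mulrC; lra.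
Qed.

Definition tmul (l l' : @trig_poly R r) : trig_poly :=
  flatten [seq [seq (x.1 * y.1, x.2 + y.2) | y <- l'] | x <- l].

Definition tconj (l : @trig_poly R r) : trig_poly := [seq ((x.1)^*, - x.2) | x <- l].

Lemma ev_tmul l l' t : ev (tmul l l') t = ev l t * ev l' t.
Proof.
rewrite ev_flatten big_map /ev mulr_suml; apply: eq_bigr => x _.
by rewrite big_map mulr_sumr; apply: eq_bigr => y _ /=; rewrite ezD; ring.
Qed.

Lemma ev_tconj l t : ev (tconj l) t = (ev l t)^*.
Proof.
rewrite /ev big_map rmorph_sum; apply: eq_bigr => x _ /=.
by rewrite rmorphM ezN.
Qed.

End ComplexMeans.

(** * Skew-adjointness up to a multiple of the tangent *)

Section SkewAdjoint.
Local Open Scope classical_set_scope.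
Local Open Scope ring_scope.
Local Open Scope complex_scope.
Context {R : realType} {r : nat}.
Variables a b iota e kappa : R.
Hypotheses (a_ge0 : 0 <= a) (b_ge0 : 0 <= b) (iota_ge0 : 0 <= iota).
Hypotheses (kappa_ge0 : 0 <= kappa) (e1 : e = 1 \/ e = -1).
Implicit Types (F G : 'rV[R]_r -> R[i]) (t : 'rV[R]_r) (l : @trig_poly R r).

Notation de i := (delta_mx 0 i : 'rV[int]_r).
Notation W := (@weight R r a b iota e kappa 0).
Notation regular := (@regular R r a b iota).
Notation eq_reg := (@eq_reg R r a b iota).
Notation cherednik := (@cherednik R r a b iota).
Notation mult := (@rmult R r a b iota).
Notation Dpoly := (@Dpoly R r a b iota).

Lemma weight_regular t : W t != 0 -> regular t.
Proof. exact: weight_neq0_regular. Qed.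

Lemma cnice_weight : cnice (fun t => (W t)%:C).
Proof.
by apply: cnice_real; [exact: weight0_ucont|exact: weight_periodic].
Qed.

Definition pairing F G : R[i] := cmean (fun t => F t * (G t)^* * (W t)%:C).

Lemma pairing_eq_reg F F' G G' : eq_reg F F' -> eq_reg G G' ->
  pairing F G = pairing F' G'.
Proof.
move=> FF GG; apply: cmean_ext => t.
have [->|/weight_regular rt] := eqVneq (W t) 0; first by rewrite !mulr0.
by rewrite FF// GG.
Qed.

Lemma cnice_pairing l l' : cnice (fun t => ev l t * (ev l' t)^* * (W t)%:C).
Proof.
apply: cniceM cnice_weight; apply: cniceM (cnice_ev _) _.
exact/cnice_conj/cnice_ev.
Qed.

Lemma sin_ez al t : (sin (2 * dz al t))%:C = - 'i%C / 2 * (ez al t - (ez al t)^-1).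
Proof.
rewrite -ezV ezN /ez /expi.
apply: (@mulIf _ 2); first by rewrite pnatr_eq0.
rewrite mulrAC divfK ?pnatr_eq0//; apply/eqP.
by rewrite eq_complex /=; apply/andP; split; apply/eqP; ring.
Qed.

Lemma cos_ez al t : (cos (2 * dz al t))%:C = (ez al t + (ez al t)^-1) / 2.
Proof.
rewrite -ezV ezN /ez /expi.
apply: (@mulIf _ 2); first by rewrite pnatr_eq0.
rewrite divfK ?pnatr_eq0//; apply/eqP.
by rewrite eq_complex /=; apply/andP; split; apply/eqP; ring.
Qed.

Lemma qroot_ez al t : (qroot al t)%:C = 2 - (ez al t + (ez al t)^-1).
Proof.
rewrite /qroot rmorphB rmorphM /= (rmorph_nat (real_complex R) 2) cos_ez.
by move: (ez al t + _) => y; field.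
Qed.

Lemma mulii : 'i%C * 'i%C = -1 :> R[i].
Proof. by apply/eqP; rewrite eq_complex /=; apply/andP; split; apply/eqP; ring. Qed.

(** With x = [dz (rvec j i) t] this is (1/2) cot x. *)
Definition rcot (j : 'I_r) (i : rindex r) t : R :=
  sin (2 * dz (rvec j i) t) / qroot (rvec j i) t.

(** The identity 1 / (1 - exp(- 2 i x)) = 1/2 - (i/2) cot x, where the sign accounts for the roots
    that enter as [- rvec j i]. *)
Lemma inv_one_sub_ez j i t : ez (rvec j i) t != 1 ->
  (1 - ez (- pvec j i) t)^-1
    = 2^-1 - 'i%C * ((-1) ^+ pneg j i)%:C * (rcot j i t)%:C.
Proof.
move=> v1; set w := ez (rvec j i) t in v1.
have w0 : w != 0 by exact: ez_neq0.
have q0 : 2 - (w + w^-1) != 0.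
  by rewrite -qroot_ez fmorph_eq0 qroot_eq0.
have q0' : (1 - w) != 0 by rewrite subr_eq0 eq_sym.
have q0'' : 1 - w^-1 != 0 by rewrite subr_eq0 -[X in X == _]invr1 (inj_eq invr_inj) eq_sym.
rewrite /rcot rmorphM /= -real_complexV sin_ez qroot_ez -/w.
have -> : 'i%C * ((-1) ^+ pneg j i)%:C * (- 'i%C / 2 * (w - w^-1) / (2 - (w + w^-1)))
    = - ('i%C * 'i%C) * ((-1) ^+ pneg j i)%:C * (w - w^-1) / 2 / (2 - (w + w^-1)) by ring.
rewrite mulii opprK mul1r.
have E : 2 - (w + w^-1) = - (1 - w) ^+ 2 / w by field.
rewrite E /pvec; case: (pneg j i) => /=.
  by rewrite opprK -/w expr1 rmorphN rmorph1; field; rewrite w0 q0'.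
rewrite ezV -/w expr0 rmorph1; field.
by rewrite w0 q0' /= subr_eq0.
Qed.

Lemma rcot_rrefl j i t : rvalid j i -> rcot j i (rrefl j i t) = - rcot j i t.
Proof.
by move=> ij; rewrite /rcot qroot_rvec_rrefl// dz_rvec_rrefl// mulrN sinN mulNr.
Qed.

Lemma rrefl_rrefl j i t : rvalid j i -> rrefl j i (rrefl j i t) = t.
Proof.
case: i => [[k s]|s] /= kj; apply/rowP => l; rewrite !mxE; last first.
  by rewrite !perm1 /=; case: (l == j); rewrite /=; ring.
rewrite tpermK; case: tpermP => [->|->|/eqP/negbTE-> /eqP/negbTE->];
  rewrite ?eqxx ?(negbTE kj) ?[j == k]eq_sym ?(negbTE kj) /= ?andbT ?andbF /=;
  by case: s => /=; ring.
Qed.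

Lemma periodic_rrefl (T : Type) (F : 'rV[R]_r -> T) j i : pi_periodic F ->
  pi_periodic (fun t => F (rrefl j i t)).
Proof.
have [s [c rE]] := rrefl_actE (R := R) j i => Fp t v; rewrite !rE.
have -> : act s c (t + \row_k (pi * (v k)%:~R))
    = act s c t + \row_k (pi * ((-1) ^+ c k * v (s k))%:~R).
  by apply/rowP => k; rewrite !mxE mulrDr intrM rmorphXn /=; ring.
exact: Fp.
Qed.

Lemma gmean_rrefl_odd (K : numFieldType) (F : 'rV[R]_r -> K) j i n :
  pi_periodic F -> (forall t, F (rrefl j i t) = - F t) -> gmean n.+1 F = 0.
Proof.
move=> Fp Fo; have [s [c rE]] := rrefl_actE (R := R) j i.
have : gmean n.+1 F = - gmean n.+1 F.
  rewrite -[LHS](gmean_act s c Fp)// -gmeanN; apply: gmean_ext => t.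
  by rewrite -rE Fo.
by move/eqP; rewrite -subr_eq0 opprK -mulr2n mulrn_eq0 => /eqP.
Qed.

Lemma ev_bounded l : exists2 M, 0 <= M &
  forall t, `|complex.Re (ev l t)| <= M /\ `|complex.Im (ev l t)| <= M.
Proof.
have [[[M1 h1] _] [[M2 h2] _] _] := cnice_ev l.
exists (`|M1| + `|M2|) => [|t]; first by rewrite addr_ge0.
have tt : near_row 1 t t by move=> i; rewrite subrr normr0.
have [k1 _] := h1 _ t t tt; have [k2 _] := h2 _ t t tt.
split; [apply: le_trans k1 _|apply: le_trans k2 _].
  by apply: le_trans (ler_norm _) _; rewrite lerDl.
by apply: le_trans (ler_norm _) _; rewrite lerDr.
Qed.

(* The difference with the reflected function is divisible by [1 - ez], so that
   its product with the sine is bounded by [qroot]. *)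
Lemma rrefl_diff_bound j l : exists L, forall i, rvalid j i -> forall t,
  `|complex.Re (ev l t - ev l (rrefl j i t)) * sin (2 * dz (rvec j i) t)|
    <= L * qroot (rvec j i) t /\
  `|complex.Im (ev l t - ev l (rrefl j i t)) * sin (2 * dz (rvec j i) t)|
    <= L * qroot (rvec j i) t.
Proof.
pose q i : @trig_poly R r :=
  flatten [seq tscale x.1 (geo x.2 (pvec j i) (ppair j i x.2)) | x <- l].
have qE i t : rvalid j i ->
    ev l t - ev l (rrefl j i t) = (1 - ez (- pvec j i) t) * ev (q i) t.
  move=> ij; have [v1|v1] := eqVneq (ez (pvec j i) t) 1.
    rewrite ezV v1 invr1 subrr mul0r /ev -sumrB big1// => x _.
    rewrite ez_rrefl// -mulrBr ezD -mulrNz; set n := ppair _ _ _.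
    have -> : ez (pvec j i *~ - n) t = 1; last by rewrite mulr1 subrr mulr0.
    have hn m : ez (pvec j i *+ m) t = 1 by rewrite ezMn v1 expr1n.
    case: (- n) => m; first exact: hn.
    by rewrite NegzE mulrNz ezV hn invr1.
  have v0 : 1 - ez (- pvec j i) t != 0 by rewrite subr_eq0 eq_sym ezN_eq1.
  rewrite /q ev_flatten big_map mulr_sumr /ev -sumrB; apply: eq_bigr => x _.
  rewrite -/(ev _ _) ev_scale -ev_geo// -mulrBr ez_rrefl//.
  by field.
have /choice[B BP] : forall i, exists M, 0 <= M /\ forall t,
    `|complex.Re (ev (q i) t)| <= M /\ `|complex.Im (ev (q i) t)| <= M.
  by move=> i; have [M M0 hM] := ev_bounded (q i); exists M.
exists (\sum_i 2 * B i) => i ij t.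
have B_le : 2 * B i <= \sum_i 2 * B i.
  rewrite (bigD1 i) //= lerDl sumr_ge0// => k _.
  by rewrite mulr_ge0//; have [] := BP k.
have [B0 /(_ t)[BR BI]] := BP i.
rewrite qE//.
have -> : ez (- pvec j i) t = cos (2 * dz (pvec j i) t) -i* sin (2 * dz (pvec j i) t).
  by rewrite ezN.
have cE : cos (2 * dz (pvec j i) t) = cos (2 * dz (rvec j i) t).
  by rewrite /pvec; case: ifP => _ //; rewrite dzN mulrN cosN.
have sE : `|sin (2 * dz (pvec j i) t)| = `|sin (2 * dz (rvec j i) t)|.
  by rewrite /pvec; case: ifP => _ //; rewrite dzN mulrN sinN normrN.
rewrite cE complex_ReM complex_ImM /= opprK.
set c := cos (2 * dz (rvec j i) t); set s := sin (2 * dz (rvec j i) t) in sE *.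
rewrite !add0r; set s' := sin (2 * dz (pvec j i) t) in sE *.
set x := complex.Re _ in BR *; set y := complex.Im _ in BI *.
have -> : qroot (rvec j i) t = 2 - 2 * c by [].
have cs : c ^+ 2 + s ^+ 2 = 1 by exact: cos2Dsin2.
have c1 : c <= 1 by exact: cos_le1.
have c_1 : -1 <= c by exact: cos_geN1.
have key (u v : R) : `|u| <= B i -> `|v| <= B i ->
    `|((1 - c) * u - s' * v) * s| <= (\sum_i 2 * B i) * (2 - 2 * c).
  move=> hu hv; apply: (@le_trans _ _ (2 * B i * (2 - 2 * c))); last first.
    by rewrite ler_wpM2r//; lra.
  have s_le1 : `|s| <= 1 by rewrite ler_norml sin_geN1 sin_le1.
  have ss : `|s'| * `|s| <= 2 * (1 - c).
    rewrite sE -normrM -expr2 ger0_norm ?sqr_ge0//; nra.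
  rewrite normrM; apply: (@le_trans _ _ (((1 - c) * `|u| + `|s'| * `|v|) * `|s|)).
    rewrite ler_wpM2r// (le_trans (ler_normB _ _))// !normrM ger0_norm//; lra.
  have hu0 := normr_ge0 u; have hv0 := normr_ge0 v; have hs0 := normr_ge0 s.
  have k1 : (1 - c) * `|u| * `|s| <= (1 - c) * B i.
    rewrite -mulrA; apply: ler_wpM2l; first lra.
    by rewrite -[leRHS]mulr1; apply: ler_pM.
  have k2 : `|s'| * `|v| * `|s| <= 2 * (1 - c) * B i.
    by rewrite mulrAC; apply: ler_pM => //; rewrite mulr_ge0.
  have k3 : 0 <= (1 - c) * B i by rewrite mulr_ge0//; lra.
  by rewrite mulrDl; lra.
split; first exact: key.
have -> : ((1 - c) * y + s' * x) * s = ((1 - c) * y - s' * (- x)) * s by ring.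
by apply: key => //; rewrite normrN.
Qed.

Definition tderive (j : 'I_r) l : @trig_poly R r :=
  [seq (x.1 * (2 * 'i%C * ((x.2 : 'rV[int]_r) 0 j)%:~R), x.2) | x <- l].

Lemma is_partialC_tderive j l t : is_partialC j (ev l) t (ev (tderive j l) t).
Proof.
have -> : ev (tderive j l) t = \sum_(x <- l) x.1 * (2 * 'i%C * (x.2 0 j)%:~R * ez x.2 t).
  by rewrite /ev big_map; apply: eq_bigr => x _; rewrite /= !mulrA.
exact: is_partialC_ev.
Qed.

Lemma is_partialC_conj j F t d : is_partialC j F t d ->
  is_partialC j (fun u => (F u)^*) t d^*.
Proof.
move=> [FR FI]; split.
  have -> : (fun u => complex.Re (F u)^*) = (fun u => complex.Re (F u)).
    by apply/funext => u; case: (F u).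
  by case: d FR {FI}.
have -> : (fun u => complex.Im (F u)^*) = - (fun u => complex.Im (F u)).
  by apply/funext => u; rewrite fctE; case: (F u).
have -> : complex.Im d^* = - complex.Im d by case: d {FR FI}.
exact: is_deriveN.
Qed.

Lemma conjc_i : ('i%C)^* = - 'i%C :> R[i].
Proof. by apply/eqP; rewrite eq_complex /= oppr0 !eqxx. Qed.

Lemma complex_ReN (x : R[i]) : complex.Re (- x) = - complex.Re x.
Proof. by case: x. Qed.

Lemma complex_ImN (x : R[i]) : complex.Im (- x) = - complex.Im x.
Proof. by case: x. Qed.

Lemma conjcM (x y : R[i]) : (x * y)^* = x^* * y^*.
Proof. exact: rmorphM. Qed.

Lemma conjcN (x : R[i]) : (- x)^* = - x^*.
Proof. exact: rmorphN. Qed.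

Lemma conjcD (x y : R[i]) : (x + y)^* = x^* + y^*.
Proof. exact: rmorphD. Qed.

Lemma conjc_half : (2^-1)^* = 2^-1 :> R[i].
Proof. by rewrite conjc_inv conjc_nat. Qed.

(** The list [l''] stands for l' times sin (2 t_j) / qcos, that is 2 tan t_j for e = 1 and 2 cot t_j
    for e = -1. Asking that this product be a trigonometric polynomial keeps the boundary term
    bounded. The claim follows from integration by parts for the function ev l times the conjugate
    of ev l'. *)
Lemma cmean_to_skew j l l' l'' :
  (kappa != 0 -> forall t, (sin (2 * dz (de j) t))%:C * ev l' t
    = (qcos e j t)%:C * ev l'' t) ->
  cmean_to (fun t => (cherednik j (ev l) t * (ev l' t)^*
    + ev l t * (cherednik j (ev l') t - (kappa * e)%:C * ev l'' t)^*) * (W t)%:C) 0.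
Proof.
move=> tanl; set f := ev l; set g := ev l'; set g' := ev l''.
set L := tmul l (tconj l').
have LE t : ev L t = f t * (g t)^* by rewrite ev_tmul ev_tconj.
have [M hM] := rrefl_diff_bound j L.
have [B B0 hB] := ev_bounded (tmul l (tconj l'')).
have [LR LI Lp] := cnice_ev L; have [dR dI _] := cnice_ev (tderive j L).
have kap t : kappa != 0 -> (sin (2 * dz (de j) t))%:C * ev L t
    = (qcos e j t)%:C * ev (tmul l (tconj l'')) t.
  move=> k0; have : ((sin (2 * dz (de j) t))%:C * ev l' t)^*
      = ((qcos e j t)%:C * ev l'' t)^* by rewrite tanl.
  rewrite !conjcM.
  rewrite !conjc_real => h.
  by rewrite LE ev_tmul ev_tconj mulrCA h mulrCA.
have qc0 t : 0 <= qcos e j t by case/andP: (qcos_itv j t e1).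
have e_norm : `|e| = 1 by case: e1 => ->; rewrite ?normrN normr1.
have bound (P : R[i] -> R) (PZ : forall x y, P (x%:C * y) = x * P y)
    (PM : forall t, `|P (ev (tmul l (tconj l'')) t)| <= B) :
  kappa != 0 -> forall t, `|- e * sin (2 * dz (de j) t) * P (ev L t)| <= B * qcos e j t.
  move=> k0 t; rewrite -mulrA normrM normrN e_norm mul1r -PZ kap// PZ normrM.
  by rewrite (ger0_norm (qc0 t)) mulrC ler_wpM2r.
have weaken C1 C2 (x q : R) : 0 <= q -> C1 <= C2 -> `|x| <= C1 * q -> `|x| <= C2 * q.
  by move=> q0 C12 h; apply: le_trans h _; exact: ler_wpM2r.
have q_ge0 i t : 0 <= qroot (rvec j i) t by case/andP: (qroot_itv (rvec j i) t).
pose S t : R[i] := (ev (tderive j L) t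
  + \sum_(i : rindex r | rvalid j i) (mult i)%:C *
      ((rcot j i t)%:C * (ev L t - ev L (rrefl j i t)))
  + (kappa * (- e * sin (2 * dz (de j) t) / qcos e j t))%:C * ev L t) * (W t)%:C.
have S0 : cmean_to S 0.
  pose K' := Num.max M B.
  have MK : M <= K' by rewrite le_max lexx.
  have BK : B <= K' by rewrite le_max lexx orbT.
  split.
    have h i : rvalid j i -> forall t, `|(complex.Re (ev L t) - complex.Re (ev L (rrefl j i t)))
        * sin (2 * dz (rvec j i) t)| <= K' * qroot (rvec j i) t.
      move=> ij t; apply: weaken (q_ge0 i t) MK _.
      by have [h1 h2] := hM i ij t; rewrite -complex_ReN -complex_ReD.
    have hk k0 t := weaken _ _ _ _ (qc0 t) BK
      (bound _ complex_ReZ (fun t => proj1 (hB t)) k0 t).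
    have := @stokes_symmetrised R r a b iota e kappa a_ge0 b_ge0 iota_ge0 kappa_ge0 e1 j
      (fun t => complex.Re (ev L t)) (fun t => complex.Re (ev (tderive j L) t)) K'
      (fun t v => congr1 _ (Lp t v)) LR dR
      (fun t => proj1 (is_partialC_tderive j L t)) h hk.
    apply: cvg_trans; apply: near_eq_cvg; apply: nearW => n.
    apply: gmean_ext => t; apply/esym; rewrite /S mulrC complex_ReZ mulrC !complex_ReD.
    rewrite complex_ReZ; congr ((_ + _ + _) * _); last by rewrite /=; ring.
    rewrite complex_Re_sum; apply: eq_bigr => i _.
    rewrite !complex_ReZ complex_ReD complex_ReN /rcot.
    by ring.
  have h i : rvalid j i -> forall t, `|(complex.Im (ev L t) - complex.Im (ev L (rrefl j i t)))
      * sin (2 * dz (rvec j i) t)| <= K' * qroot (rvec j i) t.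
    move=> ij t; apply: weaken (q_ge0 i t) MK _.
    by have [h1 h2] := hM i ij t; rewrite -complex_ImN -complex_ImD.
  have hk k0 t := weaken _ _ _ _ (qc0 t) BK
    (bound _ complex_ImZ (fun t => proj2 (hB t)) k0 t).
  have := @stokes_symmetrised R r a b iota e kappa a_ge0 b_ge0 iota_ge0 kappa_ge0 e1 j
    (fun t => complex.Im (ev L t)) (fun t => complex.Im (ev (tderive j L) t)) K'
    (fun t v => congr1 _ (Lp t v)) LI dI
    (fun t => proj2 (is_partialC_tderive j L t)) h hk.
  apply: cvg_trans; apply: near_eq_cvg; apply: nearW => n.
  apply: gmean_ext => t; apply/esym; rewrite /S mulrC complex_ImZ mulrC !complex_ImD.
  rewrite complex_ImZ; congr ((_ + _ + _) * _); last by rewrite /=; ring.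
  rewrite complex_Im_sum; apply: eq_bigr => i _.
  rewrite !complex_ImZ complex_ImD complex_ImN /rcot.
  by ring.
apply: cmean_to_eq_gmean S0 => n; apply/esym/eqP; rewrite -subr_eq0 -gmeanB; apply/eqP.
(* For each root the two integrands differ by [E], which is odd under the reflection of that root:
   its first part is antisymmetric, and in the second the cotangent is odd and the rest even. *)
pose E i t : R[i] := ('i%C * (pcoef a b iota j i)%:C / 2
    * (f t * (g (rrefl j i t))^* - f (rrefl j i t) * (g t)^*)
  + (mult i)%:C * (rcot j i t)%:C * ((f t - f (rrefl j i t)) * (g t - g (rrefl j i t))^*))
  * (W t)%:C.
transitivity (gmean n.+1 (fun t => \sum_(i : rindex r | rvalid j i) E i t)); last first.
  rewrite gmean_sum big1// => i ij; apply: (@gmean_rrefl_odd _ _ j i).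
    have [_ _] := cnice_ev l; have [_ _] := cnice_ev l'; rewrite -/f -/g => gp fp t v.
    have fr := periodic_rrefl j i fp t v; have gr := periodic_rrefl j i gp t v.
    rewrite /E fr gr fp gp.
    by rewrite weight_periodic /rcot /qroot (sin_periodic (rvec j i)) (cos_periodic (rvec j i)).
  move=> t; rewrite /E weight_rrefl rrefl_rrefl// rcot_rrefl// !(conjcD, conjcN) rmorphN /=; ring.
apply: gmean_ext => t; rewrite /S.
have [W0|W0] := eqVneq (W t) 0.
  by rewrite W0 !mulr0 subrr big1// => i _; rewrite /E W0 mulr0.
have rt := weight_regular W0.
rewrite -mulr_suml -mulrBl; congr (_ * _).
have dL : ev (tderive j L) t = partialC j f t * (g t)^* + f t * (partialC j g t)^*.
  rewrite -(is_partialC_val (is_partialC_tderive j L t)).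
  have -> : ev L = fun u => f u * (g u)^* by apply/funext => u; rewrite LE.
  apply: is_partialC_val; apply: is_partialCM.
    by rewrite (is_partialC_val (is_partialC_ev j l t)); exact: is_partialC_ev.
  apply: is_partialC_conj.
  by rewrite (is_partialC_val (is_partialC_ev j l' t)); exact: is_partialC_ev.
have kE : (kappa * (- e * sin (2 * dz (de j) t) / qcos e j t))%:C * ev L t
    = - (f t * ((kappa * e)%:C * g' t)^*).
  have [k0|k0] := eqVneq kappa 0; first by rewrite conjcM conjc_real k0 !mul0r mulr0 oppr0.
  have qc : qcos e j t != 0.
    move: W0; rewrite mulf_eq0 negb_or => /andP[_ /prodf_neq0/(_ j isT)].
    by rewrite mulf_eq0 negb_or => /andP[_]; rewrite addr0 powR_eq0 k0 andbT.
  have -> : (kappa * (- e * sin (2 * dz 'e_j t) / qcos e j t))%:C * ev L t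
      = - (kappa * e)%:C * ((qcos e j t)%:C)^-1 * ((sin (2 * dz 'e_j t))%:C * ev L t).
    rewrite real_complexV !mulrA; congr (_ * _).
    by rewrite -rmorphN -!rmorphM /=; congr (_%:C); ring.
  rewrite kap// ev_tmul ev_tconj conjcM conjc_real [LHS]mulrA divfK ?fmorph_eq0//.
  by rewrite mulNr mulrCA.
rewrite kE dL !cherednikE !(conjcD, conjcN, conjcM) conjc_i !conjc_real.
set X := \sum_(_ | _) _; set Y := \sum_(_ | _) _; set Z := \sum_(_ | _) _.
suff -> : \sum_(i | rvalid j i) ('i%C * (pcoef a b iota j i)%:C / 2
    * (f t * (g (rrefl j i t))^* - f (rrefl j i t) * (g t)^*)
  + (mult i)%:C * (rcot j i t)%:C * ((f t - f (rrefl j i t)) * (g t - g (rrefl j i t))^*))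
  = X * (g t)^* + f t * Y^* - Z.
  ring.
have -> : Y^* = \sum_(i | rvalid j i) ('i%C * (pcoef a b iota j i)%:C
    * ((g t - g (rrefl j i t)) / (1 - ez (- pvec j i) t)))^*.
  by rewrite /Y rmorph_sum.
rewrite mulr_suml mulr_sumr -big_split -sumrB; apply: eq_bigr => i ij.
rewrite /= !LE.
have [m0|m0] := eqVneq (mult i) 0.
  have -> : pcoef a b iota j i = 0 by rewrite /pcoef m0 oppr0 if_same.
  by rewrite m0 rmorph0 !(mulr0, mul0r) rmorph0 !(mulr0, mul0r) subr0 addr0.
have v1 : ez (rvec j i) t != 1 by exact: (proj1 (regularP _ _ _ t) rt).
have mE : mult i = (-1) ^+ pneg j i * pcoef a b iota j i.
  by rewrite /pcoef; case: (pneg j i); rewrite /= ?expr1 ?expr0; ring.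
rewrite inv_one_sub_ez//.
rewrite !(conjcM, conjcD, conjcN) conjc_i !conjc_real conjc_half mE !rmorphM /=.
set s := (_ ^+ pneg j i)%:C; set p := (pcoef _ _ _ _ _)%:C; set c := (sin _)%:C * (_^-1)%:C.
set F := f t; set G := (g t)^*; set F' := f _; set G' := (g _)^*; set u := 'i%C.
apply/subr0_eq; transitivity ((1 + u * u) * (s * p * c * ((F - F') * G + F * (G - G')))).
  by field.
by rewrite mulii subrr mul0r.
Qed.

Lemma pairing_skew j l l' l'' :
  (kappa != 0 -> forall t, (sin (2 * dz (de j) t))%:C * ev l' t
    = (qcos e j t)%:C * ev l'' t) ->
  pairing (cherednik j (ev l)) (ev l')
    = - pairing (ev l) (fun t => cherednik j (ev l') t - (kappa * e)%:C * ev l'' t).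
Proof.
move=> /(cmean_to_skew l)/cmean_to_val skew.
have cl := cherednik_ev a_ge0 b_ge0 iota_ge0 j (fun t _ => erefl (ev l t)).
have cl' := cherednik_ev a_ge0 b_ge0 iota_ge0 j (fun t _ => erefl (ev l' t)).
set h := ev (Dpoly j l' ++ tscale (- (kappa * e)%:C) l'').
have hE : eq_reg (fun t => cherednik j (ev l') t - (kappa * e)%:C * ev l'' t) h.
  by move=> t rt; rewrite /h ev_cat ev_scale mulNr cl'.
apply/subr0_eq; rewrite opprK (pairing_eq_reg cl (fun t _ => erefl _)).
rewrite (pairing_eq_reg (fun t _ => erefl _) hE) /pairing -cmeanD; last 2 first.
- exact: cnice_pairing.
- exact: cnice_pairing.
rewrite -skew; apply: cmean_ext => t; rewrite -mulrDl.
have [->|/weight_regular rt] := eqVneq (W t) 0; first by rewrite !mulr0.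
by rewrite -cl// -hE.
Qed.

End SkewAdjoint.

(** * Commutation of the Cherednik operators *)

Section Commutation.
Local Open Scope classical_set_scope.
Local Open Scope ring_scope.
Local Open Scope complex_scope.
Context {R : realType} {r : nat}.
Variables a b iota : R.
Hypotheses (a_ge0 : 0 <= a) (b_ge0 : 0 <= b) (iota_ge0 : 0 <= iota).
Implicit Types (F G : 'rV[R]_r -> R[i]) (t : 'rV[R]_r) (l : @trig_poly R r).
Implicit Types (mu nu al : 'rV[int]_r).

Notation de i := (delta_mx 0 i : 'rV[int]_r).
Notation regular := (@regular R r a b iota).
Notation eq_reg := (@eq_reg R r a b iota).
Notation cherednik := (@cherednik R r a b iota).
Notation Dpoly := (@Dpoly R r a b iota).
Notation Dmono := (@Dmono R r a b iota).
Notation pairing := (@pairing R r a b iota 1 0).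

Definition zdot mu nu : int := \sum_(i < r) mu 0 i * nu 0 i.
(** A linear form with positive, strictly decreasing weights, hence positive on all positive
    roots. *)
Definition zlin mu : int := \sum_(i < r) mu 0 i * (r - i)%:Z.

(* Orders the exponents by squared length and, on a sphere, by decreasing
   dominance. *)
Definition ht mu : int := r%:Z * (zdot mu mu ^+ 2 + zdot mu mu) - zlin mu.

Lemma zdotC mu nu : zdot mu nu = zdot nu mu.
Proof. by apply: eq_bigr => i _; rewrite mulrC. Qed.

Lemma zdotDl mu nu al : zdot (mu + nu) al = zdot mu al + zdot nu al.
Proof. by rewrite -big_split; apply: eq_bigr => i _; rewrite mxE mulrDl. Qed.

Lemma zdotMzl mu n al : zdot (mu *~ n) al = zdot mu al * n.
Proof. by rewrite mulr_suml; apply: eq_bigr => i _; rewrite mulmz_coord mulrAC. Qed.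

Lemma zdot_addMz mu al n : zdot (mu + al *~ n) (mu + al *~ n)
  = zdot mu mu + n * (zdot mu al *+ 2) + n ^+ 2 * zdot al al.
Proof.
rewrite zdotDl [zdot mu _]zdotC [zdot (al *~ n) _]zdotC !zdotDl !zdotMzl.
rewrite [zdot mu (al *~ n)]zdotC [zdot al mu]zdotC !zdotMzl [zdot al (al *~ n)]zdotC.
by rewrite zdotMzl [zdot al mu]zdotC; ring.
Qed.

Lemma zlin_addMz mu al n : zlin (mu + al *~ n) = zlin mu + n * zlin al.
Proof.
rewrite mulr_sumr -big_split; apply: eq_bigr => i _ /=.
by rewrite mxE mulmz_coord; ring.
Qed.

Lemma zdot_ge0 mu : 0 <= zdot mu mu.
Proof. by apply: sumr_ge0 => i _; rewrite -expr2 sqr_ge0. Qed.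

Lemma zlin_le mu : `|zlin mu| <= r%:Z * zdot mu mu.
Proof.
apply: le_trans (ler_norm_sum _ _ _) _; rewrite mulr_sumr; apply: ler_sum => i _.
rewrite normrM mulrC; apply: ler_pM => //; first by lia.
by case: (mu 0 i) => n; nia.
Qed.

Lemma ht_ge0 mu : 0 <= ht mu.
Proof. by have := zlin_le mu; have := zdot_ge0 mu; rewrite /ht; nia. Qed.

(** Let N < N' be the two squared lengths. The quadratic part grows by r (N' - N) (N' + N + 1), at
    least r (N + N' + 1), whereas the linear forms differ by at most r (N + N'). This is the reason
    for the shape N^2 + N and for the factor r in [ht]. *)
Lemma ht_lt_norm mu nu : (0 < r)%N -> zdot nu nu < zdot mu mu -> ht nu < ht mu.
Proof.
have := zlin_le mu; have := zlin_le nu; have := zdot_ge0 nu; rewrite /ht.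
move: (zdot nu nu) (zdot mu mu) (zlin mu) (zlin nu) => q q' B B' q0 hB' hB r0 qq.
have h1 : q * q * r%:Z + q * r%:Z + q * r%:Z + r%:Z <= q' * q' * r%:Z by nia.
by rewrite !expr2; nia.
Qed.

Lemma pvec_zdot j i mu : rvalid j i ->
  ppair j i mu * zdot (pvec j i) (pvec j i) = zdot mu (pvec j i) *+ 2.
Proof.
have dr (k : 'I_r) mu' : zdot mu' (de k) = mu' 0 k.
  rewrite /zdot (bigD1 k) //= big1 => [|i' ik]; first by rewrite mxE !eqxx mulr1 addr0.
  by rewrite mxE eqxx (negbTE ik) mulr0.
have pos nu : zdot (- nu) (- nu) = zdot nu nu.
  by apply: eq_bigr => k _; rewrite !mxE mulrNN.
have posr nu : zdot mu (- nu) = - zdot mu nu.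
  by rewrite -sumrN; apply: eq_bigr => k _; rewrite !mxE mulrN.
suff h : rvalid j i -> match i with
    | inl (k, true) => mu 0 j + mu 0 k
    | inl (k, false) => mu 0 j - mu 0 k
    | inr true => mu 0 j *+ 2
    | inr false => mu 0 j
    end * zdot (rvec j i) (rvec j i) = zdot mu (rvec j i) *+ 2.
  move=> /h {}h; rewrite /pvec /ppair; case: (pneg j i) => //.
  by rewrite pos posr mulNr h mulNrn.
have addr nu nu' mu' : zdot mu' (nu + nu') = zdot mu' nu + zdot mu' nu'.
  by rewrite zdotC zdotDl zdotC [zdot nu' _]zdotC.
have oppr nu mu' : zdot mu' (- nu) = - zdot mu' nu.
  by rewrite -sumrN; apply: eq_bigr => k _; rewrite !mxE mulrN.
case: i => [[k s]|s] /= kj.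
  by case: s; rewrite ?addr ?oppr !dr !mxE !eqxx (negbTE kj) eq_sym (negbTE kj) /=; ring.
by case: s; rewrite ?mulr2n ?addr !dr !mxE !eqxx /=; ring.
Qed.

Lemma pvec_zdot_gt0 j i : rvalid j i -> 0 < zdot (pvec j i) (pvec j i).
Proof.
move=> ij; rewrite lt_neqAle zdot_ge0 andbT eq_sym; apply/eqP => h0.
have hj : pvec j i 0 j * pvec j i 0 j = 0.
  apply/eqP; rewrite eq_le -{1}h0 -expr2 sqr_ge0 andbT expr2 /zdot (bigD1 j) //= lerDl.
  by apply: sumr_ge0 => k _; rewrite -expr2 sqr_ge0.
move: hj; rewrite /pvec; case: i ij {h0} => [[k s]|s] /= kj; last first.
  by case: s; rewrite ?mulr2n !mxE !eqxx.
by case: s => /=; last case: ifP => _; rewrite !mxE !eqxx [j == k]eq_sym (negbTE kj).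
Qed.

Lemma pvec_zlin_gt0 j i : rvalid j i -> 0 < zlin (pvec j i).
Proof.
have zd (k : 'I_r) : zlin (de k) = (r - k)%:Z.
  rewrite /zlin (bigD1 k) //= big1 => [|l lk]; first by rewrite mxE !eqxx mul1r addr0.
  by rewrite mxE eqxx (negbTE lk) mul0r.
have zD mu nu : zlin (mu + nu) = zlin mu + zlin nu.
  by rewrite -big_split; apply: eq_bigr => k _; rewrite mxE mulrDl.
have zN mu : zlin (- mu) = - zlin mu.
  by rewrite -sumrN; apply: eq_bigr => k _; rewrite mxE mulNr.
have lj := ltn_ord j.
case: i => [[k s]|s] /= kj; last first.
  by rewrite /pvec; case: s => /=; rewrite ?mulr2n ?zD zd; lia.
have lk := ltn_ord k.
rewrite /pvec; case: s => /=; first by rewrite zD !zd; lia.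
have : (k : nat) != j by rewrite val_eqE.
by case: ifP => /= kj'; rewrite ?opprB zD zN !zd; lia.
Qed.

(** Interior points of the segment from mu to its reflection are strictly shorter than mu. The
    reflected end has the same length and occurs only when the pairing with the positive root is
    negative; it then exceeds mu by a positive multiple of that root, and [zlin] is larger there. *)
Lemma ht_geo j i mu x : rvalid j i -> x \in geo mu (pvec j i) (ppair j i mu) (R := R) ->
  x.2 = mu \/ ht x.2 < ht mu.
Proof.
move=> ij; have r0 : (0 < r)%N by apply: leq_ltn_trans (ltn_ord j).
have hn := pvec_zdot mu ij; have v0 := pvec_zdot_gt0 ij; have B0 := pvec_zlin_gt0 ij.
move: (ppair j i mu) hn => [n|n] hn /=.
  move=> /mapP[k]; rewrite mem_iota add0n /= => kn -> /=.
  have [->|k0] := posnP k; [by left; rewrite mulr0n subr0|right].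
  have -> : mu - pvec j i *+ k = mu + pvec j i *~ (- k%:Z) by rewrite mulrNz.
  by apply: ht_lt_norm => //; rewrite zdot_addMz -hn; nia.
move=> /mapP[k]; rewrite mem_iota add0n => kn -> /=; right.
have -> : mu + pvec j i *+ k.+1 = mu + pvec j i *~ k.+1 by [].
have [kn'|kn'] := ltnP k n.
  by apply: ht_lt_norm => //; rewrite zdot_addMz -hn; nia.
have -> : k = n by lia.
rewrite /ht zlin_addMz zdot_addMz -hn.
have -> : zdot mu mu + n.+1%:Z * (Negz n * zdot (pvec j i) (pvec j i))
    + n.+1%:Z ^+ 2 * zdot (pvec j i) (pvec j i) = zdot mu mu by nia.
by nia.
Qed.

Definition below (n : int) l : Prop := forall x, x \in l -> ht x.2 < n.

Lemma below_cat n l l' : below n l -> below n l' -> below n (l ++ l').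
Proof. by move=> h h' x; rewrite mem_cat => /orP[/h|/h']. Qed.

Lemma below_scale n c l : below n l -> below n (tscale c l).
Proof. by move=> h _ /mapP[x /h xl ->]. Qed.

Lemma Dmono_exponents j mu x : x \in Dmono j mu -> x.2 = mu \/ ht x.2 < ht mu.
Proof.
rewrite inE => /orP[/eqP-> /=|/flattenP[l]]; first by left.
case/(@mapP (rindex r) _) => i.
by rewrite mem_enum => ij -> /mapP[y /(ht_geo ij) h ->].
Qed.

Lemma below_Dpoly n j l : below n l -> below n (Dpoly j l).
Proof.
move=> h x /flattenP[l' /mapP[y yl ->]] /mapP[z /Dmono_exponents zy -> /=].
by case: zy => [->|/lt_trans]; [exact: h|apply; exact: h].
Qed.

Lemma Dmono_leading j mu : exists c l, below (ht mu) l /\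
  forall t, ev (Dmono j mu) t = c * ez mu t + ev l t.
Proof.
exists (\sum_(x <- Dmono j mu | x.2 == mu) x.1), [seq x <- Dmono j mu | x.2 != mu].
split=> [x|t].
  by rewrite mem_filter => /andP[/eqP xm /Dmono_exponents[]].
rewrite /ev big_filter (bigID (fun x => x.2 == mu)) /=; congr (_ + _).
by rewrite mulr_suml; apply: eq_bigr => x /eqP->.
Qed.

Lemma pairing_Dpoly j l l' :
  pairing (ev (Dpoly j l)) (ev l') = - pairing (ev l) (ev (Dpoly j l')).
Proof.
have cl k := cherednik_ev a_ge0 b_ge0 iota_ge0 j (fun t _ => erefl (ev k t)).
have := pairing_skew a_ge0 b_ge0 iota_ge0 (lexx 0) (or_introl (erefl 1)) (j := j) l
  (l' := l') (l'' := [::]).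
rewrite eqxx => /(_ (fun h => False_ind _ (notF h))).
rewrite (pairing_eq_reg _ _ (cl l) (fun _ _ => erefl)) => ->.
congr (- _); apply: pairing_eq_reg => // t rt.
by rewrite ev_nil mulr0 subr0 cl.
Qed.

Lemma pairingBl F G l1 l2 l : eq_reg F (ev l1) -> eq_reg G (ev l2) ->
  pairing (fun t => F t - G t) (ev l) = pairing F (ev l) - pairing G (ev l).
Proof.
move=> F1 G2; rewrite (pairing_eq_reg _ _ F1 (fun _ _ => erefl)).
rewrite (pairing_eq_reg _ _ G2 (fun _ _ => erefl)).
have FG : eq_reg (fun t => F t - G t) (ev (l1 ++ tscale (-1) l2)).
  by move=> t rt; rewrite ev_cat ev_scale mulN1r F1// G2.
have cn := cnice_pairing a_ge0 b_ge0 iota_ge0 (lexx 0) (or_introl (erefl 1)).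
rewrite (pairing_eq_reg _ _ FG (fun _ _ => erefl)) /pairing.
rewrite -[- cmean _]mulN1r -cmeanZ; last exact: cn.
rewrite -cmeanD; last 2 first.
- exact: cn.
- by apply: cniceM; [exact: cnice_cst|exact: cn].
by apply: cmean_ext => t; rewrite ev_cat ev_scale; ring.
Qed.

(** The integrand is |ev l|^2 times a nonnegative weight; at a regular point where ev l does not
    vanish it would be positive, and so would its mean. *)
Lemma pairing_definite l : pairing (ev l) (ev l) = 0 -> eq_reg (ev l) (fun=> 0).
Proof.
move=> l0 t rt; apply/eqP/negPn/negP => lt0.
pose f u := complex.Re (ev l u * (ev l u)^* * (weight a b iota 1 0 0 u)%:C).
have fE u : f u = (complex.Re (ev l u) ^+ 2 + complex.Im (ev l u) ^+ 2)
    * weight a b iota 1 0 0 u.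
  by rewrite /f; case: (ev l u) => x y /=; ring.
have W0 (u : 'rV[R]_r) : 0 <= weight a b iota 1 0 0 u.
  by apply: weight_ge0 => //; left.
have cn := cnice_pairing a_ge0 b_ge0 iota_ge0 (lexx 0) (or_introl (erefl 1)) l l.
have [fu _ fp] := cn; have [cf _] := cmeanP cn.
suff : 0 < complex.Re (pairing (ev l) (ev l)) by rewrite l0 ltxx.
apply: (@gmean_lim_gt0 R r f t) cf => //.
- by move=> u v; rewrite /f fp.
- by move=> u; rewrite fE mulr_ge0// addr_ge0// sqr_ge0.
rewrite fE mulr_gt0//; last by rewrite lt_neqAle W0 eq_sym regular_weight_neq0.
rewrite lt_neqAle addr_ge0 ?sqr_ge0// andbT eq_sym paddr_eq0 ?sqr_ge0// !sqrf_eq0.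
by apply: contra lt0; case: (ev l t) => x y /= /andP[/eqP-> /eqP->].
Qed.

Lemma Dpoly_comm i j l : eq_reg (ev (Dpoly i (Dpoly j l))) (ev (Dpoly j (Dpoly i l))).
Proof.
have lin k k' l0 t : ev (Dpoly k (Dpoly k' l0)) t
    = \sum_(x <- l0) x.1 * ev (Dpoly k (Dmono k' x.2)) t.
  rewrite ev_Dpoly big_flatten big_map; apply: eq_bigr => x _.
  by rewrite big_map ev_Dpoly mulr_sumr; apply: eq_bigr => y _; rewrite mulrA.
suff main (n : nat) mu : ht mu < n%:Z ->
    eq_reg (ev (Dpoly i (Dmono j mu))) (ev (Dpoly j (Dmono i mu))).
  move=> t rt; rewrite !lin; apply: eq_bigr => x _; congr (_ * _).
  by apply: (main `|ht x.2|.+1%N) => //; have := ht_ge0 x.2; lia.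
elim: n mu => [|n IH] mu hn; first by have := ht_ge0 mu; lia.
have IHl l0 : below (ht mu) l0 ->
    eq_reg (ev (Dpoly i (Dpoly j l0))) (ev (Dpoly j (Dpoly i l0))).
  move=> bl t rt; rewrite !lin !big_seq; apply: eq_bigr => x xl; congr (_ * _).
  by apply: IH => //; apply: lt_le_trans (bl x xl) _; move: hn; lia.
have [c [li [bi hi]]] := Dmono_leading i mu.
have [d [lj [bj hj]]] := Dmono_leading j mu.
have De k l1 l2 : ev l1 = ev l2 -> eq_reg (ev (Dpoly k l1)) (ev (Dpoly k l2)).
  move=> l12 t rt; rewrite -(cherednik_ev a_ge0 b_ge0 iota_ge0 k (fun t _ => erefl (ev l1 t)) rt).
  by rewrite l12 (cherednik_ev a_ge0 b_ge0 iota_ge0 k (fun t _ => erefl (ev l2 t)) rt).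
have evD k cc l0 t : ev (Dpoly k ((cc, mu) :: l0)) t = cc * ev (Dmono k mu) t + ev (Dpoly k l0) t.
  by rewrite ev_Dpoly big_cons ev_Dpoly.
(* The diagonal coefficients c and d enter both orders as the same product c d on the exponential of
   mu; after this cancellation [L] has only lower exponents. *)
pose L := (tscale d li ++ Dpoly i lj) ++ tscale (-1) (tscale c lj ++ Dpoly j li).
have LE t : regular t ->
    ev L t = ev (Dpoly i (Dmono j mu)) t - ev (Dpoly j (Dmono i mu)) t.
  move=> rt.
  have -> : ev (Dpoly i (Dmono j mu)) t = ev (Dpoly i ((d, mu) :: lj)) t.
    by apply: De rt; apply/funext => u; rewrite hj ev_cons.
  have -> : ev (Dpoly j (Dmono i mu)) t = ev (Dpoly j ((c, mu) :: li)) t.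
    by apply: De rt; apply/funext => u; rewrite hi ev_cons.
  by rewrite !evD hi hj !(ev_cat, ev_scale); ring.
have bL : below (ht mu) L.
  apply: below_cat; last apply: below_scale.
    by apply: below_cat; [exact: below_scale|exact: below_Dpoly].
  by apply: below_cat; [exact: below_scale|exact: below_Dpoly].
suff L0 : eq_reg (ev L) (fun=> 0).
  by move=> t rt; apply/eqP; rewrite -subr_eq0 -LE// L0.
apply: pairing_definite.
pose e1 : @trig_poly R r := [:: (1, mu)].
have e1E k : ev (Dmono k mu) = ev (Dpoly k e1).
  by apply/funext => t; rewrite ev_Dpoly big_seq1 mul1r.
have LE' : eq_reg (ev L) (fun t => ev (Dpoly i (Dpoly j e1)) t - ev (Dpoly j (Dpoly i e1)) t).
  by move=> t rt; rewrite LE// (De i _ _ (e1E j))// (De j _ _ (e1E i)).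
rewrite {1}(pairing_eq_reg _ _ LE' (fun _ _ => erefl)).
have refl l0 : eq_reg (ev l0) (ev l0) by [].
(* Moving both operators to the other side reverses their order and restores the sign. There they
   act on [L], where they commute by induction. *)
have skew2 k k' : pairing (ev (Dpoly k (Dpoly k' e1))) (ev L)
    = pairing (ev e1) (ev (Dpoly k' (Dpoly k L))).
  by rewrite (pairing_Dpoly k (Dpoly k' e1)) (pairing_Dpoly k' e1) opprK.
rewrite (pairingBl L (refl (Dpoly i (Dpoly j e1))) (refl (Dpoly j (Dpoly i e1)))).
rewrite (skew2 i j) (skew2 j i); apply/eqP; rewrite subr_eq0; apply/eqP.
exact: pairing_eq_reg (refl e1) (fun t rt => esym (IHl L bL t rt)).
Qed.

Definition op (x : 'I_r * R[i]) l : @trig_poly R r := Dpoly x.1 l ++ tscale x.2 l.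

Lemma ev_op x l : eq_reg (ev (op x l)) (fun t => cherednik x.1 (ev l) t + x.2 * ev l t).
Proof.
move=> t rt; rewrite ev_cat ev_scale.
by rewrite (cherednik_ev a_ge0 b_ge0 iota_ge0 x.1 (fun t _ => erefl (ev l t)) rt).
Qed.

Lemma op_eq_reg x l l' : eq_reg (ev l) (ev l') -> eq_reg (ev (op x l)) (ev (op x l')).
Proof.
move=> ll t rt; rewrite !ev_op// ll//.
by rewrite (cherednik_eq_reg a_ge0 b_ge0 iota_ge0 x.1 ll rt).
Qed.

Lemma Dpoly_cat j l l' t : ev (Dpoly j (l ++ l')) t = ev (Dpoly j l) t + ev (Dpoly j l') t.
Proof. by rewrite !ev_Dpoly big_cat. Qed.

Lemma Dpoly_scale j c l t : ev (Dpoly j (tscale c l)) t = c * ev (Dpoly j l) t.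
Proof.
by rewrite !ev_Dpoly big_map mulr_sumr; apply: eq_bigr => x _ /=; rewrite mulrA.
Qed.

Lemma op_comm x y l : eq_reg (ev (op x (op y l))) (ev (op y (op x l))).
Proof.
move=> t rt; rewrite !ev_cat !ev_scale !ev_cat !ev_scale !Dpoly_cat !Dpoly_scale.
by rewrite (Dpoly_comm _ _ _ rt); ring.
Qed.

Definition ops (s : seq ('I_r * R[i])) l := foldr op l s.

Lemma ops_eq_reg s l l' : eq_reg (ev l) (ev l') -> eq_reg (ev (ops s l)) (ev (ops s l')).
Proof. by move=> ll; elim: s => //= x s IH; exact: op_eq_reg. Qed.

Lemma ops_perm s s' l : perm_eq s s' -> eq_reg (ev (ops s l)) (ev (ops s' l)).
Proof.
have ops_cat s1 s2 : ops (s1 ++ s2) l = ops s1 (ops s2 l) by rewrite /ops foldr_cat.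
have swap1 x s1 l0 : eq_reg (ev (op x (ops s1 l0))) (ev (ops s1 (op x l0))).
  elim: s1 => //= y s1 IH t rt; rewrite op_comm//; exact: op_eq_reg.
have swap s1 s2 l0 : eq_reg (ev (ops s1 (ops s2 l0))) (ev (ops s2 (ops s1 l0))).
  elim: s1 => //= x s1 IH t rt; rewrite -swap1//; exact: op_eq_reg.
pose P s' := eq_reg (ev (ops s l)) (ev (ops s' l)).
move=> ss; apply: (catCA_perm_ind (P := P) _ ss) => // s1 s2 s3 h t rt.
by rewrite h// !ops_cat swap.
Qed.

End Commutation.

(** * The Bernstein-Sato identity *)

Lemma natr_rank (S : pzSemiRingType) r (j : 'I_r) : (r - 1)%:R = (r - j.+1)%:R + j%:R :> S.
Proof. by rewrite -natrD; congr _%:R; have := ltn_ord j; lia. Qed.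

Section BernsteinSato.
Local Open Scope classical_set_scope.
Local Open Scope ring_scope.
Local Open Scope complex_scope.
Context {R : realType} {r : nat}.
Variables a b iota e : R.
Hypotheses (a_ge0 : 0 <= a) (b_ge0 : 0 <= b) (iota_ge0 : 0 <= iota).
Hypothesis (e1 : e = 1 \/ e = -1).
Implicit Types (F G : 'rV[R]_r -> R[i]) (t : 'rV[R]_r) (l : @trig_poly R r).

Notation de i := (delta_mx 0 i : 'rV[int]_r).
Notation regular := (@regular R r a b iota).
Notation eq_reg := (@eq_reg R r a b iota).
Notation cherednik := (@cherednik R r a b iota).
Notation z k t := (ez (de k) t).

Lemma ez_delta_rrefl j i k t : z k (rrefl j i t) =
  match i with
  | inl (m, s) => if s && ((k == j) || (k == m)) then (z (tperm j m k) t)^-1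
                  else z (tperm j m k) t
  | inr _ => if k == j then (z k t)^-1 else z k t
  end.
Proof.
have neg m u : ez (de m) u = expi (2 * u 0 m) by rewrite /ez dz_delta.
have inv m : expi (2 * (-1 * t 0 m)) = (z m t)^-1.
  by rewrite -ezV /ez dzN dz_delta mulN1r.
rewrite neg; case: i => [[m s]|s] /=; rewrite mxE.
  by case: (s && _); rewrite ?expr1 ?expr0 ?inv ?mul1r -?neg.
by rewrite perm1 /=; case: (k == j); rewrite ?expr1 ?expr0 ?inv ?mul1r -?neg.
Qed.

Lemma is_partialC_prod (h : 'I_r -> @trig_poly R r) j t d :
  (forall k x, k != j -> x \in h k -> x.2 0 j = 0) ->
  is_partialC j (ev (h j)) t d ->
  is_partialC j (fun u => \prod_(k < r) ev (h k) u) t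
    (d * \prod_(k < r | k != j) ev (h k) t).
Proof.
move=> hk hd.
have rest (s : seq 'I_r) :
    is_partialC j (fun u => \prod_(k <- s | k != j) ev (h k) u) t 0.
  elim: s => [|k s IH].
    rewrite (_ : (fun u => _) = fun=> 1); first exact: is_partialC_cst.
    by apply/funext => u; rewrite big_nil.
  have [->|kj] := eqVneq k j.
    rewrite (_ : (fun u => _) = fun u => \prod_(k <- s | k != j) ev (h k) u)//.
    by apply/funext => u; rewrite big_cons eqxx.
  rewrite (_ : (fun u => _) = fun u => ev (h k) u * \prod_(k <- s | k != j) ev (h k) u).
    have := is_partialCM (is_partialC_ev j (h k) t) IH.
    rewrite mulr0 addr0 big_seq big1 ?mul0r// => x xh.
    by rewrite (hk k)// mulr0 mul0r mulr0.
  by apply/funext => u; rewrite big_cons kj.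
have := is_partialCM hd (rest (index_enum 'I_r)); rewrite mulr0 addr0.
congr (is_partialC j _ t _); apply/funext => u.
by rewrite [RHS](bigD1 j).
Qed.

(** The hypothesis is conditional on p because p is a multiplicity up to a unit: for an absent root
    the denominator may vanish. *)
Lemma divided_difference (p x y d : R[i]) :
  (p != 0 -> d != 0) -> x = d * y -> p * (x / d) = p * y.
Proof.
move=> pd ->; have [->|/pd d0] := eqVneq p 0; first by rewrite !mul0r.
by rewrite mulrAC mulfV// mul1r.
Qed.

(** The reflection in eps_j + eps_k or eps_j - eps_k touches only the factors j and k, so that each
    divided difference reduces to an identity in two variables. [P k] and [M k] are its quotients
    for the sum and the difference, with the factor k taken out; [Ys] and [Yl] are those of the
    short and the long root. The sign before [M k] for k < j comes from the orientation of the
    positive root. *)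
Lemma cherednik_prod (h : 'I_r -> @trig_poly R r) (H : 'I_r -> R[i] -> R[i]) j t
    (d Ys Yl : R[i]) (P M : 'I_r -> R[i]) :
  (forall k t, ev (h k) t = H k (z k t)) ->
  (forall k x, k != j -> x \in h k -> x.2 0 j = 0) ->
  is_partialC j (ev (h j)) t d ->
  (forall k, k != j -> H j (z j t) * H k (z k t) - H j (z k t)^-1 * H k (z j t)^-1
    = (1 - (z j t * z k t)^-1) * (P k * H k (z k t))) ->
  (forall k, k != j -> H j (z j t) * H k (z k t) - H j (z k t) * H k (z j t)
    = (1 - if (k < j)%N then z j t / z k t else z k t / z j t) * (M k * H k (z k t))) ->
  H j (z j t) - H j (z j t)^-1 = (1 - (z j t)^-1) * Ys ->
  H j (z j t) - H j (z j t)^-1 = (1 - (z j t ^+ 2)^-1) * Yl ->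
  regular t ->
  cherednik j (fun u => \prod_(k < r) ev (h k) u) t =
    (d + \sum_(k < r | k != j) 'i%C * a%:C * (P k + if (k < j)%N then - M k else M k)
      + 'i%C * (2 * b)%:C * Ys + 'i%C * (2 * iota)%:C * Yl
      - 'i%C * (rho a b iota j)%:C * ev (h j) t) * \prod_(k < r | k != j) ev (h k) t.
Proof.
move=> hE hk hd PE ME YsE YlE rt; set g := fun u => \prod_(k < r) ev (h k) u.
set rest := \prod_(k < r | k != j) ev (h k) t.
rewrite cherednikE (is_partialC_val (is_partialC_prod hk hd)) -/rest.
have gE u : g u = ev (h j) u * \prod_(k < r | k != j) ev (h k) u by rewrite /g (bigD1 j).
have gE2 k u : k != j -> g u = ev (h j) u * ev (h k) u *
    \prod_(m < r | (m != j) && (m != k)) ev (h m) u.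
  by move=> kj; rewrite gE (bigD1 k)//= mulrA.
have restE k : k != j -> rest = ev (h k) t * \prod_(m < r | (m != j) && (m != k)) ev (h m) t.
  by move=> kj; rewrite /rest (bigD1 k).
have nz m : z m t != 0 by exact: ez_neq0.
have reg i : rvalid j i -> 'i%C * (pcoef a b iota j i)%:C != 0 -> 1 - ez (- pvec j i) t != 0.
  move=> ij p0; rewrite subr_eq0 eq_sym.
  have m0 : rmult a b iota i != 0.
    by apply: contra p0 => /eqP m0; rewrite /pcoef m0 oppr0 if_same mulr0.
  have := proj1 (regularP _ _ _ t) rt _ _ ij m0.
  by rewrite /pvec; case: ifP => _; rewrite ?ezN_eq1.
have one s Y : H j (z j t) - H j (z j t)^-1 = (1 - ez (- pvec j (inr s)) t) * Y ->
    'i%C * (pcoef a b iota j (inr s))%:C *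
      ((g t - g (rrefl j (inr s) t)) / (1 - ez (- pvec j (inr s)) t))
    = 'i%C * (pcoef a b iota j (inr s))%:C * Y * rest.
  move=> HY; rewrite -[RHS]mulrA; apply: divided_difference; first exact: reg.
  rewrite !gE -/rest; have -> : \prod_(k < r | k != j) ev (h k) (rrefl j (inr s) t) = rest.
    by apply: eq_bigr => k kj; rewrite !hE ez_delta_rrefl (negbTE kj).
  by rewrite -mulrBl !hE ez_delta_rrefl eqxx HY mulrA.
have two k s Y : k != j ->
    H j (z j t) * H k (z k t)
      - H j (z j (rrefl j (inl (k, s)) t)) * H k (z k (rrefl j (inl (k, s)) t))
      = (1 - ez (- pvec j (inl (k, s))) t) * (Y * H k (z k t)) ->
    'i%C * (pcoef a b iota j (inl (k, s)))%:C *
      ((g t - g (rrefl j (inl (k, s)) t)) / (1 - ez (- pvec j (inl (k, s))) t))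
    = 'i%C * (pcoef a b iota j (inl (k, s)))%:C * Y * rest.
  move=> kj HY; rewrite -[RHS]mulrA; apply: divided_difference; first exact: reg.
  rewrite !(gE2 k)// (restE k)//.
  set Q := \prod_(_ < r | _) _; set Q' := \prod_(_ < r | _) _.
  have -> : Q' = Q.
    apply: eq_bigr => m /andP[mj mk]; rewrite !hE ez_delta_rrefl.
    by rewrite (negbTE mj) (negbTE mk) andbF tpermD// eq_sym.
  by rewrite -mulrBl !hE HY; ring.
rewrite sum_rindex (one true Ys) ?(one false Yl); first last.
- by rewrite YsE /pvec /= ezV.
- by rewrite YlE /pvec /= ezV ezMn.
have -> : \sum_(k < r | k != j)
     ('i%C * (pcoef a b iota j (inl (k, true)))%:C *
      ((g t - g (rrefl j (inl (k, true)) t)) / (1 - ez (- pvec j (inl (k, true))) t)) +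
      'i%C * (pcoef a b iota j (inl (k, false)))%:C *
      ((g t - g (rrefl j (inl (k, false)) t)) / (1 - ez (- pvec j (inl (k, false))) t)))
    = (\sum_(k < r | k != j) 'i%C * a%:C * (P k + if (k < j)%N then - M k else M k)) * rest.
  rewrite mulr_suml; apply: eq_bigr => k kj.
  rewrite (two k true (P k))// ?(two k false (M k))//; first last.
  - rewrite !ez_delta_rrefl /= !eqxx orbT tpermL tpermR PE//.
    by rewrite /pvec /= opprD ezD !ezV invfM.
  - rewrite !ez_delta_rrefl /= tpermL tpermR ME// /pvec /=.
    by case: ifP => _; rewrite ?opprK 1?[- (de j - _)]opprB ezD ezV.
  by rewrite /pcoef /=; case: ifP => _; rewrite ?rmorphN /=; ring.
by rewrite /pcoef /= gE -/rest; ring.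
Qed.

Lemma sum_ord_split (V : pzSemiRingType) (j : 'I_r) (x y : V) :
  \sum_(k < r | k != j) (if (k < j)%N then x else y) = x * j%:R + y * (r - j.+1)%:R.
Proof.
rewrite !mulr_natr.
rewrite (bigID (fun k : 'I_r => (k < j)%N)) /=; congr (_ + _).
  rewrite (eq_big (fun k : 'I_r => (k < j)%N) (fun=> x)) => [|k|k /andP[_ ->]//].
    by rewrite (big_ord_narrow (ltnW (ltn_ord j))) sumr_const card_ord.
  by rewrite -val_eqE /= neq_ltn; case: ltngtP.
rewrite (eq_big (fun k : 'I_r => (j < k)%N) (fun=> y)) => [|k|k /andP[_ /negbTE->]//]; last first.
  by rewrite -val_eqE /= neq_ltn; case: ltngtP.
rewrite sumr_const; congr (_ *+ _); rewrite -sum1_card.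
rewrite (reindex_inj rev_ord_inj) /=.
rewrite (eq_bigl (fun k : 'I_r => (k < r - j.+1)%N)) => [|k]; last first.
  by rewrite unfold_in /=; have := ltn_ord k; have := ltn_ord j; lia.
by rewrite (big_ord_narrow (leq_subr _ _)) sum1_card card_ord.
Qed.

(* At [w = ez (de j) t], [bsC w] is the square of the cosine (or sine) of [t 0 j]
   and [bsG w] one of its two linear factors, up to a phase: the operators
   [D_j + i lam], then [D_j - i lam], strip [\prod_j bsC] of these factors. *)
Definition bsC (w : R[i]) : R[i] := e%:C * (w + e%:C) ^+ 2 / (4 * w).
Definition bsG (w : R[i]) : R[i] := e%:C * (w + e%:C) / 2.

Definition trig1 : @trig_poly R r := [:: (1, 0)].
Definition trigC k : @trig_poly R r :=
  [:: (e%:C / 4, de k); (2^-1, 0); (e%:C / 4, - de k)].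
Definition trigG k : @trig_poly R r := [:: (e%:C / 2, de k); (2^-1, 0)].
(** This is sin (2 t_k). Both [trigS] and [trigU] are the products of [trigC] and [trigG] by sin (2
    t_k) / qcos, as needed for the tangent term of [pairing_skew]. *)
Definition trigS k : @trig_poly R r :=
  [:: (- 'i%C / 2, de k); ('i%C / 2, - de k)].
Definition trigU k : @trig_poly R r := [:: (- 'i%C, de k); ('i%C * e%:C, 0)].

Lemma sqr_sign_complex : e%:C * e%:C = 1 :> R[i].
Proof. by case: e1 => ->; rewrite -rmorphM /= ?mul1r ?mulrNN ?mul1r. Qed.

Lemma ev_trig1 t : ev trig1 t = 1.
Proof. by rewrite /ev big_seq1 /= ez0 mulr1. Qed.

Lemma ev_trigC k t : ev (trigC k) t = bsC (z k t).
Proof.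
rewrite /ev /bsC !big_cons big_nil /= ez0 ezV; have := ez_neq0 (de k) t.
move: (z k t) => w w0; apply/subr0_eq.
transitivity ((1 - e%:C * e%:C) * (2^-1 + e%:C / (4 * w))); last by rewrite sqr_sign_complex subrr mul0r.
by field.
Qed.

Lemma ev_trigG k t : ev (trigG k) t = bsG (z k t).
Proof.
rewrite /ev /bsG !big_cons big_nil /= ez0; move: (z k t) => w; apply/subr0_eq.
transitivity ((1 - e%:C * e%:C) / 2); last by rewrite sqr_sign_complex subrr mul0r.
by field.
Qed.

Lemma ev_trigS k t : ev (trigS k) t = - 'i%C / 2 * (z k t - (z k t)^-1).
Proof. by rewrite /ev !big_cons big_nil /= ezV; ring. Qed.

Lemma ev_trigU k t : ev (trigU k) t = - 'i%C * (z k t - e%:C).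
Proof. by rewrite /ev !big_cons big_nil /= ez0; ring. Qed.

Lemma qcos_bsC k t : (qcos e k t)%:C = bsC (z k t).
Proof.
rewrite /qcos rmorphM /= -real_complexV rmorphD rmorphM /= cos_ez rmorph1.
rewrite (rmorph_nat (real_complex R) 2) /bsC; have := ez_neq0 (de k) t.
move: (z k t) => w w0; apply/subr0_eq.
transitivity ((1 - e%:C * e%:C) * (2^-1 + e%:C / (4 * w))); last by rewrite sqr_sign_complex subrr mul0r.
by field.
Qed.

Lemma e_cases : e%:C = 1 \/ e%:C = -1 :> R[i].
Proof. by case: e1 => ->; [left|right]; rewrite ?rmorphN. Qed.

Lemma bsCV w : w != 0 -> bsC w^-1 = bsC w.
Proof. by rewrite /bsC => w0; case: e_cases => ->; field. Qed.

(** The intermediate products: in [chain1 n] the indices below n have lost one linear factor, in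
    [chain2 n] the indices from n on have lost both. They agree at n = r. *)
Definition chain1 (n : nat) (k : 'I_r) : @trig_poly R r := if (k < n)%N then trigG k else trigC k.
Definition chain2 (n : nat) (k : 'I_r) : @trig_poly R r := if (k < n)%N then trigG k else trig1.

Variable kappa : R.
Let nu := kappa + 1.
Let lam := 2 * nu + iota + b + a * (r - 1)%:R.

Lemma exponents_trigC k m (x : R[i] * 'rV[int]_r) : k != m -> x \in trigC k -> x.2 0 m = 0.
Proof.
rewrite eq_sym => km; rewrite !inE => /or3P[] /eqP-> /=; rewrite !mxE ?eqxx ?(negbTE km) ?oppr0//.
Qed.

Lemma exponents_trigG k m (x : R[i] * 'rV[int]_r) : k != m -> x \in trigG k -> x.2 0 m = 0.
Proof.
rewrite eq_sym => km; rewrite !inE => /orP[] /eqP-> /=; rewrite !mxE ?eqxx ?(negbTE km)//.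
Qed.

Lemma ltn_ordS (k j : 'I_r) : k != j -> (k < j.+1)%N = (k < j)%N.
Proof. by rewrite ltnS leq_eqVlt -(inj_eq val_inj) => /negbTE->. Qed.

(** The value of lam is the one that cancels the exponent -1 of z_j: the condition reads lam = 2 nu
    + a j + rho_j, and a j + rho_j = iota + b + a (r - 1) is the same for all j. The factors j and k
    > j are still symmetric and give no divided difference, so only the j indices already treated
    contribute, whence the term a j. *)
Lemma bs_stage1 j t : regular t ->
  cherednik j (fun u => \prod_(k < r) ev (chain1 j k) u) t
    + 'i%C * lam%:C * \prod_(k < r) ev (chain1 j k) t
    - (kappa * e)%:C * (ev (trigS j) t * \prod_(k < r | k != j) ev (chain1 j k) t)
  = 'i%C * (2 * nu + a * j%:R)%:C * \prod_(k < r) ev (chain1 j.+1 k) t.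
Proof.
move=> rt; set w := z j t; have w0 : w != 0 by exact: ez_neq0.
pose H (k : 'I_r) := if (k < j)%N then bsG else bsC.
pose P (k : 'I_r) := if (k < j)%N then e%:C * (w + e%:C) / 4 else 0.
pose M (k : 'I_r) := if (k < j)%N then (w + e%:C) / (4 * w) else 0.
have Hj : H j = bsC by rewrite /H ltnn.
rewrite (@cherednik_prod _ H j t ('i%C * e%:C * (w + e%:C) * (w - e%:C) / (2 * w)) 0 0 P M) //;
    last first.
- by rewrite Hj bsCV// subrr mulr0.
- by rewrite Hj bsCV// subrr mulr0.
- move=> k kj; rewrite Hj /H /M -/w; set v := z k t; have v0 : v != 0 by exact: ez_neq0.
  case: ifP => _; last by rewrite mul0r mulr0 mulrC subrr.
  by rewrite /bsC /bsG; case: e_cases => ->; field; rewrite v0 w0.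
- move=> k kj; rewrite Hj /H /P -/w; set v := z k t; have v0 : v != 0 by exact: ez_neq0.
  case: ifP => _; last by rewrite !bsCV// mul0r mulr0 mulrC subrr.
  by rewrite /bsC /bsG; case: e_cases => ->; field; rewrite ?v0 ?w0 ?mulf_neq0.
- rewrite /chain1 ltnn; have := is_partialC_ev j (trigC j) t; rewrite !big_cons big_nil /=.
  congr (is_partialC _ _ _ _); rewrite !mxE !eqxx ez0 ezV -/w /= mulr1n mulrNz mulr1z mulr0z.
  by case: e_cases => ->; field.
- move=> k x kj; rewrite /chain1; case: ifP => _; [exact: exponents_trigG|exact: exponents_trigC].
- by move=> k u; rewrite /chain1 /H; case: ifP => _; rewrite ?ev_trigG ?ev_trigC.
set rest := \prod_(k < r | k != j) ev (chain1 j k) t.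
have restE : rest = \prod_(k < r | k != j) ev (chain1 j.+1 k) t.
  by apply: eq_bigr => k kj; rewrite /chain1 ltn_ordS.
rewrite [\prod_(k < r) ev (chain1 j k) t](bigD1 j)//=.
rewrite [\prod_(k < r) ev (chain1 j.+1 k) t](bigD1 j)//= -restE -/rest.
have -> : ev (chain1 j j) t = bsC w by rewrite /chain1 ltnn ev_trigC.
have -> : ev (chain1 j.+1 j) t = bsG w by rewrite /chain1 ltnSn ev_trigG.
rewrite ev_trigS -/w (eq_bigr (fun k : 'I_r => if (k < j)%N then
  'i%C * a%:C * (e%:C * (w + e%:C) / 4 - (w + e%:C) / (4 * w)) else 0)); last first.
  by move=> k _; rewrite /P /M; case: ifP => _; rewrite ?addr0 ?mulr0.
rewrite sum_ord_split mul0r addr0 !mulr0 !addr0 /lam /rho (natr_rank R j) /nu.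
rewrite !(rmorphD, rmorphM) /= !rmorph1 !(rmorph_nat (real_complex R)) /bsC /bsG.
move: ((r - j.+1)%:R : R[i]) (j%:R : R[i]) => n n'.
by case: e_cases => ->; field.
Qed.

(** With - lam in place of lam, it is the exponent 1 of z_j that cancels, and a constant remains.
    The term b (1 - e) tells sine from cosine; it enters the recurrence only through [bs_factor],
    which cancels after division by the mass. *)
Lemma bs_stage2 j t : regular t ->
  cherednik j (fun u => \prod_(k < r) ev (chain2 j.+1 k) u) t
    - 'i%C * lam%:C * \prod_(k < r) ev (chain2 j.+1 k) t
    - (kappa * e)%:C * (ev (trigU j) t * \prod_(k < r | k != j) ev (chain2 j.+1 k) t)
  = 'i%C * (1 - iota - 2 * nu - a * (r - j.+1)%:R - b * (1 - e))%:C
      * \prod_(k < r) ev (chain2 j k) t.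
Proof.
move=> rt; set w := z j t; have w0 : w != 0 by exact: ez_neq0.
pose H (k : 'I_r) := if (k < j.+1)%N then bsG else fun=> 1.
pose P (k : 'I_r) := if (k < j)%N then bsG w else e%:C * w / 2.
pose M (k : 'I_r) := if (k < j)%N then 0 else e%:C * w / 2.
have Hj : H j = bsG by rewrite /H ltnSn.
rewrite (@cherednik_prod _ H j t ('i%C * e%:C * w) (e%:C * (w + 1) / 2) (e%:C * w / 2) P M) //;
    last first.
- by rewrite Hj -/w /bsG; case: e_cases => ->; field.
- by rewrite Hj -/w /bsG; case: e_cases => ->; field.
- move=> k kj; rewrite Hj /H /M -/w ltn_ordS//; set v := z k t.
  have v0 : v != 0 by exact: ez_neq0.
  by case: ifP => _; rewrite /bsG; case: e_cases => ->; field; rewrite ?v0 ?w0.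
- move=> k kj; rewrite Hj /H /P -/w ltn_ordS//; set v := z k t.
  have v0 : v != 0 by exact: ez_neq0.
  by case: ifP => _; rewrite /bsG; case: e_cases => ->; field; rewrite ?v0 ?w0 ?mulf_neq0.
- rewrite /chain2 ltnSn; have := is_partialC_ev j (trigG j) t; rewrite !big_cons big_nil /=.
  congr (is_partialC _ _ _ _); rewrite !mxE !eqxx ez0 -/w /= mulr1z mulr0z.
  by case: e_cases => ->; field.
- move=> k x kj; rewrite /chain2; case: ifP => _; first exact: exponents_trigG.
  by rewrite inE => /eqP-> /=; rewrite mxE.
- by move=> k u; rewrite /chain2 /H; case: ifP => _; rewrite ?ev_trigG ?ev_trig1.
set rest := \prod_(k < r | k != j) ev (chain2 j.+1 k) t.
have restE : rest = \prod_(k < r | k != j) ev (chain2 j k) t.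
  by apply: eq_bigr => k kj; rewrite /chain2 ltn_ordS.
rewrite [\prod_(k < r) ev (chain2 j.+1 k) t](bigD1 j)//=.
rewrite [\prod_(k < r) ev (chain2 j k) t](bigD1 j)//= -restE -/rest.
have -> : ev (chain2 j j) t = 1 by rewrite /chain2 ltnn ev_trig1.
have -> : ev (chain2 j.+1 j) t = bsG w by rewrite /chain2 ltnSn ev_trigG.
rewrite ev_trigU -/w (eq_bigr (fun k : 'I_r => if (k < j)%N then
  'i%C * a%:C * bsG w else 'i%C * a%:C * (e%:C * w))); last first.
  by move=> k _; rewrite /P /M; case: ifP => _; rewrite ?oppr0 ?addr0//; field.
rewrite sum_ord_split /lam /rho (natr_rank R j) /nu.
rewrite !(rmorphD, rmorphM, rmorphN) /= !rmorph1 !(rmorph_nat (real_complex R)) /bsG.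
move: ((r - j.+1)%:R : R[i]) (j%:R : R[i]) => n n'.
by case: e_cases => ->; field.
Qed.

End BernsteinSato.

(** * The recurrence in the exponent kappa *)

Section Recurrence.
Local Open Scope classical_set_scope.
Local Open Scope ring_scope.
Local Open Scope complex_scope.
Context {R : realType} {r : nat}.
Variables a b iota e : R.
Hypotheses (a_ge0 : 0 <= a) (b_ge0 : 0 <= b) (iota_ge0 : 0 <= iota).
Hypothesis (e1 : e = 1 \/ e = -1).
Implicit Types (F G : 'rV[R]_r -> R[i]) (t : 'rV[R]_r) (l : @trig_poly R r).

Notation de i := (delta_mx 0 i : 'rV[int]_r).
Notation regular := (@regular R r a b iota).
Notation eq_reg := (@eq_reg R r a b iota).
Notation cherednik := (@cherednik R r a b iota).
Notation op := (@op R r a b iota).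
Notation ops := (@ops R r a b iota).

Section FixedKappa.
Variable kappa : R.
Hypothesis kappa_ge0 : 0 <= kappa.
Notation W := (@weight R r a b iota e kappa 0).
Notation pairing := (@pairing R r a b iota e kappa).

Let cnp l1 l2 := cnice_pairing a_ge0 b_ge0 iota_ge0 kappa_ge0 e1 l1 l2.
Let refl l : eq_reg (ev l) (ev l) := fun _ _ => erefl.

Lemma pairing_catl l1 l2 l :
  pairing (ev (l1 ++ l2)) (ev l) = pairing (ev l1) (ev l) + pairing (ev l2) (ev l).
Proof.
rewrite /pairing -cmeanD; last 2 first. by exact: cnp. by exact: cnp.
by apply: cmean_ext => t; rewrite ev_cat !mulrDl.
Qed.

Lemma pairing_scalel c l1 l :
  pairing (ev (tscale c l1)) (ev l) = c * pairing (ev l1) (ev l).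
Proof.
rewrite /pairing -cmeanZ; last exact: cnp.
by apply: cmean_ext => t; rewrite ev_scale !mulrA.
Qed.

Lemma pairing_catr l l1 l2 :
  pairing (ev l) (ev (l1 ++ l2)) = pairing (ev l) (ev l1) + pairing (ev l) (ev l2).
Proof.
rewrite /pairing -cmeanD; last 2 first. by exact: cnp. by exact: cnp.
by apply: cmean_ext => t; rewrite ev_cat conjcD mulrDr !mulrDl.
Qed.

Lemma pairing_scaler c l l1 :
  pairing (ev l) (ev (tscale c l1)) = c^* * pairing (ev l) (ev l1).
Proof.
rewrite /pairing -cmeanZ; last exact: cnp.
by apply: cmean_ext => t; rewrite ev_scale conjcM; ring.
Qed.

(** For real c, multiplication by i c is anti-hermitian, so D_j + i c is skew whenever D_j is; the
    two signs, from skewness and from conjugating i x, compensate. *)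
Lemma pairing_op j (c x : R) l l1 l2 l3 :
  (forall t, (sin (2 * dz (de j) t))%:C * ev l1 t = (qcos e j t)%:C * ev l3 t) ->
  (forall t, regular t -> cherednik j (ev l1) t + 'i%C * c%:C * ev l1 t
     - (kappa * e)%:C * ev l3 t = 'i%C * x%:C * ev l2 t) ->
  pairing (ev (op (j, 'i%C * c%:C) l)) (ev l1) = 'i%C * x%:C * pairing (ev l) (ev l2).
Proof.
move=> hT hG; rewrite /op pairing_catl pairing_scalel /=.
have cl := cherednik_ev a_ge0 b_ge0 iota_ge0 j (@refl l).
rewrite -(pairing_eq_reg _ _ cl (@refl l1))
  (pairing_skew a_ge0 b_ge0 iota_ge0 kappa_ge0 e1 l (fun _ => hT)).
have hD : eq_reg (fun t => cherednik j (ev l1) t - (kappa * e)%:C * ev l3 t)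
    (ev (tscale ('i%C * x%:C) l2 ++ tscale (- ('i%C * c%:C)) l1)).
  by move=> t rt; rewrite ev_cat !ev_scale -hG//; ring.
rewrite (pairing_eq_reg _ _ (@refl l) hD) pairing_catr !pairing_scaler.
by rewrite !(conjcN, conjcM) !conjc_i !conjc_real; ring.
Qed.

Definition tprod (h : 'I_r -> @trig_poly R r) : @trig_poly R r :=
  foldr tmul trig1 [seq h k | k <- index_enum 'I_r].

Lemma ev_tprod h t : ev (tprod h) t = \prod_(k < r) ev (h k) t.
Proof.
rewrite /tprod; elim: (index_enum _) => [|k s IH]; first by rewrite big_nil ev_trig1.
by rewrite big_cons -IH /= ev_tmul.
Qed.

Lemma ev_tprod_at h j t : ev (tprod (fun k => if k == j then trig1 else h k)) t
  = \prod_(k < r | k != j) ev (h k) t.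
Proof.
rewrite ev_tprod (bigD1 j)//= eqxx ev_trig1 mul1r.
by apply: eq_bigr => k /negbTE->.
Qed.

Definition shift := 2 * (kappa + 1) + iota + b + a * (r - 1)%:R.

Lemma pairing_stage1 j l : pairing (ev (op (j, 'i%C * shift%:C) l)) (ev (tprod (chain1 e j)))
  = 'i%C * (2 * (kappa + 1) + a * j%:R)%:C * pairing (ev l) (ev (tprod (chain1 e j.+1))).
Proof.
pose rest := tprod (fun k => if k == j then trig1 else chain1 e j k).
apply: (@pairing_op j _ _ l _ _ (tmul (trigS j) rest)).
  move=> t; rewrite ev_tmul /rest ev_tprod_at ev_tprod (bigD1 j)//=.
  by rewrite {1}/chain1 ltnn sin_ez ev_trigS (ev_trigC e1) (qcos_bsC e1); ring.
move=> t rt; rewrite ev_tmul.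
have -> : ev (tprod (chain1 e j)) = fun u => \prod_(k < r) ev (chain1 e j k) u.
  by apply/funext => u; exact: ev_tprod.
rewrite (ev_tprod (chain1 e j.+1)) -(bs_stage1 a_ge0 b_ge0 iota_ge0 e1 kappa j rt).
by rewrite /rest ev_tprod_at.
Qed.

Lemma pairing_stage2 j l : pairing (ev (op (j, - ('i%C * shift%:C)) l)) (ev (tprod (chain2 e j.+1)))
  = 'i%C * (1 - iota - 2 * (kappa + 1) - a * (r - j.+1)%:R - b * (1 - e))%:C
    * pairing (ev l) (ev (tprod (chain2 e j))).
Proof.
have -> : - ('i%C * shift%:C) = 'i%C * (- shift)%:C by rewrite rmorphN mulrN.
pose rest := tprod (fun k => if k == j then trig1 else chain2 e j.+1 k).
apply: (@pairing_op j _ _ l _ _ (tmul (trigU e j) rest)).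
  move=> t; rewrite ev_tmul /rest ev_tprod_at ev_tprod (bigD1 j)//=.
  rewrite {1}/chain2 ltnSn sin_ez ev_trigU (ev_trigG e1) (qcos_bsC e1).
  move: (\prod_(k < r | k != j) _) => P.
  rewrite /bsG /bsC; have := ez_neq0 (de j) t; move: (ez _ t) => w w0.
  by case: (e_cases e1) => ->; field.
move=> t rt; rewrite ev_tmul.
have -> : ev (tprod (chain2 e j.+1)) = fun u => \prod_(k < r) ev (chain2 e j.+1 k) u.
  by apply/funext => u; exact: ev_tprod.
rewrite (ev_tprod (chain2 e j)) -(bs_stage2 a_ge0 b_ge0 iota_ge0 e1 kappa j rt).
by rewrite /rest ev_tprod_at rmorphN mulrN mulNr.
Qed.

(** As [ops] applies the last entry first, the head of the list is the first operator to be moved to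
    the other side of the pairing. The decreasing second half matches the order in which [chain2]
    loses its factors. *)
Definition palindrome : seq ('I_r * R[i]) :=
  [seq (j, 'i%C * shift%:C) | j <- enum 'I_r]
  ++ [seq (j, - ('i%C * shift%:C)) | j <- rev (enum 'I_r)].

(** The product of the constants left by the two stages of index j; the sign of the second one is
    changed by i^2 = -1. *)
Definition bs_factor (j : 'I_r) : R :=
  (2 * (kappa + 1) + a * j%:R) *
  (2 * (kappa + 1) - 1 + iota + a * (r - j.+1)%:R + b * (1 - e)).

Lemma pairing_palindrome l :
  pairing (ev (ops palindrome l)) (ev (tprod (trigC e)))
  = (\prod_(j < r) bs_factor j)%:C * pairing (ev l) (ev trig1).
Proof.
have up n l' : (n <= r)%N ->
    pairing (ev (ops [seq (j, 'i%C * shift%:C) | j <- take n (enum 'I_r)] l'))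
      (ev (tprod (chain1 e 0)))
    = \prod_(j <- take n (enum 'I_r)) ('i%C * (2 * (kappa + 1) + a * j%:R)%:C)
      * pairing (ev l') (ev (tprod (chain1 e n))).
  elim: n l' => [|n IH] l' nr; first by rewrite take0 big_nil mul1r.
  pose j := Ordinal nr.
  have -> : take n.+1 (enum 'I_r) = rcons (take n (enum 'I_r)) j.
    by rewrite (take_nth j) ?size_enum_ord// (nth_ord_enum j j).
  rewrite map_rcons /ops foldr_rcons -/(ops _ _) IH ?(ltnW nr)// big_rcons /=.
  by rewrite (pairing_stage1 j); ring.
have down n l' : (n <= r)%N ->
    pairing (ev (ops [seq (j, - ('i%C * shift%:C)) | j <- rev (take n (enum 'I_r))] l'))
      (ev (tprod (chain2 e n)))
    = \prod_(j <- take n (enum 'I_r))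
        ('i%C * (1 - iota - 2 * (kappa + 1) - a * (r - j.+1)%:R - b * (1 - e))%:C)
      * pairing (ev l') (ev (tprod (chain2 e 0))).
  elim: n l' => [|n IH] l' nr; first by rewrite take0 big_nil mul1r.
  pose j := Ordinal nr.
  have -> : take n.+1 (enum 'I_r) = rcons (take n (enum 'I_r)) j.
    by rewrite (take_nth j) ?size_enum_ord// (nth_ord_enum j j).
  by rewrite rev_rcons /= big_rcons /= (pairing_stage2 j) IH ?(ltnW nr)//; ring.
have := up r (ops [seq (j, - ('i%C * shift%:C)) | j <- rev (enum 'I_r)] l) (leqnn r).
have e12 : (chain1 e r : 'I_r -> @trig_poly R r) = chain2 e r.
  by apply/funext => k; rewrite /chain1 /chain2 ltn_ord.
have := down r l (leqnn r).
rewrite take_oversize ?size_enum_ord// e12 => -> .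
rewrite /ops -foldr_cat -/(ops _ _) -/palindrome => H.
have -> : tprod (trigC e) = tprod (chain1 e 0) by [].
rewrite {}H mulrA !big_enum /= -big_split /= rmorph_prod; congr (_ * _).
  apply: eq_bigr => j _; rewrite /bs_factor !(rmorphD, rmorphM, rmorphN) /=.
  rewrite !rmorph1 !(rmorph_nat (real_complex R)); set x := _ * (_ + 1) + _.
  move: (@mulii R); set u := 'i%C => uu.
  set X := (X in u * _ * (u * X)).
  rewrite (_ : u * x * (u * X) = (u * u) * x * X); last by ring.
  by rewrite uu /X /x; ring.
apply: pairing_eq_reg => t rt; first by [].
by rewrite ev_tprod ev_trig1 big1// => k _; rewrite /chain2 ltn0 ev_trig1.
Qed.

End FixedKappa.

Definition cint kappa l : R[i] := cmean (fun t => ev l t * (weight a b iota e kappa 0 t)%:C).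

Lemma weightS kappa t : 0 <= kappa ->
  weight a b iota e (kappa + 1) 0 t = (\prod_(k < r) qcos e k t) * weight a b iota e kappa 0 t.
Proof.
move=> k0; rewrite /weight [RHS]mulrCA; congr (_ * _); rewrite -big_split /=.
apply: eq_bigr => j _; rewrite [RHS]mulrCA; congr (_ * _); rewrite addr0 mulrC.
have /andP[q0 _] := qcos_itv j t e1.
rewrite powRD; first by rewrite powRr1.
by apply/implyP; rewrite paddr_eq0// oner_eq0 andbF.
Qed.

Lemma cint_recurrence kappa l E : 0 <= kappa ->
  eq_reg (ev (ops (palindrome kappa) l)) (fun t => E * ev l t) ->
  (\prod_(j < r) bs_factor kappa j)%:C * cint kappa l = E * cint (kappa + 1) l.
Proof.
move=> k0 hE.
have -> : cint kappa l = pairing a b iota e kappa (ev l) (ev trig1).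
  by apply: cmean_ext => t; rewrite ev_trig1 conjc1 mulr1.
rewrite -pairing_palindrome//.
have hE' : eq_reg (ev (ops (palindrome kappa) l)) (ev (tscale E l)).
  by move=> t rt; rewrite ev_scale hE.
transitivity (pairing a b iota e kappa (ev (tscale E l)) (ev (tprod (trigC e)))).
  exact: (pairing_eq_reg e kappa hE' (fun t _ => erefl (ev (tprod (trigC e)) t))).
rewrite (pairing_scalel k0 E l).
have qE t : (ev (tprod (trigC e)) t)^* = (\prod_(k < r) qcos e k t)%:C.
  rewrite ev_tprod (rmorph_prod (@conjc R)) rmorph_prod; apply: eq_bigr => k _ /=.
  by rewrite (ev_trigC e1) -(qcos_bsC e1) conjc_real.
have -> // : pairing a b iota e kappa (ev l) (ev (tprod (trigC e))) = cint (kappa + 1) l.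
by apply: cmean_ext => t; rewrite qE weightS// -mulrA -rmorphM.
Qed.

(** All divided differences of a constant vanish, so that D_j acts on 1 by - i rho_j. This is the
    case m = 0 of the spectral equation, and it yields the recurrence of the masses. *)
Lemma palindrome_one kappa :
  eq_reg (ev (ops (palindrome kappa) trig1))
    (fun t => (\prod_(j < r) (shift kappa ^+ 2 - rho a b iota j ^+ 2))%:C * ev trig1 t).
Proof.
have one j c : eq_reg (ev (op (j, c) trig1)) (ev (tscale (c - 'i%C * (rho a b iota j)%:C) trig1)).
  move=> t rt; rewrite ev_op// ev_scale ev_trig1 /=.
  rewrite cherednikE.
  have -> : ev trig1 = fun u => \prod_(k < r) ev (@trig1 R r) u.
    by apply/funext => u; rewrite ev_trig1 big1// => k _; rewrite ev_trig1.
  have /is_partialC_val-> : is_partialC j (fun u => \prod_(k < r) ev (@trig1 R r) u) t 0.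
    rewrite (_ : (fun u => _) = fun=> 1); first exact: is_partialC_cst.
    by apply/funext => u; rewrite big1// => k _; rewrite ev_trig1.
  rewrite big1 => [|i _]; last by rewrite !big1 ?subrr ?mul0r ?mulr0// => k _; rewrite ev_trig1.
  by rewrite !big1 ?mulr1 ?add0r ?addr0; [ring|move=> k _; rewrite ev_trig1..].
have many s : eq_reg (ev (ops s trig1))
    (fun t => \prod_(x <- s) (x.2 - 'i%C * (rho a b iota x.1)%:C) * ev trig1 t).
  elim: s => [|[j c] s IH] t rt; first by rewrite big_nil mul1r.
  have IH' : eq_reg (ev (ops s trig1))
     (ev (tscale (\prod_(x <- s) (x.2 - 'i%C * (rho a b iota x.1)%:C)) trig1)).
    by move=> u ru; rewrite IH// ev_scale.
  have scale c0 : ev (op (j, c) (tscale c0 trig1)) t = c0 * ev (op (j, c) trig1) t.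
    by rewrite [LHS]ev_cat [X in c0 * X]ev_cat Dpoly_scale !ev_scale; ring.
  rewrite -[ops _ _]/(op (j, c) (ops s trig1)) (op_eq_reg a_ge0 b_ge0 iota_ge0 (j, c) IH')//.
  by rewrite scale one// ev_scale big_cons /=; ring.
move=> t rt; rewrite many//; congr (_ * _).
rewrite /palindrome big_cat /= !big_map big_rev !big_enum /= -big_split rmorph_prod.
apply: eq_bigr => j _ /=; rewrite rmorphB !rmorphXn /=.
move: (@mulii R); set u := 'i%C => uu; move: (shift _)%:C (rho _ _ _ _)%:C => x y.
apply/subr0_eq; transitivity ((1 + u * u) * (y ^+ 2 - x ^+ 2)); first by ring.
by rewrite uu subrr mul0r.
Qed.

End Recurrence.

(** * The spectral equation and the exponents of the Jacobi polynomials *)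

Import (canonicals) mpoly.

Section SpectralEquation.
Local Open Scope ring_scope.
Local Open Scope complex_scope.
Context {R : realType} {r : nat}.
Variables a b iota : R.
Hypotheses (a_ge0 : 0 <= a) (b_ge0 : 0 <= b) (iota_ge0 : 0 <= iota).
Implicit Types (F G : 'rV[R]_r -> R[i]) (t : 'rV[R]_r) (l : @trig_poly R r).
Implicit Types (k : mpoly.multinom r) (p q : mpoly.mpoly r R[i]).

Notation regular := (@regular R r a b iota).
Notation eq_reg := (@eq_reg R r a b iota).
Notation cherednik := (@cherednik R r a b iota).
Notation op := (@op R r a b iota).
Notation ops := (@ops R r a b iota).
Notation Dpoly := (@Dpoly R r a b iota).

Lemma ops_cat s1 s2 l : ops (s1 ++ s2) l = ops s1 (ops s2 l).
Proof. by rewrite /ops foldr_cat. Qed.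

Lemma ops_lin s l l1 l2 c : eq_reg (ev l) (fun t => ev l1 t + c * ev l2 t) ->
  eq_reg (ev (ops s l)) (fun t => ev (ops s l1) t + c * ev (ops s l2) t).
Proof.
move=> h.
have h' : eq_reg (ev l) (ev (l1 ++ tscale c l2)).
  by move=> t rt; rewrite ev_cat ev_scale h.
move=> t rt; rewrite (ops_eq_reg a_ge0 b_ge0 iota_ge0 s h')// {h h'}.
elim: s t rt => [|x s IH] t rt; first by rewrite /= ev_cat ev_scale.
have IH' : eq_reg (ev (ops s (l1 ++ tscale c l2))) (ev (ops s l1 ++ tscale c (ops s l2))).
  by move=> u ru; rewrite IH// ev_cat ev_scale.
rewrite -[ops (x :: s) _]/(op x (ops s _)) (op_eq_reg a_ge0 b_ge0 iota_ge0 x IH')//.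
rewrite /op !ev_cat !ev_scale Dpoly_cat Dpoly_scale !ev_cat !ev_scale; ring.
Qed.

Definition mono_ops (k : mpoly.multinom r) : seq ('I_r * R[i]) :=
  flatten [seq nseq (mpoly.fun_of_multinom k j) (j, 0) | j <- index_enum 'I_r].

Lemma cherednik_monomial_ops k F l : eq_reg F (ev l) ->
  eq_reg (cherednik_monomial a b iota k F) (ev (ops (mono_ops k) l)).
Proof.
move=> Fl; rewrite /cherednik_monomial /mono_ops.
elim: (index_enum 'I_r) => [|j s IH] /=; first by rewrite big_nil.
rewrite big_cons ops_cat /=.
elim: (mpoly.fun_of_multinom k j) => [|n IHn] //= t rt.
rewrite (cherednik_eq_reg a_ge0 b_ge0 iota_ge0 j IHn)// ev_op// mul0r addr0.
by [].
Qed.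

Lemma mono_opsD k j : perm_eq (mono_ops (mpoly.mnm_add k (mpoly.mnm1 j)))
  (rcons (mono_ops k) (j, 0)).
Proof.
apply/seq.permP => A; rewrite -cats1 count_cat /= addn0 /mono_ops !count_flatten.
rewrite !sumnE !big_map.
under eq_bigr do rewrite count_nseq mpoly.mnmDE mpoly.mnm1E mulnDr.
under [in RHS]eq_bigr do rewrite count_nseq.
rewrite big_split /=; congr (_ + _)%N.
rewrite (bigD1 j) //= eqxx muln1 big1 ?addn0// => i /negbTE ij.
by rewrite eq_sym ij muln0.
Qed.

(** The shape of [cherednik_poly] as a functional of the polynomial. The sum runs over the support,
    which may shrink under addition; linearity is therefore proved over a common larger index
    set. *)
Definition lin_ext (M : mpoly.multinom r -> R[i]) p : R[i] :=
  \sum_(k <- mpoly.msupp p) mpoly.mcoeff k p * M k.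

Lemma lin_ext_widen M p (s : seq (mpoly.multinom r)) :
  uniq s -> {subset mpoly.msupp p <= s} ->
  lin_ext M p = \sum_(k <- s) mpoly.mcoeff k p * M k.
Proof.
move=> us ps; rewrite (bigID (mem (mpoly.msupp p))) /= [X in _ + X]big1 ?addr0.
  rewrite -big_filter; apply: perm_big; apply: uniq_perm.
  - exact: mpoly.msupp_uniq.
  - exact: filter_uniq.
  by move=> k; rewrite mem_filter /=; case: (boolP (k \in _)) => // /ps->.
by move=> k kp; rewrite mpoly.memN_msupp_eq0// mul0r.
Qed.

Lemma lin_extD M p q : lin_ext M (p + q) = lin_ext M p + lin_ext M q.
Proof.
pose s := undup (mpoly.msupp (p + q) ++ mpoly.msupp p ++ mpoly.msupp q).
have us : uniq s by exact: undup_uniq.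
rewrite !(@lin_ext_widen M _ s)//; last 3 first.
- by move=> k kp; rewrite mem_undup !mem_cat kp !orbT.
- by move=> k kp; rewrite mem_undup !mem_cat kp !orbT.
- by move=> k kp; rewrite mem_undup !mem_cat kp.
by rewrite -big_split; apply: eq_bigr => k _; rewrite mpoly.mcoeffD mulrDl.
Qed.

Lemma lin_extZ M c p : lin_ext M (c *: p) = c * lin_ext M p.
Proof.
pose s := undup (mpoly.msupp (c *: p) ++ mpoly.msupp p).
have us : uniq s by exact: undup_uniq.
rewrite !(@lin_ext_widen M _ s)//; last 2 first.
- by move=> k kp; rewrite mem_undup !mem_cat kp !orbT.
- by move=> k kp; rewrite mem_undup !mem_cat kp.
by rewrite mulr_sumr; apply: eq_bigr => k _; rewrite mpoly.mcoeffZ mulrA.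
Qed.

Lemma lin_extX M k : lin_ext M (mpoly.mpolyX R[i] k) = M k.
Proof. by rewrite /lin_ext mpoly.msuppX big_seq1 mpoly.mcoeffX eqxx mul1r. Qed.

Variable lam : R.

Definition quad_poly (s : seq 'I_r) : mpoly.mpoly r R[i] :=
  \prod_(j <- s) (mpoly.mpolyX R[i] (mpoly.mnm1 j) ^+ 2 + mpoly.mpolyC r (lam ^+ 2)%:C).

Definition quad_ops (s : seq 'I_r) : seq ('I_r * R[i]) :=
  flatten [seq [:: (j, 'i%C * lam%:C); (j, - ('i%C * lam%:C))] | j <- s].

Lemma ops_quad j l : eq_reg (ev (ops [:: (j, 'i%C * lam%:C); (j, - ('i%C * lam%:C))] l))
  (fun t => ev (ops [:: (j, 0); (j, 0)] l) t + (lam ^+ 2)%:C * ev l t).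
Proof.
move=> t rt; rewrite /= /op !ev_cat !ev_scale !Dpoly_cat !Dpoly_scale !ev_cat !ev_scale.
rewrite rmorphXn /=; set u := 'i%C; set x := lam%:C.
apply/subr0_eq; transitivity (- (1 + u * u) * x ^+ 2 * ev l t); first by ring.
by rewrite mulii subrr oppr0 !mul0r.
Qed.

(** The monomial k is arbitrary so that the induction can move the factor X_j^2 of each quadratic
    into it; on the side of the operators this is a reordering, legitimate by commutation. *)
Lemma lin_ext_quad l s k t : regular t ->
  lin_ext (fun k => ev (ops (mono_ops k) l) t) (mpoly.mpolyX R[i] k * quad_poly s)
  = ev (ops (mono_ops k) (ops (quad_ops s) l)) t.
Proof.
move=> rt; elim: s k => [|j s IH] k; first by rewrite /quad_poly big_nil mulr1 lin_extX.
rewrite /quad_poly big_cons -/(quad_poly s).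
have -> : mpoly.mpolyX R[i] k
      * ((mpoly.mpolyX R[i] (mpoly.mnm1 j) ^+ 2 + mpoly.mpolyC r (lam ^+ 2)%:C) * quad_poly s)
    = mpoly.mpolyX R[i] (mpoly.mnm_add (mpoly.mnm_add k (mpoly.mnm1 j)) (mpoly.mnm1 j))
        * quad_poly s
      + (lam ^+ 2)%:C *: (mpoly.mpolyX R[i] k * quad_poly s).
  by rewrite !mpoly.mpolyXD -mpoly.mul_mpolyC; ring.
rewrite lin_extD lin_extZ !IH.
rewrite -[quad_ops (j :: s)]/([:: (j, 'i%C * lam%:C); (j, - ('i%C * lam%:C))] ++ quad_ops s).
rewrite ops_cat (ops_lin (mono_ops k) (ops_quad j (ops (quad_ops s) l)))//.
congr (_ + _).
rewrite (ops_perm a_ge0 b_ge0 iota_ge0 _ (mono_opsD _ j))// -cats1 ops_cat.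
rewrite (ops_perm a_ge0 b_ge0 iota_ge0 _ (mono_opsD _ j))// -cats1 !ops_cat.
by [].
Qed.

Lemma quad_ops_perm : perm_eq (quad_ops (enum 'I_r))
  ([seq (j, 'i%C * lam%:C) | j <- enum 'I_r]
   ++ [seq (j, - ('i%C * lam%:C)) | j <- rev (enum 'I_r)]).
Proof.
rewrite /quad_ops; move: (enum 'I_r) => s0; apply/seq.permP => A.
rewrite count_cat !count_map count_rev; elim: s0 => //= j s ->; lia.
Qed.

Lemma polyval_quad (x : 'rV[R[i]]_r) : polyval (quad_poly (enum 'I_r)) x
  = \prod_(j < r) (x 0 j ^+ 2 + (lam ^+ 2)%:C).
Proof.
rewrite /polyval /quad_poly rmorph_prod big_enum; apply: eq_bigr => j _ /=.
by rewrite rmorphD rmorphXn /= mpoly.mevalXU mpoly.mevalC.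
Qed.

Lemma weyl_act (F : numFieldType) (w : 'rV[F]_r -> 'rV[F]_r) : weyl a b iota w ->
  exists (s : {perm 'I_r}) (c : 'I_r -> bool), forall x, w x = act s c x.
Proof.
have step al : is_root a b iota al ->
    exists (s : {perm 'I_r}) (c : 'I_r -> bool), forall x : 'rV[F]_r, refl al x = act s c x.
  have pos be : pos_root a b iota be ->
      exists (s : {perm 'I_r}) (c : 'I_r -> bool), forall x : 'rV[F]_r, refl be x = act s c x.
    case=> [j k jk _|j k jk _|j _|j _].
    - by exists (tperm j k), (fun=> false) => x; rewrite refl_sub// neq_ltn jk.
    - exists (tperm j k), (fun i => (i == j) || (i == k)) => x.
      by rewrite refl_add// neq_ltn jk.
    - by exists 1%g, (pred1 j) => x; rewrite refl_eps.
    - by exists 1%g, (pred1 j) => x; rewrite reflZ ?refl_eps// pnatr_eq0.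
  by case=> [/pos//|/pos [s [c h]]]; exists s, c => x; rewrite -h reflN.
elim=> [|al {}w /step[s [c h]] _ [s' [c' h']]].
  exists 1%g, (fun=> false) => x; apply/rowP => j.
  by rewrite mxE perm1 expr0 mul1r.
exists (s * s')%g, (fun j => c j (+) c' (s j)) => x /=; rewrite h h'.
by apply/rowP => j; rewrite !mxE permM signr_addb mulrA.
Qed.

Lemma quad_poly_invariant : weyl_invariant a b iota (polyval (quad_poly (enum 'I_r))).
Proof.
move=> w /weyl_act[s [c h]] x; rewrite !polyval_quad h.
rewrite [RHS](reindex_inj (@perm_inj _ s)) /=; apply: eq_bigr => j _.
by rewrite mxE; case: (c j); rewrite ?expr1 ?expr0 ?mul1r// mulN1r sqrrN.
Qed.

Lemma spectral_quad (m : 'I_r -> int) :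
  polyval (quad_poly (enum 'I_r)) (spectral a b iota m)
  = (\prod_(j < r) (lam ^+ 2 - ((m j)%:~R + rho a b iota j) ^+ 2))%:C.
Proof.
rewrite polyval_quad rmorph_prod; apply: eq_bigr => j _.
rewrite mxE exprMn expr2 mulii /= rmorphB !rmorphXn /=; ring.
Qed.

Lemma jacobi_palindrome (m : 'I_r -> int) (phi : 'rV[R]_r -> R[i]) l :
  jacobi_polynomial a b iota m phi -> phi = ev l ->
  eq_reg (ev (ops ([seq (j, 'i%C * lam%:C) | j <- enum 'I_r]
      ++ [seq (j, - ('i%C * lam%:C)) | j <- rev (enum 'I_r)]) l))
    (fun t => (\prod_(j < r) (lam ^+ 2 - ((m j)%:~R + rho a b iota j) ^+ 2))%:C * ev l t).
Proof.
move=> [_ _ /(_ _ quad_poly_invariant) h _] phiE t rt.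
rewrite -spectral_quad -phiE -h// -(ops_perm a_ge0 b_ge0 iota_ge0 l quad_ops_perm rt).
have := lin_ext_quad l (enum 'I_r) mpoly.mnm0 rt; rewrite mpoly.mpolyX0 mul1r.
have -> : mono_ops mpoly.mnm0 = [::].
  rewrite /mono_ops; elim: (index_enum _) => //= j s ->.
  by rewrite mpoly.mnm0E.
move=> <-; apply: eq_bigr => k _; congr (_ * _); apply/esym.
by apply: cherednik_monomial_ops => // u _; rewrite phiE.
Qed.

End SpectralEquation.

(** * Integrality and parity of the exponents *)

Section Exponents.
Local Open Scope ring_scope.
Local Open Scope complex_scope.
Context {R : realType} {r : nat}.
Variables a b iota : R.
Implicit Types (t : 'rV[R]_r) (l : @trig_poly R r) (v : 'rV[int]_r).

Notation de i := (delta_mx 0 i : 'rV[int]_r).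
Notation toR v := (map_mx intr v : 'rV[R]_r).

(** The parity is the point: when b = 0 the short roots are absent and all roots have an even sum of
    coordinates. *)
Lemma pos_root_int (al : 'rV[R]_r) : pos_root a b iota al ->
  exists2 v, al = toR v & b = 0 -> exists q : int, \sum_j v 0 j = 2 * q.
Proof.
have sum_de (k : 'I_r) : \sum_j de k 0 j = 1.
  rewrite (bigD1 k) //= big1 => [|i ik]; first by rewrite mxE !eqxx addr0.
  by rewrite mxE (negbTE ik) andbF.
have epsE k : eps k = toR (de k).
  by apply/rowP => i; rewrite !mxE; case: (_ && _).
case=> [j k jk _|j k jk _|j b0|j _].
- exists (de j - de k); first by rewrite raddfB !epsE.
  by exists 0; under eq_bigr do rewrite mxE [X in _ + X]mxE; rewrite sumrB !sum_de.
- exists (de j + de k); first by rewrite raddfD !epsE.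
  by exists 1; under eq_bigr do rewrite mxE; rewrite big_split /= !sum_de.
- by exists (de j) => [|b0']; [rewrite epsE|rewrite b0' eqxx in b0].
- exists (de j + de j); first by rewrite raddfD /= epsE mulr2n scalerDl scale1r.
  by exists 1; under eq_bigr do rewrite mxE; rewrite big_split /= !sum_de.
Qed.

Lemma dominated_int (m : 'I_r -> int) (mu : 'rV[R]_r) :
  (forall j, (2 %| m j)%Z) -> dominated a b iota (int_vec m) mu ->
  exists2 v, mu = 2 *: toR v &
    b = 0 -> exists q : int, \sum_j v 0 j = \sum_j (m j %/ 2)%Z + 2 * q.
Proof.
move=> m2; elim=> [|al {}mu /pos_root_int[v -> vq] _ [w -> wq]].
  exists (\row_j (m j %/ 2)%Z); last first.
    by exists 0; rewrite addr0; apply: eq_bigr => j _; rewrite mxE.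
  by apply/rowP => j; rewrite !mxE -[in LHS](divzK (m2 j)) intrM mulrC.
exists (w - v); first by rewrite raddfB scalerBr.
move=> b0; have [q hq] := vq b0; have [p hp] := wq b0; exists (p - q).
under eq_bigr do rewrite mxE [X in _ + X]mxE.
by rewrite sumrB hq hp; ring.
Qed.

Lemma jacobi_trig_poly (m : 'I_r -> int) (phi : 'rV[R]_r -> R[i]) :
  (forall j, (2 %| m j)%Z) -> jacobi_polynomial a b iota m phi ->
  exists2 l, phi = ev l & b = 0 -> forall x, x \in l ->
    exists q : int, \sum_j x.2 0 j = \sum_j (m j %/ 2)%Z + 2 * q.
Proof.
move=> m2 [_ [s [c [[_ _ phiE] _ _ sm]]] _ _].
suff [l lE lq] : exists2 l, (forall t, \sum_(mu <- s) c mu * expi (dot mu t) = ev l t) &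
    b = 0 -> forall x, x \in l ->
      exists q : int, \sum_j x.2 0 j = \sum_j (m j %/ 2)%Z + 2 * q.
  by exists l => //; apply/funext => t; rewrite phiE lE.
elim: s sm {phiE} => [|mu s IH] sm.
  by exists [::] => // t; rewrite big_nil ev_nil.
have [l lE lq] := IH (fun mu' h => sm mu' (mem_behead (s := mu :: s) h)).
have [v muE vq] := dominated_int m2 (sm mu (mem_head _ _)).
exists ((c mu, v) :: l) => [t|b0 x].
  rewrite big_cons ev_cons lE /=; congr (_ * _ + _); rewrite muE /ez.
  congr expi; rewrite /dot /dz mulr_sumr; apply: eq_bigr => j _.
  by rewrite !mxE mulrA.
by rewrite inE => /orP[/eqP->|/(lq b0)//]; exact: vq.
Qed.

Lemma expi_pi_int (n : int) : expi (pi * n%:~R) = (-1) ^ n :> R[i].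
Proof.
have nat k : expi (pi * k%:R) = (-1) ^+ k :> R[i].
  elim: k => [|k IH]; first by rewrite mulr0 expi0.
  rewrite -natr1 mulrDr mulr1 expiD IH exprS mulrC; congr (_ * _).
  by apply/eqP; rewrite eq_complex /= cospi sinpi oppr0 !eqxx.
case: n => n; first by rewrite -pmulrn nat.
rewrite NegzE mulrNz mulrN -expi_conj -pmulrn nat.
rewrite -exprnN -exprVn invrN1.
elim: n.+1 => [|k IH]; first by apply/eqP; rewrite eq_complex /= oppr0 !eqxx.
rewrite exprS conjcM IH; congr (_ * _).
by apply/eqP; rewrite eq_complex /= !oppr0 !eqxx.
Qed.

(** At (pi/2, ..., pi/2) the exponential of v equals -1 to the power of the sum of the coordinates
    of v. For b = 0 all exponents of phi have this sum of the same parity, so phi takes there the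
    value phi(0) = 1 up to one common sign. *)
Lemma jacobi_half_pi (m : 'I_r -> int) (phi : 'rV[R]_r -> R[i]) :
  (forall j, (2 %| m j)%Z) -> jacobi_polynomial a b iota m phi -> b = 0 ->
  phi half_pi_vec = \prod_(j < r) (-1) ^ (m j %/ 2)%Z.
Proof.
move=> m2 hphi b0; have [l phiE lq] := jacobi_trig_poly m2 hphi.
have [_ _ _ phi0] := hphi.
have n1 : -1 != 0 :> R[i] by rewrite oppr_eq0 oner_eq0.
have prodE : \prod_(j < r) (-1) ^ (m j %/ 2)%Z = (-1) ^ (\sum_j (m j %/ 2)%Z) :> R[i].
  elim/big_rec2: _ => [|j x y _ ->]; first by rewrite expr0z.
  by rewrite expfzDr.
rewrite prodE phiE.
have -> : ev l half_pi_vec = (-1) ^ (\sum_j (m j %/ 2)%Z) * ev l 0.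
  rewrite /ev mulr_sumr [LHS]big_seq [RHS]big_seq; apply: eq_bigr => x xl.
  have [q hq] := lq b0 x xl.
  have -> : ez x.2 (0 : 'rV[R]_r) = 1.
    by rewrite /ez /dz big1 ?mulr0 ?expi0// => j _; rewrite mxE mulr0.
  have -> : ez x.2 (half_pi_vec : 'rV[R]_r) = (-1) ^ (\sum_j x.2 0 j).
    rewrite -expi_pi_int /ez; congr expi; rewrite rmorph_sum /dz !mulr_sumr.
    by apply: eq_bigr => j _; rewrite mxE; field.
  have sq : (-1) ^ 2 = 1 :> R[i] by rewrite -exprnP sqrrN expr1n.
  by rewrite hq expfzDr// -exprz_exp sq exp1rz !mulr1 mulrC.
by rewrite -phiE phi0 mulr1.
Qed.

End Exponents.

(** * Concentration of the weight for a large exponent *)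

Section Concentration.
Local Open Scope classical_set_scope.
Local Open Scope ring_scope.
Local Open Scope complex_scope.
Context {R : realType} {r : nat}.
Variables a b iota e : R.
Hypotheses (a_ge0 : 0 <= a) (b_ge0 : 0 <= b) (iota_ge0 : 0 <= iota).
Hypothesis (e1 : e = 1 \/ e = -1).
Implicit Types (F G : 'rV[R]_r -> R[i]) (t : 'rV[R]_r) (l : @trig_poly R r).
Implicit Types (mu nu : 'rV[int]_r).

Notation de i := (delta_mx 0 i : 'rV[int]_r).
Notation W kappa := (@weight R r a b iota e kappa 0).
Notation cint := (@cint R r a b iota e).

Lemma ratio_cvg1 (u v : R) : (n%:R + u) / (n%:R + v) @[n --> \oo] --> (1 : R).
Proof.
apply/cvgrPdist_lt => eps eps0; near=> n.
have nv : (`|u - v| + 1) / eps < n%:R + v.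
  have : (`|u - v| + 1) / eps + `|v| + 1 <= n%:R by near: n; exact: nbhs_infty_ger.
  by have := ler_norm (- v); rewrite normrN; lra.
have nv0 : 0 < n%:R + v by apply: lt_trans nv; rewrite divr_gt0// ltr_wpDl.
have -> : 1 - (n%:R + u) / (n%:R + v) = (v - u) / (n%:R + v) by field; rewrite gt_eqF.
rewrite normrM normfV (gtr0_norm nv0) distrC ltr_pdivrMr//.
rewrite mulrC -ltr_pdivrMr//; apply: lt_trans nv; rewrite ltr_pM2r ?invr_gt0//.
by rewrite ltrDl.
Unshelve. all: by end_near.
Qed.

Lemma cvg_prod1 (I : Type) (s : seq I) (f : I -> nat -> R) :
  (forall i, f i n @[n --> \oo] --> (1 : R)) ->
  \prod_(i <- s) f i n @[n --> \oo] --> (1 : R).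
Proof.
move=> h; elim: s => [|i s IH].
  by under eq_fun do rewrite big_nil; exact: cvg_cst.
under eq_fun do rewrite big_cons.
by have h1 := cvgM (h i) IH; rewrite mulr1 in h1; exact: h1.
Qed.

Lemma weight_gt0_somewhere (kappa : R) : exists t0, 0 < W kappa t0.
Proof.
have r0 : 0 < r.+1%:R :> R by rewrite ltr0n.
have p0 := pi_gt0 R.
(* The coordinates are distinct and lie strictly between 0 and pi / 4; thus their differences, sums
   and doubles are nonzero and of absolute value less than pi, and no sine or cosine involved
   vanishes. *)
pose t0 : 'rV[R]_r := \row_j (pi / 4 * (j.+1%:R / r.+1%:R)).
have t0_itv j : 0 < t0 0 j < pi / 4.
  rewrite mxE; apply/andP; split; first by rewrite !mulr_gt0// ?invr_gt0 ?ltr0n.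
  rewrite -[ltRHS]mulr1 ltr_pM2l ?divr_gt0// ltr_pdivrMr// mul1r ltr_nat ltnS.
  exact: ltn_ord.
have dist i k : i != k -> t0 0 i != t0 0 k.
  apply: contra => /eqP; rewrite !mxE.
  move=> /(mulfI (lt0r_neq0 (divr_gt0 p0 (ltr0n R 4)))).
  move=> /(mulIf (invr_neq0 (lt0r_neq0 r0)))/eqP; rewrite eqr_nat => /eqP[ik].
  exact/eqP/val_inj.
have sin0 x : - pi < x < pi -> x != 0 -> sin x != 0.
  move=> /andP[h1 h2]; rewrite neq_lt => /orP[x0|x0]; last first.
    by rewrite gt_eqF// sin_gt0_pi// x0.
  by rewrite -oppr_eq0 -sinN gt_eqF// sin_gt0_pi//; apply/andP; split; lra.
have q_neq0 al : - pi < dz al t0 < pi -> dz al t0 != 0 -> qroot al t0 != 0.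
  by move=> h1 h2; rewrite qroot_eq0 /ez expi_eq1 sin0.
exists t0; rewrite lt_neqAle weight_ge0// andbT eq_sym mulf_neq0//.
  apply/prodf_neq0 => i _; apply/prodf_neq0 => k ki.
  have /andP[i1 i2] := t0_itv i; have /andP[k1 k2] := t0_itv k.
  have ik : t0 0 i - t0 0 k != 0 by rewrite subr_eq0 dist// eq_sym.
  have ikD : t0 0 i + t0 0 k != 0 by rewrite gt_eqF// addr_gt0.
  rewrite mulf_neq0// powR_eq0 addr0 negb_and q_neq0//.
  - by rewrite dz_deB; apply/andP; split; lra.
  - by rewrite dz_deB.
  - by rewrite dz_deD; apply/andP; split; lra.
  - by rewrite dz_deD.
apply/prodf_neq0 => i _; have /andP[i1 i2] := t0_itv i.
have i0 : t0 0 i != 0 by rewrite gt_eqF.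
rewrite !mulf_neq0// powR_eq0 addr0 negb_and.
- by rewrite q_neq0// dz_delta//; apply/andP; split; lra.
- rewrite q_neq0// mulr2n dzD !dz_delta; first by apply/andP; split; lra.
  by rewrite gt_eqF// addr_gt0.
suff -> : qcos e i t0 != 0 by [].
rewrite /qcos dz_delta mulf_neq0//; have c1 : 0 < cos (t0 0 i).
  by rewrite cos_gt0_pihalf//; apply/andP; split; lra.
have s1 : 0 < sin (t0 0 i) by rewrite sin_gt0_pi//; apply/andP; split; lra.
rewrite mulr_natl cos_mulr2n gt_eqF//.
have := cos2Dsin2 (t0 0 i); case: e1 => ->; nra.
Qed.

Definition nsq (x : R[i]) : R := complex.Re x ^+ 2 + complex.Im x ^+ 2.

Lemma nsqM x y : nsq (x * y) = nsq x * nsq y.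
Proof. by case: x => x1 x2; case: y => y1 y2; rewrite /nsq /=; ring. Qed.

Lemma nsqD x y : nsq (x + y) <= 2 * (nsq x + nsq y).
Proof.
case: x => x1 x2; case: y => y1 y2; rewrite /nsq /=.
by have := sqr_ge0 (x1 - y1); have := sqr_ge0 (x2 - y2); rewrite !sqrrB !sqrrD; lra.
Qed.

Lemma nsq_ge0 x : 0 <= nsq x.
Proof. by rewrite addr_ge0 ?sqr_ge0. Qed.

Lemma nsq_conj x : nsq x^* = nsq x.
Proof. by case: x => x y; rewrite /nsq /= sqrrN. Qed.

Lemma nsq_ez mu t : nsq (ez mu t) = 1.
Proof. by rewrite /nsq /ez /= cos2Dsin2. Qed.

(** Its integral against the weight of exponent kappa is [mass kappa - mass (kappa + 1)], which
    turns pointwise bounds by the defect into bounds by differences of masses. *)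
Definition defect t : R := 1 - \prod_(j < r) qcos e j t.

Lemma defect_ge0 t : 0 <= defect t.
Proof.
rewrite subr_ge0; apply: prodr_ile1 => j _; exact: qcos_itv.
Qed.

Lemma defect_ge j t : 1 - qcos e j t <= defect t.
Proof.
rewrite lerB// (bigD1 j)//= -[leRHS]mulr1.
have /andP[q0 _] := qcos_itv j t e1.
by rewrite ler_wpM2l// prodr_ile1// => k _; exact: qcos_itv.
Qed.

Definition close F G : Prop := exists2 B, 0 <= B &
  forall t, nsq (F t - G t) <= B * defect t.

Variable p0 : 'rV[R]_r.
Hypothesis ez_p0 : forall j, ez (de j) p0 = e%:C.

(** The point p0 is where all [qcos] equal 1: the origin for e = 1, and (pi/2, ..., pi/2) for e =
    -1. For a basis vector |ez - e|^2 = 4 (1 - qcos) exactly; other exponents follow by products and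
    conjugation, as exponentials have modulus 1. *)
Lemma close_ez mu : close (ez mu) (fun=> ez mu p0).
Proof.
have gen : forall j, close (ez (de j)) (fun=> ez (de j) p0).
  move=> j; exists 4 => // t; rewrite ez_p0.
  apply: (@le_trans _ _ (4 * (1 - qcos e j t))); last by rewrite ler_wpM2l// defect_ge.
  rewrite /nsq /ez /qcos /= subr0.
  have := cos2Dsin2 (2 * dz (de j) t).
  by case: e1 => ->; move: (cos _) (sin _) => c s; rewrite !expr2; lra.
have add mu1 mu2 : close (ez mu1) (fun=> ez mu1 p0) -> close (ez mu2) (fun=> ez mu2 p0) ->
    close (ez (mu1 + mu2)) (fun=> ez (mu1 + mu2) p0).
  move=> [B1 B10 h1] [B2 B20 h2]; exists (2 * (B1 + B2)) => [|t].
    by rewrite mulr_ge0// addr_ge0.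
  rewrite !ezD (_ : _ - _ = (ez mu1 t - ez mu1 p0) * ez mu2 t
    + ez mu1 p0 * (ez mu2 t - ez mu2 p0)); last by ring.
  apply: le_trans (nsqD _ _) _; rewrite !nsqM !nsq_ez mulr1 mul1r.
  by rewrite -mulrA ler_wpM2l// mulrDl lerD.
have opp mu1 : close (ez mu1) (fun=> ez mu1 p0) -> close (ez (- mu1)) (fun=> ez (- mu1) p0).
  move=> [B1 B10 h1]; exists B1 => // t.
  have -> : ez (- mu1) t - ez (- mu1) p0 = (ez mu1 t - ez mu1 p0)^*.
    by rewrite conjcD conjcN !ezN.
  by rewrite nsq_conj.
have zero : close (ez 0) (fun=> ez 0 p0).
  by exists 0 => // t; rewrite !ez0 subrr /nsq /= expr0n addr0 mul0r.
have -> : mu = \sum_j de j *~ mu 0 j.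
  apply/rowP => k; rewrite summxE (bigD1 k) //= big1 => [|j jk].
    by rewrite mulmz_coord mxE !eqxx mul1r addr0.
  by rewrite mulmz_coord mxE eq_sym (negbTE jk) andbF mul0r.
elim/big_ind: _ => // j _; have nat n : close (ez (de j *+ n)) (fun=> ez (de j *+ n) p0).
  by elim: n => [|n IH]; rewrite ?mulr0n// mulrS; exact: add.
by case: (mu 0 j) => n; [exact: nat|rewrite NegzE mulrNz; exact/opp/nat].
Qed.

Lemma close_ev l : close (ev l) (fun=> ev l p0).
Proof.
elim: l => [|[c mu] l [B1 B10 h1]].
  by exists 0 => // t; rewrite !ev_nil subrr /nsq /= expr0n addr0 mul0r.
have [B2 B20 h2] := close_ez mu; exists (2 * (nsq c * B2 + B1)) => [|t].
  by rewrite mulr_ge0// addr_ge0// mulr_ge0// nsq_ge0.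
rewrite !ev_cons /= (_ : _ - _ = c * (ez mu t - ez mu p0) + (ev l t - ev l p0)); last by ring.
apply: le_trans (nsqD _ _) _; rewrite nsqM -[leRHS]mulrA ler_wpM2l// [leRHS]mulrDl lerD//.
by rewrite -mulrA ler_wpM2l// nsq_ge0.
Qed.

(** Either |x| <= eta, or |x| <= x^2 / eta. This replaces a square root of the defect by a bound
    that is affine in the defect and can be integrated. *)
Lemma close_real (f : 'rV[R]_r -> R) (f0 B eta : R) : 0 < eta -> 0 <= B ->
  (forall t, (f t - f0) ^+ 2 <= B * defect t) ->
  forall t, `|f t - f0| <= eta + B / eta * defect t.
Proof.
move=> eta0 B0 h t; have := h t; set x := f t - f0 => hx.
have Be : 0 <= B / eta * defect t by rewrite mulr_ge0 ?defect_ge0// divr_ge0// ltW.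
have [xe|ex] := leP `|x| eta; first by rewrite (le_trans xe)// lerDl.
apply: (@le_trans _ _ (B / eta * defect t)); last by rewrite lerDr ltW.
rewrite mulrAC ler_pdivlMr//; apply: le_trans hx.
by rewrite -[leRHS]real_normK ?num_real// expr2 ler_wpM2l// ltW.
Qed.

Lemma mean_close (f : 'rV[R]_r -> R) (f0 C eta kappa L n0 n1 : R) : 0 <= kappa ->
  (forall t, `|f t - f0| <= eta + C * defect t) ->
  gmean n.+1 (fun t => f t * W kappa t) @[n --> \oo] --> L ->
  gmean n.+1 (W kappa) @[n --> \oo] --> n0 ->
  gmean n.+1 (W (kappa + 1)) @[n --> \oo] --> n1 ->
  `|L - f0 * n0| <= eta * n0 + C * (n0 - n1).
Proof.
move=> k0 h hL h0 h1.
have bound n : `|gmean n.+1 (fun t => f t * W kappa t) - f0 * gmean n.+1 (W kappa)|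
    <= eta * gmean n.+1 (W kappa) + C * (gmean n.+1 (W kappa) - gmean n.+1 (W (kappa + 1))).
  have pt t : `|f t * W kappa t - f0 * W kappa t|
      <= eta * W kappa t + C * (W kappa t - W (kappa + 1) t).
    have W0 : 0 <= W kappa t by exact: weight_ge0.
    rewrite weightS// -mulrBl normrM (ger0_norm W0).
    by have := ler_wpM2r W0 (h t); rewrite /defect; lra.
  rewrite -!gmeanZ -!gmeanB -gmeanZ -gmeanD ler_norml -gmeanN.
  apply/andP; split; apply: le_gmean => t; have := pt t; rewrite ler_norml => /andP[] //.
have c1 : `|gmean n.+1 (fun t => f t * W kappa t) - f0 * gmean n.+1 (W kappa)|
    @[n --> \oo] --> `|L - f0 * n0|.
  by apply: cvg_norm; apply: cvgB => //; apply: cvgMr.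
have c2 : eta * gmean n.+1 (W kappa)
      + C * (gmean n.+1 (W kappa) - gmean n.+1 (W (kappa + 1)))
    @[n --> \oo] --> eta * n0 + C * (n0 - n1).
  by apply: cvgD; apply: cvgMr => //; exact: cvgB.
by apply: ler_cvg_to c1 c2 _; near=> n; exact: bound.
Unshelve. all: by end_near.
Qed.

Definition mass (kappa : R) : R := complex.Re (cint kappa trig1).

Lemma cnice_cint l (kappa : R) : 0 <= kappa -> cnice (fun t => ev l t * (W kappa t)%:C).
Proof.
move=> k0; apply: cniceM (cnice_ev l) _.
by apply: cnice_real; [exact: weight0_ucont|exact: weight_periodic].
Qed.

Lemma mass_cvg (kappa : R) : 0 <= kappa -> gmean n.+1 (W kappa) @[n --> \oo] --> mass kappa.
Proof.
move=> k0; have [h _] := cmeanP (cnice_cint trig1 k0).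
apply: cvg_trans h; apply: near_eq_cvg; apply: nearW => n.
by apply: gmean_ext => t; rewrite ev_trig1 mul1r.
Qed.

Lemma mass_gt0 (kappa : R) : 0 <= kappa -> 0 < mass kappa.
Proof.
move=> k0; have [t0 W0] := weight_gt0_somewhere kappa.
apply: (gmean_lim_gt0 _ _ _ W0) (mass_cvg k0).
- exact: weight0_ucont.
- exact: weight_periodic.
- by move=> t; exact: weight_ge0.
Qed.

Definition gap_factor (kappa : R) (j : 'I_r) : R :=
  @shift R r a b iota kappa ^+ 2 - rho a b iota j ^+ 2.

Lemma gap_factorE (kappa : R) j : gap_factor kappa j = (2 * (kappa + 1) + a * j%:R)
  * (2 * (kappa + 1) + 2 * iota + 2 * b + a * (r - 1)%:R + a * (r - j.+1)%:R).
Proof. by rewrite /gap_factor /shift /rho (natr_rank R j); ring. Qed.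

Lemma mass_recurrence (kappa : R) : 0 <= kappa ->
  (\prod_(j < r) bs_factor a b iota e kappa j) * mass kappa
    = (\prod_(j < r) gap_factor kappa j) * mass (kappa + 1).
Proof.
move=> k0.
have := @cint_recurrence R r a b iota e a_ge0 b_ge0 iota_ge0 e1 kappa _ _ k0
  (palindrome_one a_ge0 b_ge0 iota_ge0 kappa).
rewrite /mass; move: (cint kappa trig1) (cint (kappa + 1) trig1) => x y h.
by rewrite -complex_ReZ h complex_ReZ.
Qed.

(** By the recurrence of the masses, the ratio is the product of [bs_factor / gap_factor]. The
    factor 2 (kappa + 1) + a j is common to both, and halving what remains gives quotients of the
    form (n + u_j) / (n + v_j). *)
Lemma mass_ratio_cvg (kappa : R) : 0 <= kappa ->
  mass (kappa + n%:R + 1) / mass (kappa + n%:R) @[n --> \oo] --> (1 : R).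
Proof.
move=> k0.
pose u (j : 'I_r) : R := kappa + 1 + (iota - 1 + a * (r - j.+1)%:R + b * (1 - e)) / 2.
pose v (j : 'I_r) : R := kappa + 1 + (2 * iota + 2 * b + a * (r - 1)%:R + a * (r - j.+1)%:R) / 2.
have := cvg_prod1 (index_enum 'I_r) (fun j => ratio_cvg1 (u j) (v j)).
apply: cvg_trans; apply: near_eq_cvg; apply: nearW => n /=.
have kn : 0 <= kappa + n%:R by rewrite addr_ge0.
have m0 := mass_gt0 kn; have m1 := mass_gt0 (addr_ge0 kn ler01).
have an (k : nat) : 0 <= a * k%:R by rewrite mulr_ge0.
have g1 j : 0 < n%:R + v j.
  rewrite ltr_wpDl// ltr_pwDl ?ltr_wpDl// divr_ge0// !addr_ge0 ?an//.
  by rewrite mulr_ge0.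
  by rewrite mulr_ge0.
have g2 j : 0 < 2 * (kappa + n%:R + 1) + a * j%:R.
  by rewrite ltr_pwDl// mulr_gt0// ltr_wpDl.
have gE j : gap_factor (kappa + n%:R) j = (2 * (kappa + n%:R + 1) + a * j%:R) * (2 * (n%:R + v j)).
  by rewrite gap_factorE /v; field.
have gap0 : \prod_(j < r) gap_factor (kappa + n%:R) j != 0.
  by apply/prodf_neq0 => j _; rewrite gE !mulf_neq0// ?gt_eqF// pnatr_eq0.
have bE j : bs_factor a b iota e (kappa + n%:R) j
    = gap_factor (kappa + n%:R) j * ((n%:R + u j) / (n%:R + v j)).
  rewrite gE /bs_factor /u; move: (g1 j); set w := n%:R + v j => w0.
  by field; rewrite gt_eqF.
have := mass_recurrence kn; rewrite (eq_bigr _ (fun j _ => bE j)) big_split /=.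
move: (mass _) (mass _) m0 m1 => x y x0 y0.
by rewrite -mulrA => /(mulfI gap0) <-; rewrite mulfK// gt_eqF.
Qed.

Lemma ratio_dist (f0 L M M' eta C : R) : 0 < M -> 0 <= C -> 0 < eta ->
  `|L - f0 * M| <= eta * M + C * (M - M') -> `|1 - M' / M| < eta / (C + 1) ->
  `|f0 - L / M| < 2 * eta.
Proof.
move=> M0 C0 eta0 h; have C1 : 0 < C + 1 by lra.
rewrite ltr_pdivlMr// => q.
have -> : f0 - L / M = - (L - f0 * M) / M by field; rewrite gt_eqF.
rewrite normrM normrN normfV (gtr0_norm M0) ltr_pdivrMr//; apply: le_lt_trans h _.
have -> : M - M' = (1 - M' / M) * M by field; rewrite gt_eqF.
rewrite mulrA -mulrDl ltr_pM2r// [ltRHS]mulr_natl mulr2n ltrD2l.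
have := normr_ge0 (1 - M' / M); have := ler_norm (1 - M' / M).
move: q; move: `|_| => x q h x0.
apply: le_lt_trans (ler_wpM2l C0 h) _; move: q; rewrite mulrDr mulr1 mulrC; lra.
Qed.

(** A Chebyshev argument: for fixed eta the error is at most eta + (B / eta) (1 - M' / M), where M
    and M' are consecutive masses, and M' / M tends to 1. *)
Lemma concentration (f : 'rV[R]_r -> R) (f0 B : R) (L : nat -> R) (kappa : R) : 0 <= kappa ->
  0 <= B -> (forall t, (f t - f0) ^+ 2 <= B * defect t) ->
  (forall n, gmean k.+1 (fun t => f t * W (kappa + n%:R) t) @[k --> \oo] --> L n) ->
  L n / mass (kappa + n%:R) @[n --> \oo] --> f0.
Proof.
move=> k0 B0 hf hL; apply/cvgrPdist_lt => eps eps0.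
have eta0 : 0 < eps / 2 by rewrite divr_gt0.
have C0 : 0 <= B / (eps / 2) by rewrite divr_ge0// ltW.
near=> n.
have kn : 0 <= kappa + n%:R by rewrite addr_ge0.
have -> : eps = 2 * (eps / 2) by field.
apply: (ratio_dist (mass_gt0 kn) C0 eta0).
  exact: mean_close kn (close_real eta0 B0 hf) (hL n) (mass_cvg kn) (mass_cvg (addr_ge0 kn ler01)).
near: n; have /cvgrPdist_lt := mass_ratio_cvg k0; apply.
by rewrite divr_gt0// ltr_wpDl.
Unshelve. all: by end_near.
Qed.

Lemma cint_concentration l (kappa : R) : 0 <= kappa ->
  complex.Re (cint (kappa + n%:R) l) / mass (kappa + n%:R) @[n --> \oo] --> complex.Re (ev l p0)
  /\ complex.Im (cint (kappa + n%:R) l) / mass (kappa + n%:R) @[n --> \oo] --> complex.Im (ev l p0).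
Proof.
move=> k0; have [B B0 hB] := close_ev l.
have kn n : 0 <= kappa + n%:R :> R by rewrite addr_ge0.
split.
  apply: (@concentration (fun t => complex.Re (ev l t)) _ B) => // [t|n].
    by have := hB t; apply: le_trans; rewrite /nsq complex_ReD complex_ReN lerDl sqr_ge0.
  have [h _] := cmeanP (cnice_cint l (kn n)).
  apply: cvg_trans h; apply: near_eq_cvg; apply: nearW => k.
  by apply: gmean_ext => t; rewrite mulrC complex_ReZ mulrC.
apply: (@concentration (fun t => complex.Im (ev l t)) _ B) => // [t|n].
  by have := hB t; apply: le_trans; rewrite /nsq complex_ImD complex_ImN lerDr sqr_ge0.
have [_ h] := cmeanP (cnice_cint l (kn n)).
apply: cvg_trans h; apply: near_eq_cvg; apply: nearW => k.
by apply: gmean_ext => t; rewrite mulrC complex_ImZ mulrC.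
Qed.

End Concentration.

(** * Solution of the recurrence *)

Section Pochhammer.
Local Open Scope classical_set_scope.
Local Open Scope ring_scope.
Local Open Scope complex_scope.
Context {R : realType}.
Implicit Types (x y : R) (k : int).

Lemma prod_addn_shift x n :
  \prod_(i < n) (x + i%:R) * (x + n%:R) = x * \prod_(i < n) (x + 1 + i%:R) :> R.
Proof.
rewrite -(big_ord_recr n (fun i => x + i%:R)) big_ord_recl /= addr0; congr (_ * _).
by apply: eq_bigr => i _; rewrite /bump /= add1n -natr1; ring.
Qed.

Lemma prod_sub_rev x n :
  \prod_(i < n) (x + n%:R - i.+1%:R) = \prod_(i < n) (x + i%:R) :> R.
Proof.
rewrite [RHS](reindex_inj rev_ord_inj); apply: eq_bigr => i _ /=.
by rewrite natrB// addrA.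
Qed.

Lemma poch_num x k : 0 < x ->
  poch (x - k%:~R) k * x = (x - k%:~R) * poch (x + 1 - k%:~R) k.
Proof.
move=> x0; case: k => n /=.
  have := prod_addn_shift (x - n%:~R) n; rewrite -pmulrn subrK => ->.
  by congr (_ * _); apply: eq_bigr => i _; ring.
rewrite NegzE mulrNz !opprK -pmulrn !prod_sub_rev.
have h := prod_addn_shift x n.+1.
have p1 y : 0 < y -> \prod_(i < n.+1) (y + i%:R) != 0.
  by move=> y0; apply/prodf_neq0 => i _; rewrite gt_eqF// ltr_wpDr.
have := p1 x x0; have := p1 (x + 1) (addr_gt0 x0 ltr01).
move: h; move: (\prod_(i < _) _) (\prod_(i < _) _) => p q h p0 q0.
apply: (mulfI q0); rewrite !mulrA mulfV// mul1r; apply: (mulIf p0).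
by rewrite -!mulrA mulVf// mulr1 -h.
Qed.

Lemma poch_den y k : 0 < y ->
  (poch y k)^-1 * y = (y + k%:~R) * (poch (y + 1) k)^-1.
Proof.
move=> y0; case: k => n /=.
  have h := prod_addn_shift y n.
  have p1 x : 0 < x -> \prod_(i < n) (x + i%:R) != 0.
    by move=> x0; apply/prodf_neq0 => i _; rewrite gt_eqF// ltr_wpDr.
  have := p1 y y0; have := p1 (y + 1) (addr_gt0 y0 ltr01).
  move: h; rewrite -pmulrn; move: (\prod_(i < _) _) (\prod_(i < _) _) => p q h q0 p0.
  apply: (mulfI p0); rewrite !mulrA mulfV// mul1r h -mulrA mulfV ?mulr1//.
rewrite !invrK NegzE mulrNz -pmulrn big_ord_recr [in RHS]big_ord_recl /=.
have -> : \prod_(i < n) (y + 1 - (bump 0 i).+1%:R) = \prod_(i < n) (y - i.+1%:R).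
  by apply: eq_bigr => i _; rewrite /bump /= add1n -[in LHS]natr1; ring.
by move: (\prod_(i < n) _) => p; ring.
Qed.

Definition poch_ratio x y k := poch (x - k%:~R) k / poch y k.

(** The quotient is Gamma(x) Gamma(y) / (Gamma(x - k) Gamma(y + k)). Positivity is required of x and
    y alone, and x - k or y + k may vanish or be negative, so the zeros of the transform are
    included. *)
Lemma poch_ratioS x y k : 0 < x -> 0 < y ->
  poch_ratio x y k = (x - k%:~R) * (y + k%:~R) / (x * y) * poch_ratio (x + 1) (y + 1) k.
Proof.
move=> x0 y0; have xn : x != 0 by rewrite gt_eqF.
have yn : y != 0 by rewrite gt_eqF.
apply: (mulIf (mulf_neq0 xn yn)); rewrite /poch_ratio.
transitivity ((poch (x - k%:~R) k * x) * ((poch y k)^-1 * y)); first by ring.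
rewrite poch_num// poch_den//.
move: (poch (x + 1 - _) k) ((poch (y + 1) k)^-1) => p q.
by field; rewrite xn yn.
Qed.

Lemma poch_ratio_cvg x y k :
  poch_ratio (x + n%:R) (y + n%:R) k @[n --> \oo] --> (1 : R).
Proof.
case: k => p.
  pose u (i : 'I_p) : R := x - p%:~R + i%:R; pose v (i : 'I_p) : R := y + i%:R.
  have := cvg_prod1 (index_enum 'I_p) (fun i => ratio_cvg1 (u i) (v i)).
  apply: cvg_trans; apply: near_eq_cvg; apply: nearW => n /=.
  rewrite /poch_ratio /= -prodf_div; apply: eq_bigr => i _.
  by congr (_ / _); rewrite /u /v; ring.
pose u (i : 'I_p.+1) : R := y - i.+1%:R; pose v (i : 'I_p.+1) : R := x + i%:R.
have := cvg_prod1 (index_enum 'I_p.+1) (fun i => ratio_cvg1 (u i) (v i)).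
apply: cvg_trans; apply: near_eq_cvg; apply: nearW => n /=.
rewrite /poch_ratio /= NegzE mulrNz opprK -pmulrn prod_sub_rev invrK mulrC -prodf_div.
by apply: eq_bigr => i _; congr (_ / _); rewrite /u /v; ring.
Qed.

Lemma poch_reflect x k : poch (1 - x) k = (-1) ^ k * poch (x - k%:~R) k.
Proof.
have sgn n (f : 'I_n -> R) : \prod_i (- f i) = (-1) ^+ n * \prod_i f i.
  by rewrite prodrN card_ord.
case: k => n /=.
  rewrite -pmulrn -exprnP -sgn (reindex_inj rev_ord_inj); apply: eq_bigr => i _ /=.
  by rewrite natrB// -natr1; ring.
rewrite NegzE mulrNz opprK -pmulrn prod_sub_rev -exprnN -invfM -sgn; congr (_^-1).
by apply: eq_bigr => i _; rewrite -natr1; ring.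
Qed.

End Pochhammer.

(** * The value of the normalised mean of phi *)

Section SphericalMeans.
Local Open Scope classical_set_scope.
Local Open Scope ring_scope.
Local Open Scope complex_scope.
Context {R : realType} {r : nat}.
Variables a b iota e : R.
Hypotheses (a_ge0 : 0 <= a) (b_ge0 : 0 <= b) (iota_ge0 : 0 <= iota).
Hypothesis (e1 : e = 1 \/ e = -1).
Notation de i := (delta_mx 0 i : 'rV[int]_r).
Notation cint := (@cint R r a b iota e).
Notation mass := (@mass R r a b iota e).

(** The two sequences are compared by the cross product u_0 w_n = w_0 u_n, which avoids dividing by
    q n; in the application q n may be 0. *)
Lemma recurrence_limit (q u w : nat -> R) (f0 : R) :
  (forall n, u n = q n * u n.+1) -> (forall n, w n = q n * w n.+1) ->
  u n @[n --> \oo] --> f0 -> w n @[n --> \oo] --> (1 : R) -> u 0 = w 0 * f0.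
Proof.
move=> hu hw cu cw.
have prop n : exists X, u 0 = X * u n /\ w 0 = X * w n.
  elim: n => [|n [X [uX wX]]]; first by exists 1; rewrite !mul1r.
  by exists (X * q n); rewrite -!mulrA -hu -hw.
have eqn n : u 0 * w n = w 0 * u n by have [X [-> ->]] := prop n; ring.
have l1 : u 0 * w n @[n --> \oo] --> u 0 * 1 by apply: cvgMr.
have l2 : u 0 * w n @[n --> \oo] --> w 0 * f0.
  by under eq_fun do rewrite eqn; apply: cvgMr.
by rewrite -[LHS]mulr1; apply: (cvg_unique _ l1 l2); exact: norm_hausdorff.
Qed.

Variables (m : 'I_r -> int) (phi : 'rV[R]_r -> R[i]) (l : @trig_poly R r).
Hypotheses (hphi : jacobi_polynomial a b iota m phi) (phiE : phi = ev l).
Hypothesis (m2 : forall j, (2 %| m j)%Z).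
Variable p0 : 'rV[R]_r.
Hypothesis ez_p0 : forall j, ez (de j) p0 = e%:C.

(** Here lam - rho_j = 2 X_j and lam + rho_j = 2 Y_j. Passing from rho_j to rho_j + m_j with m_j = 2
    k_j gives X_j - k_j and Y_j + k_j; these shifts are the origin of the two Pochhammer symbols. *)
Let X (kappa : R) (j : 'I_r) := kappa + 1 + a / 2 * j%:R.
Let Y (kappa : R) (j : 'I_r) := kappa + 1 + iota + b + a * (r - 1)%:R - a / 2 * j%:R.
Let k (j : 'I_r) := (m j %/ 2)%Z.

Lemma X_gt0 (kappa : R) j : 0 <= kappa -> 0 < X kappa j.
Proof. by move=> k0; rewrite ltr_pwDl ?ltr_wpDl// mulr_ge0// divr_ge0. Qed.

Lemma Y_gt0 (kappa : R) j : 0 <= kappa -> 0 < Y kappa j.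
Proof.
move=> k0; rewrite /Y (natr_rank R j).
have -> : kappa + 1 + iota + b + a * ((r - j.+1)%:R + j%:R) - a / 2 * j%:R
    = (kappa + 1) + (iota + b + a * (r - j.+1)%:R + a / 2 * j%:R) by field.
by rewrite ltr_pwDl ?ltr_wpDl// !addr_ge0 ?mulr_ge0// divr_ge0.
Qed.

Lemma bs_factor_gt0 (kappa : R) (j : 'I_r) : 0 <= kappa -> 0 < bs_factor a b iota e kappa j.
Proof.
move=> k0; have an n : 0 <= a * n%:R by rewrite mulr_ge0.
have be : 0 <= b * (1 - e) by rewrite mulr_ge0//; case: e1 => ->; lra.
have h1 := an j; have h2 := an (r - j.+1)%N.
rewrite /bs_factor mulr_gt0//.
  by move: (a * _) h1 => x h1; lra.
move: (a * (r - j.+1)%:R) (b * (1 - e)) h2 be => x y h2 be.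
have -> : 2 * (kappa + 1) - 1 + iota + x + y = (2 * kappa + 1) + (iota + x + y) by ring.
by rewrite ltr_pwDl ?addr_ge0// ltr_wpDl// mulr_ge0.
Qed.

Lemma gap_factor_XY kappa j : gap_factor a b iota kappa j = 4 * (X kappa j * Y kappa j).
Proof. by rewrite gap_factorE /X /Y (natr_rank R j); field. Qed.

Definition eigen_factor (kappa : R) (j : 'I_r) : R :=
  @shift R r a b iota kappa ^+ 2 - ((m j)%:~R + rho a b iota j) ^+ 2.

Lemma eigen_factor_XY kappa j :
  eigen_factor kappa j = 4 * ((X kappa j - (k j)%:~R) * (Y kappa j + (k j)%:~R)).
Proof.
rewrite /eigen_factor /shift /rho /X /Y (natr_rank R j).
have -> : (m j)%:~R = (k j)%:~R * 2 :> R by rewrite -[in LHS](divzK (m2 j)) intrM.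
by field.
Qed.

Lemma cint_step (kappa : R) : 0 <= kappa ->
  (\prod_(j < r) bs_factor a b iota e kappa j)%:C * cint kappa l
    = (\prod_(j < r) eigen_factor kappa j)%:C * cint (kappa + 1) l.
Proof.
move=> k0; apply: (@cint_recurrence R r a b iota e a_ge0 b_ge0 iota_ge0 e1 kappa l _ k0).
exact: (jacobi_palindrome a_ge0 b_ge0 iota_ge0 _ hphi phiE).
Qed.

Lemma cint_value (kappa : R) : 0 <= kappa ->
  cint kappa l = (mass kappa * \prod_(j < r) poch_ratio (X kappa j) (Y kappa j) (k j))%:C
    * ev l p0.
Proof.
move=> k0.
have kn n : 0 <= kappa + n%:R :> R by rewrite addr_ge0.
pose w n := \prod_(j < r) poch_ratio (X kappa j + n%:R) (Y kappa j + n%:R) (k j).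
pose q n := \prod_(j < r) (eigen_factor (kappa + n%:R) j / gap_factor a b iota (kappa + n%:R) j).
have XE n j : X (kappa + n%:R) j = X kappa j + n%:R by rewrite /X; ring.
have YE n j : Y (kappa + n%:R) j = Y kappa j + n%:R by rewrite /Y; ring.
have w1 : w n @[n --> \oo] --> (1 : R).
  by apply: cvg_prod1 => j; exact: poch_ratio_cvg.
have wq n : w n = q n * w n.+1.
  rewrite -big_split; apply: eq_bigr => j _ /=.
  rewrite poch_ratioS -?XE -?YE ?X_gt0 ?Y_gt0// eigen_factor_XY gap_factor_XY !XE !YE.
  have := X_gt0 j (kn n); have := Y_gt0 j (kn n); rewrite XE YE => Y0 X0.
  rewrite (_ : n.+1%:R = n%:R + 1); last by rewrite natr1.
  rewrite !addrA; congr (_ * _).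
  by field; rewrite !gt_eqF.
have n0 : mass kappa != 0 by rewrite gt_eqF// mass_gt0.
(* Real and imaginary parts are treated at once, as functions P compatible with multiplication by
   reals. *)
have step (P : R[i] -> R) : (forall (x : R) y, P (x%:C * y) = x * P y) ->
    P (cint (kappa + n%:R) l) / mass (kappa + n%:R) @[n --> \oo] --> P (ev l p0) ->
    P (cint kappa l) = mass kappa * w 0 * P (ev l p0).
  move=> PZ cP.
  pose u n := P (cint (kappa + n%:R) l) / mass (kappa + n%:R).
  have uq n : u n = q n * u n.+1.
    have K0 : \prod_(j < r) bs_factor a b iota e (kappa + n%:R) j != 0.
      by apply/prodf_neq0 => j _; rewrite gt_eqF// bs_factor_gt0.
    have M0 : mass (kappa + n%:R) != 0 by rewrite gt_eqF// mass_gt0.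
    have M1 : mass (kappa + n.+1%:R) != 0 by rewrite gt_eqF// mass_gt0.
    have G0 : \prod_(j < r) gap_factor a b iota (kappa + n%:R) j != 0.
      apply/prodf_neq0 => j _; rewrite gap_factor_XY mulf_neq0 ?pnatr_eq0//.
      by rewrite mulf_neq0// gt_eqF// ?X_gt0// Y_gt0.
    have nE : kappa + n%:R + 1 = kappa + n.+1%:R by rewrite -[in RHS]natr1 addrA.
    move: K0 G0 M0 M1; rewrite /u /q prodf_div.
    set K := \prod_(j < r) bs_factor _ _ _ _ _ _.
    set G := \prod_(j < r) gap_factor _ _ _ _ _; set E := \prod_(j < r) eigen_factor _ _.
    have h1 : K * mass (kappa + n%:R) = G * mass (kappa + n.+1%:R).
      by rewrite -nE; exact: mass_recurrence.
    have h2 : K * P (cint (kappa + n%:R) l) = E * P (cint (kappa + n.+1%:R) l).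
      by rewrite -nE -!PZ cint_step.
    move: (mass (kappa + n%:R)) (mass (kappa + n.+1%:R)) h1 => M M' h1.
    move: (P (cint (kappa + n%:R) l)) (P (cint (kappa + n.+1%:R) l)) h2 => c c' h2.
    move=> K0 G0 M0 M'0.
    apply: (mulfI K0); apply: (mulfI M0); apply: (mulfI G0); apply: (mulfI M'0).
    transitivity (G * M' * (K * c)); first by field.
    by rewrite h2 -h1; field; rewrite ?G0 ?M'0.
  have := recurrence_limit uq wq cP w1; rewrite /u addr0 => h.
  by rewrite -mulrA -h mulrC divfK.
have [cR cI] := cint_concentration a_ge0 b_ge0 iota_ge0 e1 ez_p0 l k0.
have w0E : w 0%N = \prod_(j < r) poch_ratio (X kappa j) (Y kappa j) (k j).
  by apply: eq_bigr => j _; rewrite !addr0.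
rewrite -w0E; apply/eqP; rewrite eq_complex complex_ReZ complex_ImZ.
by rewrite (step _ (@complex_ReZ R) cR) (step _ (@complex_ImZ R) cI) !eqxx.
Qed.

End SphericalMeans.

(** * Integrals over the torus *)

Section Torus.
Local Open Scope classical_set_scope.
Local Open Scope ring_scope.
Local Open Scope complex_scope.
Context {R : realType} {r : nat}.
Variables a b iota e : R.
Hypotheses (a_ge0 : 0 <= a) (b_ge0 : 0 <= b) (iota_ge0 : 0 <= iota).
Hypothesis (e1 : e = 1 \/ e = -1).
Implicit Types (t : 'rV[R]_r) (l : @trig_poly R r).
Notation de i := (delta_mx 0 i : 'rV[int]_r).

Lemma prod_sym_pairs (A : 'I_r -> 'I_r -> R) : (forall i k, A i k = A k i) ->
  \prod_(i < r) \prod_(k < r | k != i) A i k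
    = \prod_(i < r) \prod_(k < r | (i < k)%N) A i k ^+ 2.
Proof.
move=> sym.
have -> : \prod_(i < r) \prod_(k < r | k != i) A i k
    = (\prod_(i < r) \prod_(k < r | (i < k)%N) A i k)
      * \prod_(i < r) \prod_(k < r | (k < i)%N) A i k.
  rewrite -big_split; apply: eq_bigr => i _ /=.
  rewrite (bigID (fun k : 'I_r => (i < k)%N)) /=; congr (_ * _); apply: eq_bigl => k;
    by rewrite -val_eqE /= neq_ltn; case: ltngtP.
rewrite [X in _ * X](exchange_big_dep xpredT) //= -big_split; apply: eq_bigr => i _ /=.
by rewrite -big_split; apply: eq_bigr => k _; rewrite /= expr2 [A k i]sym.
Qed.

Lemma qroot_sin (al : 'rV[int]_r) t : qroot al t = `|2 * sin (dz al t)| ^+ 2.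
Proof.
rewrite real_normK ?num_real// /qroot [in cos _]mulr_natl cos_mulr2n.
by have := cos2Dsin2 (dz al t); move: (cos _) (sin _) => c s h; lra.
Qed.

Lemma sqr_powR (x p : R) : 0 <= x -> (x ^+ 2) `^ p = x `^ (2 * p).
Proof. by move=> x0; rewrite powRrM powR_mulrn. Qed.

Lemma powR_half_sqr (x p : R) : (x `^ (p / 2)) ^+ 2 = x `^ p.
Proof. by rewrite -powR_mulrn ?powR_ge0// -powRrM divfK// pnatr_eq0. Qed.

Lemma powR_prod (I : Type) (s : seq I) (f : I -> R) p : (forall i, 0 <= f i) ->
  (\prod_(i <- s) f i) `^ p = \prod_(i <- s) f i `^ p.
Proof.
move=> f0; elim: s => [|i s IH]; first by rewrite !big_nil powR1.
by rewrite !big_cons powRM ?IH// prodr_ge0.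
Qed.

Lemma weight_density (g : R -> R) kappa t :
  (forall x, (1 + e * cos (2 * x)) / 2 = g x ^+ 2) ->
  weight a b iota e kappa 0 t
    = (\prod_(j < r) `|g (t 0 j)|) `^ (2 * kappa) * density a b iota t.
Proof.
move=> hg; rewrite /weight /density mulrCA; congr (_ * _).
  rewrite prod_sym_pairs => [|i k]; last first.
    have -> : qroot (de i - de k) t = qroot (de k - de i) t.
      by rewrite !qroot_sin !dz_deB -opprB sinN mulrN normrN.
    by rewrite [de i + de k]addrC.
  apply: eq_bigr => i _; apply: eq_bigr => k _; rewrite !addr0 !qroot_sin.
  rewrite dz_deB dz_deD exprMn !sqr_powR// [in RHS]normrM [in RHS]powRM//.
  have -> : 2 * (a / 4) = a / 2 :> R by field.
  by rewrite !powR_half_sqr.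
rewrite powR_prod// -big_split; apply: eq_bigr => j _ /=.
have d2 : dz (de j *+ 2) t = 2 * t 0 j by rewrite mulr2n dzD dz_delta; ring.
rewrite !addr0 !qroot_sin d2 dz_delta /qcos dz_delta hg -[g _ ^+ 2]real_normK ?num_real//.
by rewrite !sqr_powR// [2 * (iota / 2)]mulrC divfK ?pnatr_eq0// mulrC.
Qed.

Definition side_mult (j : 'I_r) : nat :=
  if (iota != 0) || (a != 0) && (0 < j)%N then 1 else 2.

Definition volume : R := \prod_(j < r) (pi * (side_mult j)%:R).

Lemma torus_side_mult : torus_side a iota = fun j : 'I_r => pi * (side_mult j)%:R.
Proof.
apply/funext => j; rewrite /torus_side /side_mult; case: ifP => _; first by rewrite mulr1.
by rewrite mulrC.
Qed.

Lemma torus_integral_mean (f F : 'rV[R]_r -> R) (L : R) :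
  (forall t, f t * density a b iota t = F t) -> ucont near_row F -> pi_periodic F ->
  gmean n.+1 F @[n --> \oo] --> L -> torus_integral a b iota f = volume * L.
Proof.
move=> fF Fu Fp FL; rewrite /torus_integral torus_side_mult.
rewrite (_ : (fun t => _) = F); last by apply/funext.
have c0 j : (0 < side_mult j)%N by rewrite /side_mult; case: ifP.
have := cvg_gmean c0 Fu Fp => /(cvg_unique (@norm_hausdorff _ _) FL) ->.
rewrite mulrC divfK//; apply/prodf_neq0 => j _.
by rewrite gt_eqF// mulr_gt0 ?pi_gt0// ltr0n.
Qed.

Variables (g : R -> R) (kappa : R).
Hypothesis kappa_ge0 : 0 <= kappa.
Hypothesis hg : forall x, (1 + e * cos (2 * x)) / 2 = g x ^+ 2.
Let G t := \prod_(j < r) `|g (t 0 j)|.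

Lemma torus_integral_mass :
  torus_integral a b iota (fun t => G t `^ (2 * kappa)) = volume * @mass R r a b iota e kappa.
Proof.
apply: torus_integral_mean => [t|||].
- by rewrite -(weight_density _ _ hg).
- exact: weight0_ucont.
- exact: weight_periodic.
- exact: mass_cvg.
Qed.

Lemma spherical_transform_cint l :
  spherical_transform a b iota (ev l) (fun t => G t `^ (2 * kappa))
    = volume%:C * cint a b iota e kappa l.
Proof.
have cn := cnice_cint a_ge0 b_ge0 iota_ge0 e1 l kappa_ge0.
have [cR cI cp] := cn; have [mR mI] := cmeanP cn.
apply/eqP; rewrite eq_complex complex_ReZ complex_ImZ /spherical_transform /=.
apply/andP; split; apply/eqP.
  apply: (torus_integral_mean _ cR _ mR) => [t|t v]; last by rewrite cp.
  by rewrite (weight_density _ _ hg) mulrC [in RHS]mulrC !complex_ReZ; ring.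
apply: (torus_integral_mean _ cI _ mI) => [t|t v]; last by rewrite cp.
by rewrite (weight_density _ _ hg) mulrC [in RHS]mulrC !complex_ImZ; ring.
Qed.

End Torus.

(** * Both spherical transforms *)

Lemma spherical_transform_value (R : realType) (r : nat) (a b iota e kappa : R)
    (a_ge0 : 0 <= a) (b_ge0 : 0 <= b) (iota_ge0 : 0 <= iota)
    (e1 : e = 1 \/ e = -1) (kappa_ge0 : 0 <= kappa) (g : R -> R)
    (hg : forall x, (1 + e * cos (2 * x)) / 2 = g x ^+ 2)
    (m : 'I_r -> int) (m2 : forall j, (2 %| m j)%Z)
    (phi : 'rV[R]_r -> R[i]) (hphi : jacobi_polynomial a b iota m phi)
    (p0 : 'rV[R]_r) (ez_p0 : forall j, ez (delta_mx 0 j) p0 = e%:C) :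
  spherical_transform a b iota phi (fun t => (\prod_(j < r) `|g (t 0 j)|) `^ (2 * kappa))
    = (torus_integral a b iota (fun t : 'rV[R]_r => (\prod_(j < r) `|g (t 0 j)|) `^ (2 * kappa))
       * \prod_(j < r)
           (poch (kappa + 1 + a / 2 * j%:R - (m j)%:~R / 2) (m j %/ 2)%Z
            / poch (kappa + 1 + iota + b + a * (r - 1)%:R - a / 2 * j%:R)
                (m j %/ 2)%Z))%:C * phi p0.
Proof.
have [l phiE _] := jacobi_trig_poly m2 hphi.
rewrite (torus_integral_mass a_ge0 b_ge0 iota_ge0 e1 kappa_ge0 hg).
rewrite {1}phiE (spherical_transform_cint a_ge0 b_ge0 iota_ge0 e1 kappa_ge0 hg).
rewrite (cint_value a_ge0 b_ge0 iota_ge0 e1 hphi phiE m2 ez_p0 kappa_ge0) phiE.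
rewrite mulrA -rmorphM -mulrA; congr ((_ * (_ * _))%:C * _).
apply: eq_bigr => j _; congr (poch (_ - _) _ / _).
by rewrite -[in RHS](divzK (m2 j)) intrM mulfK// intr_eq0.
Qed.

Theorem theorem4p3 (R : realType) (r : nat) (a b iota nu : R)
    (r_gt0 : (0 < r)%N) (a_ge0 : 0 <= a) (b_ge0 : 0 <= b)
    (iota_ge0 : 0 <= iota)
    (rank_r : [\/ 0 < iota, 0 < b | typeD r a b iota])
    (nu_ge0 : 0 <= nu)
    (m : 'I_r -> int) (hm : dominant_even a b iota m)
    (phi : 'rV[R]_r -> R[i]) (hphi : jacobi_polynomial a b iota m phi) :
  [/\ spherical_transform a b iota phi (fun t => absCos t `^ (2 * nu))
      = (normCos r a b iota nu
         * \prod_(j < r)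
             (poch (nu + 1 + a / 2 * j%:R - (m j)%:~R / 2) (m j %/ 2)%Z
              / poch (nu + 1 + iota + b + a * (r - 1)%:R - a / 2 * j%:R)
                  (m j %/ 2)%Z))%:C,
      spherical_transform a b iota phi (fun t => absSin t `^ (2 * nu))
      = (normSin r a b iota nu
         * \prod_(j < r)
             (poch (nu + 1 + a / 2 * j%:R - (m j)%:~R / 2) (m j %/ 2)%Z
              / poch (nu + 1 + iota + b + a * (r - 1)%:R - a / 2 * j%:R)
                  (m j %/ 2)%Z))%:C
        * phi half_pi_vec
    & (typeC b iota \/ typeD r a b iota) ->
      [/\ b = 0,
          phi half_pi_vec = \prod_(j < r) (-1) ^ (m j %/ 2)%Z
        & spherical_transform a b iota phi (fun t => absSin t `^ (2 * nu))
          = (normSin r a b iota nu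
             * \prod_(j < r)
                 (poch (- nu - a / 2 * j%:R) (m j %/ 2)%Z
                  / poch (nu + 1 + iota + b + a * (r - 1)%:R - a / 2 * j%:R)
                      (m j %/ 2)%Z))%:C]].
Proof.
have [m2 _ _] := hm; have [_ _ _ phi0] := hphi.
have sinE : spherical_transform a b iota phi (fun t => absSin t `^ (2 * nu))
      = (normSin r a b iota nu
         * \prod_(j < r)
             (poch (nu + 1 + a / 2 * j%:R - (m j)%:~R / 2) (m j %/ 2)%Z
              / poch (nu + 1 + iota + b + a * (r - 1)%:R - a / 2 * j%:R)
                  (m j %/ 2)%Z))%:C
        * phi half_pi_vec.
  apply: (@spherical_transform_value R r a b iota (-1) nu a_ge0 b_ge0 iota_ge0
    (or_intror erefl) nu_ge0 (@sin R) _ m m2 phi hphi half_pi_vec).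
    by move=> x; rewrite mulN1r mulr_natl cos_mulr2n cos2sin2; field.
  move=> j; rewrite /ez dz_delta mxE.
  have -> : 2 * (pi / 2) = pi :> R by field.
  by apply/eqP; rewrite eq_complex /= cospi sinpi !eqxx.
split=> [||CD]; last 1 first.
- have b0 : b = 0 by case: CD => -[].
  have half := jacobi_half_pi m2 hphi b0; split=> //.
  rewrite sinE half.
  have -> : \prod_(j < r) (-1) ^ (m j %/ 2)%Z
      = (\prod_(j < r) (-1) ^ (m j %/ 2)%Z : R)%:C :> R[i].
    rewrite rmorph_prod; apply: eq_bigr => j _ /=.
    by rewrite rmorphXz ?rmorphN1// unitrN1.
  rewrite -rmorphM -mulrA -big_split /=; congr ((_ * _)%:C); apply: eq_bigr => j _ /=.
  (* This form calls for [poch_reflect], whose sign is the factor of index j in the value of phi at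
     (pi/2, ..., pi/2). *)
  have -> : - nu - a / 2 * j%:R = 1 - (nu + 1 + a / 2 * j%:R) by ring.
  rewrite poch_reflect; have -> : (m j)%:~R / 2 = ((m j %/ 2)%Z)%:~R :> R.
    by rewrite -[in LHS](divzK (m2 j)) intrM mulfK// intr_eq0.
  by ring.
- rewrite -[RHS]mulr1 -[X in _ = _ * X]phi0.
  apply: (@spherical_transform_value R r a b iota 1 nu a_ge0 b_ge0 iota_ge0
    (or_introl erefl) nu_ge0 (@cos R) _ m m2 phi hphi 0).
    by move=> x; rewrite mul1r mulr_natl cos_mulr2n; field.
  by move=> j; rewrite /ez dz_delta mxE mulr0 expi0.
exact: sinE.
Qed.
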